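(* Let $B>0$ and let $\phi\in L^1(\mathbb R)$ satisfy $\operatorname{supp}\phi\subset[-B,B]$, $\overline{\phi(-x)}=\phi(x)$, and $\phi(x)\ne 0$ for a.e. $x\in[-B,B]$. Let $\psi(x)=\phi(x)(e^{2\pi i xb}-1)$, where $0<b\le 1/(2B)$. Suppose that $\{\omega_n\}_{n\ge1}=\{k/(4B)\}_{k\in\mathbb Z}$, or that $\{\omega_n\}_{n\ge1}$ is a sequence of positive numbers satisfying $\limsup_{n\to\infty} n/\omega_n>4B$. Suppose that $0<T\le 2B$ and $f\in L^1(T)$. Let $t_0,t_1\in\mathbb R$ be such that both $f\phi(\cdot-t_0)$ and $f\phi(\cdot-t_1)$ are integrable. If $(t_1-t_0)/T$ is an irrational number, then $f$ is determined up to a global phase by the measurements $$\{|\mathcal V_\phi f(t_j,\omega_n)|,\ |\mathcal V_\psi f(t_j,\omega_n)| : n\ge1,\ j=0,1\}.$$ Moreover, the conclusion fails if $(t_1-t_0)/T$ is a rational number.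
   Context: Signals are complex-valued functions on $\mathbb R$. $\mathbb T=\{z\in\mathbb C:|z|=1\}$. $L^1(T)$ denotes the space of all locally integrable functions on $\mathbb R$ which are periodic with period $T$. The short-time Fourier transform is $\mathcal V_\phi f(t,\omega)=\int_{\mathbb R} f(x)\overline{\phi(x-t)}e^{-2\pi i x\omega}\,dx$, defined when $f\phi(\cdot-t)$ is integrable. That $f$ is determined up to a global phase by the measurements means that every $g\in L^1(T)$ whose measurements are defined and equal to those of $f$ satisfies $f=\lambda g$ a.e. for some constant $\lambda\in\mathbb T$.
   Formalization: The sequence of positive numbers ω_n with limsup n/ω_n > 4B is additionally required to be strictly increasing; without an ordering the claim is false, e.g. for a constant sequence, where the limsup is infinite but finitely many measurements cannot determine f. *)

(* Defs.v *)
From mathcomp Require Import all_boot all_order all_algebra.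
From mathcomp Require Import complex.
From mathcomp Require Import all_classical all_reals all_analysis.

Set Implicit Arguments.
Unset Strict Implicit.
Unset Printing Implicit Defensive.

Import Order.TTheory GRing.Theory Num.Theory.
Import numFieldNormedType.Exports.

Local Open Scope classical_set_scope.
Local Open Scope ring_scope.
Local Open Scope complex_scope.

(* The Lebesgue integral of the library is defined for functions with values
   in \bar R; it is extended componentwise to complex-valued functions.
   As usual for L^1, pointwise conditions are meant almost everywhere. *)

Definition cintegrable (R : realType) (F : R -> R[i]) : Prop :=
  (@lebesgue_measure R).-integrable setT (fun x => (complex.Re (F x))%:E) /\
  (@lebesgue_measure R).-integrable setT (fun x => (complex.Im (F x))%:E).

Definition cintegral (R : realType) (F : R -> R[i]) : R[i] :=
  Rintegral (@lebesgue_measure R) setT (fun x => complex.Re (F x)) +i*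
  Rintegral (@lebesgue_measure R) setT (fun x => complex.Im (F x)).

Definition L1_periodic (R : realType) (T : R) (f : R -> R[i]) : Prop :=
  [/\ locally_integrable setT (fun x => complex.Re (f x)),
      locally_integrable setT (fun x => complex.Im (f x)) &
      {ae (@lebesgue_measure R), forall x, f (x + T) = f x}].

(* Support of a class of functions modulo a.e. equality: the complement of
   the largest open set on which the function vanishes a.e. *)
Definition ess_supp (R : realType) (F : R -> R[i]) : set R :=
  ~` \bigcup_(U in [set U : set R | open U /\
       {ae (@lebesgue_measure R), forall x, U x -> F x = 0}]) U.

Definition expi (R : realType) (theta : R) : R[i] := cos theta +i* sin theta.

Definition stft_defined (R : realType) (phi f : R -> R[i]) (t : R) : Prop :=
  cintegrable (fun x => f x * phi (x - t)).

(* A total function, meaningful when [stft_defined phi f t] holds. *)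
Definition stft (R : realType) (phi f : R -> R[i]) (t w : R) : R[i] :=
  cintegral (fun x => f x * conjc (phi (x - t)) * expi (- (2 * pi * x * w))).

(* The sequence omega is indexed by n >= 1; its value at 0 is never used. *)
Definition determined_up_to_phase (R : realType) (T : R)
    (phi psi : R -> R[i]) (omega : nat -> R) (t0 t1 : R) (f : R -> R[i]) :
    Prop :=
  forall g : R -> R[i],
    L1_periodic T g ->
    (forall t, t = t0 \/ t = t1 ->
       stft_defined phi g t /\ stft_defined psi g t) ->
    (forall t, t = t0 \/ t = t1 -> forall n, (1 <= n)%N ->
       `|stft phi f t (omega n)| = `|stft phi g t (omega n)| /\
       `|stft psi f t (omega n)| = `|stft psi g t (omega n)|) ->
    exists lambda : R[i], `|lambda| = 1 /\
      {ae (@lebesgue_measure R), forall x, f x = lambda * g x}.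

Definition critical_lattice (R : realType) (B : R) (omega : nat -> R) : Prop :=
  omega @` [set n | (1 <= n)%N] = [set k%:~R / (4 * B) | k in [set: int]].

(* The sequence has to be strictly increasing for limsup n / omega n to be the
   upper density of {omega n}: a constant sequence, or a suitable reordering of
   a sparse lattice, also makes this limsup infinite. *)
Definition supercritical_density (R : realType) (B : R) (omega : nat -> R) :
    Prop :=
  [/\ forall n, (1 <= n)%N -> 0 < omega n,
      forall m n, (1 <= m)%N -> (m < n)%N -> omega m < omega n &
      ((4 * B)%:E < limn_esup (fun n => (n%:R / omega n)%:E))%E].

(* Main.v *)
(* Fix t and put h x = f (x + t) * conj (phi x), which is supported in [-B, B].
   Up to unimodular factors the measurements at t are |H w| and |H (w + b) - H w|,
   where H is the Fourier transform of h. The function |H|^2 extends to an entire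
   function of exponential type 4 pi B, so it is determined by its samples: above
   the critical density because Jensen's formula bounds the number of real zeros,
   and on the critical lattice because |H|^2 is the Fourier transform of an
   autocorrelation supported in [-2B, 2B]. Hence Re (H (w + b) * conj (H w)) is
   known for all w, and by analyticity H (w + b) * conj (H w) is known up to a
   conjugation independent of w. Propagating the phase along w + bZ recovers h up
   to a phase, possibly after the reflection x |-> conj (h (- x)). By periodicity
   f = lam g or f = lam conj (g (2 t - .)) almost everywhere. If the reflection
   occurs at both t0 and t1, then f is an eigenvector of the translation by
   2 (t1 - t0), which for an irrational ratio forces f to be a multiple of one
   exponential, and then f = lam g after all. If (t1 - t0) / T = p / q, the
   function 1 + i exp (2 pi i q (x - t0) / T) has the same reflection about t0 and
   about t1, and this reflection is not a unimodular multiple of the function. *)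
Require Import Defs.
From mathcomp Require Import all_boot all_order all_algebra.
From mathcomp Require Import complex.
From mathcomp Require Import all_classical all_reals all_analysis.
From mathcomp Require Import measurable_realfun.
From mathcomp Require Import zify ring lra.
Import Order.TTheory GRing.Theory Num.Theory.
Import numFieldNormedType.Exports.
Local Open Scope classical_set_scope.
Local Open Scope ring_scope.
Local Open Scope complex_scope.
Set Implicit Arguments.
Unset Strict Implicit.
Unset Printing Implicit Defensive.

Import ComplexField.Normc.

(** The zero counts rest on one inequality: [|p(0)|] is at most the geometric mean of [|p|] on a
    circle. It is used on circles about real points, and on the unit circle carried to the real
    line, where it bounds the integral of [ln (C / |H|) / (1 + x^2)]. That bound makes the real
    zeros of [H] a null set unless [H] vanishes on the whole line, so a product of two such
    functions vanishes on the line only if one factor does.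

    The obstacle is that the zeros are known on a half-line only: Jensen's formula in one large disk
    would then give the density bound with twice the right constant. The remedy is small disks whose
    centres run over the interval that contains the zeros; the price is the integral of
    [ln (C / |H|)] over the centres, negligible by the bound above.

    The constants are period lengths. Spacing [1 / (4B)] matches the period [4B], which contains the
    differences of points of the support; spacing [b] matches the period [1 / b >= 2B], which
    contains the support; and the window of length [2B >= T] contains a period of [f]. *)

Section modulus.
Context {R : realType}.
Implicit Types (x y t : R) (z w : R[i]).

Lemma normc_norm z : `|z| = (normc z)%:C.
Proof. by []. Qed.

Lemma normc_ge0 z : 0 <= normc z.
Proof. by case: z => a b; rewrite /= sqrtr_ge0. Qed.

Lemma sqr_normcE z : normc z ^+ 2 = complex.Re z ^+ 2 + complex.Im z ^+ 2.
Proof. by case: z => a b; rewrite /= sqr_sqrtr// addr_ge0 ?sqr_ge0. Qed.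

Lemma normc_eq0 z : (normc z == 0) = (z == 0).
Proof.
apply/eqP/eqP => [/eq0_normc//|->]; exact: normc0.
Qed.

Lemma normc_gt0 z : (0 < normc z) = (z != 0).
Proof. by rewrite lt0r normc_eq0 normc_ge0 andbT. Qed.

Lemma normc_real x : normc x%:C = `|x|.
Proof. by rewrite /= expr0n addr0 sqrtr_sqr. Qed.

Lemma normc_conj z : normc (conjc z) = normc z.
Proof. by case: z => a b /=; rewrite sqrrN. Qed.

Lemma normcX z n : normc (z ^+ n) = normc z ^+ n.
Proof.
by elim: n => [|n IH]; rewrite ?expr0 ?normc1// !exprS normcM IH.
Qed.

Lemma normc_prod (I : Type) (s : seq I) (P : pred I) (F : I -> R[i]) :
  normc (\prod_(i <- s | P i) F i) = \prod_(i <- s | P i) normc (F i).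
Proof.
elim/big_rec2 : _ => [|i y z _ <-]; first exact: normc1.
by rewrite normcM.
Qed.

Lemma ler_normc_sum (I : Type) (s : seq I) (P : pred I) (F : I -> R[i]) :
  normc (\sum_(i <- s | P i) F i) <= \sum_(i <- s | P i) normc (F i).
Proof.
elim/big_rec2 : _ => [|i y z _ yz]; first by rewrite normc0.
by rewrite (le_trans (le_normcD _ _))// lerD2l.
Qed.

Lemma ler_normcB z w : normc (z - w) <= normc z + normc w.
Proof. by rewrite -(normcN w) le_normcD. Qed.

Lemma ler_dist_normc z w : normc z - normc w <= normc (z - w).
Proof. by rewrite lerBlDr -{1}(subrK w z) le_normcD. Qed.

Lemma normc_distC z w : normc (z - w) = normc (w - z).
Proof. by rewrite -normcN opprB. Qed.

Lemma ler_normr_dist_normc z w : `|normc z - normc w| <= normc (z - w).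
Proof.
by rewrite ler_norml ler_dist_normc andbT lerNl opprB normc_distC ler_dist_normc.
Qed.

Lemma Re_le_normc z : `|complex.Re z| <= normc z.
Proof.
by rewrite -(@ler_pXn2r _ 2) ?nnegrE ?normc_ge0// sqr_normcE real_normK ?num_real// lerDl sqr_ge0.
Qed.

Lemma Im_le_normc z : `|complex.Im z| <= normc z.
Proof.
by rewrite -(@ler_pXn2r _ 2) ?nnegrE ?normc_ge0// sqr_normcE real_normK ?num_real// lerDr sqr_ge0.
Qed.

Lemma normc_le_ReIm z : normc z <= `|complex.Re z| + `|complex.Im z|.
Proof.
case: z => a b.
rewrite (_ : a +i* b = a%:C + 'i * b%:C); last by rewrite [LHS]complexE.
rewrite (le_trans (le_normcD _ _))// normcM !normc_real /=.
by rewrite expr0n add0r expr1n sqrtr1 mul1r !(mul0r,mulr0,mul1r,mulr1,subr0,addr0,add0r).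
Qed.

Lemma mulc_conj z : z * conjc z = (normc z ^+ 2)%:C.
Proof. by rewrite sqr_normcE; case: z => a b /=; apply/eqP; rewrite eq_complex /=; apply/andP; split; apply/eqP; ring. Qed.

Lemma conjcM z w : conjc (z * w) = conjc z * conjc w.
Proof. exact: rmorphM. Qed.

Lemma ReD z w : complex.Re (z + w) = complex.Re z + complex.Re w.
Proof. by case: z w => [? ?] []. Qed.
Lemma ImD z w : complex.Im (z + w) = complex.Im z + complex.Im w.
Proof. by case: z w => [? ?] []. Qed.
Lemma ReM z w : complex.Re (z * w) = complex.Re z * complex.Re w - complex.Im z * complex.Im w.
Proof. by case: z w => [? ?] []. Qed.
Lemma ImM z w : complex.Im (z * w) = complex.Re z * complex.Im w + complex.Im z * complex.Re w.
Proof. by case: z w => [? ?] [? ?] /=; rewrite addrC. Qed.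
Lemma ReN z : complex.Re (- z) = - complex.Re z.
Proof. by case: z. Qed.
Lemma ImN z : complex.Im (- z) = - complex.Im z.
Proof. by case: z. Qed.
Lemma Re_conj z : complex.Re (conjc z) = complex.Re z.
Proof. by case: z. Qed.
Lemma Im_conj z : complex.Im (conjc z) = - complex.Im z.
Proof. by case: z. Qed.

Lemma complex_ext z w : complex.Re z = complex.Re w ->
  complex.Im z = complex.Im w -> z = w.
Proof. by case: z w => a b [c d] /= -> ->. Qed.

End modulus.

(** * Unimodular and complex exponentials *)

Section cexp.
Context {R : realType}.
Implicit Types (x y t : R) (z w : R[i]).

Lemma expiD x y : expi (x + y) = expi x * expi y.
Proof. by apply: complex_ext; rewrite ?ReM ?ImM /= ?cosD ?sinD 1?addrC. Qed.

Lemma expi0 : expi 0 = 1 :> R[i].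
Proof. by rewrite /expi cos0 sin0. Qed.

Lemma expiN x : expi (- x) = conjc (expi x).
Proof. by rewrite /expi cosN sinN. Qed.

Lemma normc_expi x : normc (expi x) = 1.
Proof. by rewrite /= cos2Dsin2 sqrtr1. Qed.

Lemma expi_neq0 x : expi x != 0.
Proof. by rewrite -normc_gt0 normc_expi. Qed.

Lemma expiMn x n : expi (n%:R * x) = expi x ^+ n.
Proof.
elim: n => [|n IH]; first by rewrite mul0r expi0 expr0.
by rewrite -natr1 mulrDl mul1r expiD IH exprSr.
Qed.

Lemma expi_2piz (k : int) : expi (2 * pi * k%:~R) = 1 :> R[i].
Proof.
have h (n : nat) : expi (2 * pi * n%:R) = 1 :> R[i].
  rewrite mulrC expiMn /expi (_ : 2 * pi = pi *+ 2); last by rewrite mulr_natl.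
  by rewrite cos2pi sin2pi expr1n.
case: k => n; first exact: h.
by rewrite NegzE mulrNz mulrN expiN h conjc1.
Qed.

Lemma expi_pi : expi pi = -1 :> R[i].
Proof. by rewrite /expi cospi sinpi; apply/eqP; rewrite eq_complex /= oppr0 !eqxx. Qed.

Definition cexp z : R[i] := (expR (complex.Re z))%:C * expi (complex.Im z).

Lemma cexpD z w : cexp (z + w) = cexp z * cexp w.
Proof. by rewrite /cexp ReD ImD expRD expiD rmorphM /= mulrACA. Qed.

Lemma cexp0 : cexp 0 = 1.
Proof. by rewrite /cexp /= expR0 expi0 mulr1. Qed.

Lemma normc_cexp z : normc (cexp z) = expR (complex.Re z).
Proof. by rewrite normcM normc_real normc_expi mulr1 ger0_norm// expR_ge0. Qed.

Lemma cexpMn z n : cexp (n%:R * z) = cexp z ^+ n.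
Proof.
elim: n => [|n IH]; first by rewrite mul0r cexp0 expr0.
by rewrite -natr1 mulrDl mul1r cexpD IH exprSr.
Qed.

Lemma cexp_i x : cexp (x *i) = expi x.
Proof. by rewrite /cexp /= expR0 mul1r. Qed.

End cexp.

(** * Integration of complex-valued functions *)

Section complex_integral.
Context {R : realType}.
Notation mu := (@lebesgue_measure R).
Implicit Types (D : set R) (F G : R -> R[i]) (g : R -> R).

Definition cmeas D F := measurable_fun D (fun x => complex.Re (F x)) /\
  measurable_fun D (fun x => complex.Im (F x)).

(** For [D = setT], [cintble] and [cint] are convertible to [cintegrable] and [cintegral]; a general
    [D] serves the integrals over a period or over the window. *)
Definition cintble D F := mu.-integrable D (fun x => (complex.Re (F x))%:E) /\
  mu.-integrable D (fun x => (complex.Im (F x))%:E).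

Definition cint D F : R[i] :=
  Rintegral mu D (fun x => complex.Re (F x)) +i*
  Rintegral mu D (fun x => complex.Im (F x)).

(** Convergence is expressed through the modulus, so that every limit is taken in [R]. *)
Definition ccvg (u : nat -> R[i]) (l : R[i]) :=
  (fun n => normc (u n - l)) @ \oo --> (0 : R).

Lemma cmeasS D1 D2 F : measurable D2 -> D1 `<=` D2 -> cmeas D2 F -> cmeas D1 F.
Proof. by move=> mD sD [h1 h2]; split; apply: measurable_funS sD _. Qed.

Lemma cmeasD D F G : cmeas D F -> cmeas D G -> cmeas D (fun x => F x + G x).
Proof.
move=> [F1 F2] [G1 G2]; split.
- under eq_fun do rewrite ReD; exact: measurable_funD.
- under eq_fun do rewrite ImD; exact: measurable_funD.
Qed.

Lemma cmeasM D F G : cmeas D F -> cmeas D G -> cmeas D (fun x => F x * G x).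
Proof.
move=> [F1 F2] [G1 G2]; split.
- under eq_fun do rewrite ReM; apply: measurable_funB; exact: measurable_funM.
- under eq_fun do rewrite ImM; apply: measurable_funD; exact: measurable_funM.
Qed.

Lemma cmeas_cst D (c : R[i]) : cmeas D (fun=> c).
Proof. by split; exact: measurable_cst. Qed.

Lemma cmeas_conj D F : cmeas D F -> cmeas D (fun x => conjc (F x)).
Proof.
move=> [F1 F2]; split.
- by under eq_fun do rewrite Re_conj.
- by under eq_fun do rewrite Im_conj; exact: measurableT_comp.
Qed.

Lemma cmeasB D F G : cmeas D F -> cmeas D G -> cmeas D (fun x => F x - G x).
Proof.
move=> [F1 F2] [G1 G2]; split.
- under eq_fun do rewrite ReD ReN; exact: measurable_funB.
- under eq_fun do rewrite ImD ImN; exact: measurable_funB.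
Qed.

Lemma cmeas_real D g : measurable_fun D g -> cmeas D (fun x => (g x)%:C).
Proof. by move=> mg; split => //=; exact: measurable_cst. Qed.

Lemma cmeasX D F n : cmeas D F -> cmeas D (fun x => F x ^+ n).
Proof.
move=> mF; elim: n => [|n IH].
  by under eq_fun do rewrite expr0; exact: cmeas_cst.
by under eq_fun do rewrite exprS; exact: cmeasM.
Qed.

Lemma measurable_cosR : measurable_fun [set: R] (@cos R).
Proof. by apply: continuous_measurable_fun; exact: continuous_cos. Qed.

Lemma measurable_sinR : measurable_fun [set: R] (@sin R).
Proof. by apply: continuous_measurable_fun; exact: continuous_sin. Qed.

Lemma cmeas_expi D g : measurable_fun D g -> cmeas D (fun x => expi (g x)).
Proof.
move=> mg; split => /=.
- by apply: measurableT_comp => //; exact: measurable_cosR.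
- by apply: measurableT_comp => //; exact: measurable_sinR.
Qed.

Lemma cmeas_cexp D F : cmeas D F -> cmeas D (fun x => cexp (F x)).
Proof.
move=> [F1 F2]; rewrite /cexp; apply: cmeasM; last exact: cmeas_expi.
apply: cmeas_real; apply: measurableT_comp => //; exact: measurable_expR.
Qed.

Lemma measurable_normc D F : cmeas D F -> measurable_fun D (fun x => normc (F x)).
Proof.
move=> [F1 F2].
have -> : (fun x => normc (F x)) =
    (fun x => Num.sqrt (complex.Re (F x) ^+ 2 + complex.Im (F x) ^+ 2)).
  by apply/funext => x; rewrite -sqr_normcE sqrtr_sqr ger0_norm ?normc_ge0.
apply: (@measurableT_comp _ _ _ _ _ _ (@Num.sqrt R)) => //.
  apply: continuous_measurable_fun; exact: sqrt_continuous.
by apply: measurable_funD; apply: measurable_funX.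
Qed.

Lemma cintble_meas D F : cintble D F -> cmeas D F.
Proof. by move=> [/measurable_int /measurable_EFinP h1 /measurable_int /measurable_EFinP]. Qed.

Lemma cintble_le D F g : measurable D -> cmeas D F ->
  mu.-integrable D (fun x => (g x)%:E) -> (forall x, D x -> normc (F x) <= g x) ->
  cintble D F.
Proof.
move=> mD [F1 F2] ig Fg; split; apply: le_integrable ig => //=.
- exact/measurable_EFinP.
- move=> x Dx; rewrite lee_fin; apply: le_trans (Re_le_normc _) _.
  exact: le_trans (Fg _ Dx) (ler_norm _).
- exact/measurable_EFinP.
- move=> x Dx; rewrite lee_fin; apply: le_trans (Im_le_normc _) _.
  exact: le_trans (Fg _ Dx) (ler_norm _).
Qed.

Lemma cintble_normc D F : measurable D -> cintble D F ->
  mu.-integrable D (fun x => (normc (F x))%:E).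
Proof.
move=> mD iF; have [F1 F2] := cintble_meas iF; move: iF => [i1 i2].
have i3 : mu.-integrable D (fun x => `|(complex.Re (F x))%:E| + `|(complex.Im (F x))%:E|)%E.
  by apply: integrableD => //; exact: integrable_abse.
apply: le_integrable i3 => //.
  by apply/measurable_EFinP; apply: measurable_normc.
move=> x Dx /=; rewrite lee_fin ger0_norm ?normc_ge0//.
by apply: le_trans (ler_norm _); exact: normc_le_ReIm.
Qed.

Lemma cintbleS D1 D2 F : measurable D1 -> measurable D2 -> D1 `<=` D2 -> cintble D2 F -> cintble D1 F.
Proof. by move=> m1 m2 s [i1 i2]; split; [apply: integrableS i1|apply: integrableS i2]. Qed.

Lemma cintbleM D F G M : measurable D -> cintble D F -> cmeas D G ->
  (forall x, D x -> normc (G x) <= M) -> cintble D (fun x => F x * G x).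
Proof.
move=> mD iF mG GM.
apply: (@cintble_le D _ (fun x => M * normc (F x))) => //.
- by apply: cmeasM => //; exact: cintble_meas.
- under eq_fun do rewrite EFinM; apply: integrableZl => //; exact: cintble_normc.
- move=> x Dx; rewrite normcM mulrC ler_wpM2r ?normc_ge0//; exact: GM.
Qed.

Lemma cintbleD D F G : measurable D -> cintble D F -> cintble D G ->
  cintble D (fun x => F x + G x).
Proof.
move=> mD [F1 F2] [G1 G2]; split.
- by under eq_fun do rewrite ReD EFinD; exact: integrableD.
- by under eq_fun do rewrite ImD EFinD; exact: integrableD.
Qed.

Lemma cintbleZ D F c : measurable D -> cintble D F -> cintble D (fun x => F x * c).
Proof. by move=> mD iF; apply: (@cintbleM D F _ (normc c)) => //; exact: cmeas_cst. Qed.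

Lemma cintble_eq D F G : measurable D -> {in D, F =1 G} -> cintble D F -> cintble D G.
Proof.
move=> mD FG [F1 F2]; split; [move: F1|move: F2]; apply: eq_integrable => // x Dx;
  by rewrite FG.
Qed.

Lemma cintble_conj D F : measurable D -> cintble D F -> cintble D (fun x => conjc (F x)).
Proof.
move=> mD [F1 F2]; split.
- by under eq_fun do rewrite Re_conj.
- by under eq_fun do rewrite Im_conj EFinN; exact: integrableN.
Qed.

Lemma cintbleB D F G : measurable D -> cintble D F -> cintble D G ->
  cintble D (fun x => F x - G x).
Proof.
move=> mD iF iG; apply: (@cintble_eq _ (fun x => F x + G x * (-1))) => //.
  by move=> x _; rewrite mulrN1.
by apply: cintbleD => //; exact: cintbleZ.
Qed.

Lemma eq_cint D F G : {in D, F =1 G} -> cint D F = cint D G.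
Proof. by move=> FG; congr Complex; apply: eq_Rintegral => x Dx; rewrite FG. Qed.

Lemma cintD D F G : measurable D -> cintble D F -> cintble D G ->
  cint D (fun x => F x + G x) = cint D F + cint D G.
Proof.
move=> mD [F1 F2] [G1 G2]; apply: complex_ext; rewrite ?ReD ?ImD /=.
- by rewrite -RintegralD//; apply: eq_Rintegral => x _; rewrite ReD.
- by rewrite -RintegralD//; apply: eq_Rintegral => x _; rewrite ImD.
Qed.

Lemma integrable_mulr D g (c : R) : measurable D -> mu.-integrable D (fun x => (g x)%:E) ->
  mu.-integrable D (fun x => (g x * c)%:E).
Proof.
by move=> mD ig; under eq_fun do rewrite EFinM; exact: integrableZr.
Qed.

Lemma integrable_subr D (f g : R -> R) : measurable D ->
  mu.-integrable D (fun x => (f x)%:E) -> mu.-integrable D (fun x => (g x)%:E) ->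
  mu.-integrable D (fun x => (f x - g x)%:E).
Proof. by move=> mD fi gi; under eq_fun do rewrite EFinB; exact: integrableB. Qed.

Lemma cintZ D F c : measurable D -> cintble D F ->
  cint D (fun x => F x * c) = cint D F * c.
Proof.
move=> mD [F1 F2]; apply: complex_ext; rewrite ?ReM ?ImM /=.
- transitivity (Rintegral mu D (fun x => complex.Re (F x) * complex.Re c - complex.Im (F x) * complex.Im c)).
    by apply: eq_Rintegral => x _; rewrite ReM.
  by rewrite RintegralB ?RintegralZr//=; exact: integrable_mulr.
- transitivity (Rintegral mu D (fun x => complex.Re (F x) * complex.Im c + complex.Im (F x) * complex.Re c)).
    by apply: eq_Rintegral => x _; rewrite ImM.
  by rewrite RintegralD ?RintegralZr//=; exact: integrable_mulr.
Qed.

Lemma cintB D F G : measurable D -> cintble D F -> cintble D G ->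
  cint D (fun x => F x - G x) = cint D F - cint D G.
Proof.
move=> mD iF iG; rewrite -[in RHS]mulrN1 -cintZ// -cintD//; last exact: cintbleZ.
by apply: eq_cint => x _; rewrite mulrN1.
Qed.

Lemma cint_conj D F : measurable D -> cintble D F ->
  cint D (fun x => conjc (F x)) = conjc (cint D F).
Proof.
move=> mD [F1 F2]; apply: complex_ext; rewrite ?Re_conj ?Im_conj /=.
- by apply: eq_Rintegral => x _; rewrite Re_conj.
- rewrite -mulN1r -RintegralZl//; by apply: eq_Rintegral => x _; rewrite Im_conj mulN1r.
Qed.

Lemma cint0 D : measurable D -> cint D (fun=> 0) = 0.
Proof. by move=> mD; apply: complex_ext => /=; rewrite Rintegral_cst// mul0r. Qed.

Lemma cintble0 D : measurable D -> cintble D (fun=> 0).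
Proof. by move=> mD; split; exact: integrable0. Qed.

Lemma cintble_sum D (I : Type) (s : seq I) (P : pred I) (F : I -> R -> R[i]) : measurable D ->
  (forall i, P i -> cintble D (F i)) -> cintble D (fun x => \sum_(i <- s | P i) F i x).
Proof.
move=> mD iF; elim: s => [|i s IH].
  by apply: cintble_eq mD _ (cintble0 mD) => x _; rewrite big_nil.
case: (boolP (P i)) => Pi.
  apply: cintble_eq mD _ (cintbleD mD (iF i Pi) IH) => x _; by rewrite big_cons Pi.
by apply: cintble_eq mD _ IH => x _; rewrite big_cons (negbTE Pi).
Qed.

Lemma cint_sum D (I : Type) (s : seq I) (P : pred I) (F : I -> R -> R[i]) : measurable D ->
  (forall i, P i -> cintble D (F i)) ->
  cint D (fun x => \sum_(i <- s | P i) F i x) = \sum_(i <- s | P i) cint D (F i).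
Proof.
move=> mD iF; elim: s => [|i s IH].
  by rewrite big_nil -[RHS](cint0 mD); apply: eq_cint => x _; rewrite big_nil.
rewrite big_cons; case: (boolP (P i)) => Pi.
  rewrite -IH -cintD//; [|exact: iF|exact: cintble_sum].
  by apply: eq_cint => x _; rewrite big_cons Pi.
by rewrite -IH; apply: eq_cint => x _; rewrite big_cons (negbTE Pi).
Qed.

(** A unimodular constant [u] turns the integral onto the positive real axis; its modulus is then
    the integral of [Re (F u)], which [normc F] dominates pointwise. *)
Lemma le_normc_cint D F : measurable D -> cintble D F ->
  normc (cint D F) <= Rintegral mu D (fun x => normc (F x)).
Proof.
move=> mD iF; set c := cint D F.
have [c0|c0] := eqVneq c 0.
  by rewrite c0 normc0; apply: Rintegral_ge0 => x _; exact: normc_ge0.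
have nc0 : 0 < normc c by rewrite normc_gt0.
set u := conjc c * ((normc c)^-1)%:C.
have uc : c * u = (normc c)%:C.
  rewrite /u mulrA mulc_conj -rmorphM /= expr2 mulfK//; exact: lt0r_neq0.
have nu : normc u = 1.
  rewrite /u normcM normc_conj normc_real ger0_norm ?invr_ge0 ?normc_ge0//.
  by rewrite divff// lt0r_neq0.
have h : complex.Re (cint D (fun x => F x * u)) = normc c by rewrite cintZ// uc.
rewrite -h /=; apply: le_Rintegral => //.
- by have [] := cintbleZ u mD iF.
- exact: cintble_normc.
- move=> x Dx; apply: le_trans (ler_norm _) _; apply: le_trans (Re_le_normc _) _.
  by rewrite normcM nu mulr1.
Qed.

Lemma ccvg_ReIm (u : nat -> R[i]) (l : R[i]) :
  (fun n => complex.Re (u n)) @ \oo --> complex.Re l ->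
  (fun n => complex.Im (u n)) @ \oo --> complex.Im l -> ccvg u l.
Proof.
move=> h1 h2; rewrite /ccvg.
apply: (@squeeze_cvgr _ _ _ _ (fun=> 0) (fun n => `|complex.Re (u n) - complex.Re l| + `|complex.Im (u n) - complex.Im l|)).
- apply: nearW => n; rewrite normc_ge0 /= (le_trans (normc_le_ReIm _))//.
  by rewrite ReD ImD ReN ImN.
- exact: cvg_cst.
- rewrite -(addr0 0); apply: cvgD.
  + rewrite -(normr0 R); apply: cvg_norm; rewrite -(subrr (complex.Re l)).
    by apply: cvgB => //; exact: cvg_cst.
  + rewrite -(normr0 R); apply: cvg_norm; rewrite -(subrr (complex.Im l)).
    by apply: cvgB => //; exact: cvg_cst.
Qed.

Lemma ccvg_Re (u : nat -> R[i]) (l : R[i]) : ccvg u l ->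
  (fun n => complex.Re (u n)) @ \oo --> complex.Re l.
Proof.
move=> h; apply/cvgrPdist_le => e e0.
move/cvgrPdist_le : h => /(_ _ e0); apply: filterS => n.
rewrite sub0r normrN ger0_norm ?normc_ge0// => hn.
rewrite distrC; apply: le_trans hn; rewrite -ReN -ReD; exact: Re_le_normc.
Qed.

Lemma ccvg_Im (u : nat -> R[i]) (l : R[i]) : ccvg u l ->
  (fun n => complex.Im (u n)) @ \oo --> complex.Im l.
Proof.
move=> h; apply/cvgrPdist_le => e e0.
move/cvgrPdist_le : h => /(_ _ e0); apply: filterS => n.
rewrite sub0r normrN ger0_norm ?normc_ge0// => hn.
rewrite distrC; apply: le_trans hn; rewrite -ImN -ImD; exact: Im_le_normc.
Qed.

Lemma ccvg_unique (u : nat -> R[i]) (l l' : R[i]) : ccvg u l -> ccvg u l' -> l = l'.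
Proof.
move=> h h'; apply: complex_ext.
- exact: (cvg_unique _ (ccvg_Re h) (ccvg_Re h')).
- exact: (cvg_unique _ (ccvg_Im h) (ccvg_Im h')).
Qed.

Lemma ccvg_cst (l : R[i]) : ccvg (fun=> l) l.
Proof. by rewrite /ccvg subrr normc0; exact: cvg_cst. Qed.

Lemma ccvgM (u v : nat -> R[i]) (l m : R[i]) : ccvg u l -> ccvg v m ->
  ccvg (fun n => u n * v n) (l * m).
Proof.
move=> ul vm; apply: ccvg_ReIm; rewrite ?ReM ?ImM.
- under eq_fun do rewrite ReM; by apply: cvgB; apply: cvgM; (exact: ccvg_Re||exact: ccvg_Im).
- under eq_fun do rewrite ImM; by apply: cvgD; apply: cvgM; (exact: ccvg_Re||exact: ccvg_Im).
Qed.

Lemma ccvg_real (u : nat -> R) (l : R) : u @ \oo --> l -> ccvg (fun n => (u n)%:C) l%:C.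
Proof. by move=> h; apply: ccvg_ReIm => //=; exact: cvg_cst. Qed.

Lemma cmeas_cvg D (F_ : nat -> R -> R[i]) F : measurable D -> (forall n, cmeas D (F_ n)) ->
  (forall x, D x -> ccvg (F_ ^~ x) (F x)) -> cmeas D F.
Proof.
move=> mD mF h; split.
- apply: (@measurable_fun_cvg _ _ _ D (fun n x => complex.Re (F_ n x))) => //.
    by move=> n; case: (mF n).
  by move=> x Dx; exact: ccvg_Re (h x Dx).
- apply: (@measurable_fun_cvg _ _ _ D (fun n x => complex.Im (F_ n x))) => //.
    by move=> n; case: (mF n).
  by move=> x Dx; exact: ccvg_Im (h x Dx).
Qed.

Lemma cmeas_eq D F G : measurable D -> {in D, F =1 G} -> cmeas D F -> cmeas D G.
Proof.
move=> mD FG mF; apply: (cmeas_cvg mD (F_ := fun=> F)) => // x Dx.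
by rewrite FG ?inE//; exact: ccvg_cst.
Qed.

Lemma Rintegral_dct D (f_ : nat -> R -> R) (f g : R -> R) : measurable D ->
  (forall n, measurable_fun D (f_ n)) -> measurable_fun D f ->
  (forall x, D x -> (f_ ^~ x) @ \oo --> f x) ->
  mu.-integrable D (fun x => (g x)%:E) ->
  (forall n x, D x -> `|f_ n x| <= g x) ->
  (fun n => Rintegral mu D (f_ n)) @ \oo --> Rintegral mu D f.
Proof.
move=> mD mf_ mf h ig fg.
have [||||ifi _ cv] := @dominated_convergence _ _ _ mu D mD (fun n x => (f_ n x)%:E) (fun x => (f x)%:E) (fun x => (g x)%:E) _ _ _ ig _.
- by move=> n; apply/measurable_EFinP; exact: mf_.
- by apply/measurable_EFinP.
- by apply: aeW => x Dx; apply: cvg_EFin; [exact: nearW|exact: h].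
- by apply: aeW => x n Dx; rewrite abse_EFin lee_fin; exact: fg.
- apply: fine_cvg; rewrite fineK//; exact: integrable_fin_num.
Qed.

Lemma cint_dct D (F_ : nat -> R -> R[i]) F g : measurable D -> (forall n, cmeas D (F_ n)) ->
  (forall x, D x -> ccvg (F_ ^~ x) (F x)) ->
  mu.-integrable D (fun x => (g x)%:E) ->
  (forall n x, D x -> normc (F_ n x) <= g x) ->
  ccvg (fun n => cint D (F_ n)) (cint D F).
Proof.
move=> mD mF h ig Fg; have [m1 m2] := cmeas_cvg mD mF h.
apply: ccvg_ReIm => /=; apply: (Rintegral_dct (g := g)) => //.
- by move=> n; case: (mF n).
- by move=> x Dx; exact: ccvg_Re (h x Dx).
- by move=> n x Dx; apply: le_trans (Re_le_normc _) (Fg n x Dx).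
- by move=> n; case: (mF n).
- by move=> x Dx; exact: ccvg_Im (h x Dx).
- by move=> n x Dx; apply: le_trans (Im_le_normc _) (Fg n x Dx).
Qed.

Lemma ae_mono (P Q : set R) : (forall x, P x -> Q x) ->
  {ae mu, forall x, P x} -> {ae mu, forall x, Q x}.
Proof.
move=> PQ [N [mN N0 sub]]; exists N; split => // x /= nQ; apply: sub => /= Px.
by apply: nQ; exact: PQ.
Qed.

Lemma ae_conj (P Q : set R) : {ae mu, forall x, P x} -> {ae mu, forall x, Q x} ->
  {ae mu, forall x, P x /\ Q x}.
Proof.
move=> [N [mN N0 sN]] [M [mM M0 sM]]; exists (N `|` M); split.
- exact: measurableU.
- by rewrite null_set_setU.
- move=> x /= nPQ; have [Px|nP] := pselect (P x); last by left; apply: sN.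
  by right; apply: sM => /= Qx; apply: nPQ.
Qed.

Lemma ae_all (P : set R) : (forall x, P x) -> {ae mu, forall x, P x}.
Proof. by move=> h; exists set0; split => // x /=; have := h x. Qed.

Lemma ae_eq_cint D F G : measurable D -> cmeas D F -> cmeas D G ->
  {ae mu, forall x, D x -> F x = G x} -> cint D F = cint D G.
Proof.
move=> mD [F1 F2] [G1 G2] FG; congr Complex; congr fine; apply: ae_eq_integral => //;
  try (by apply/measurable_EFinP); by apply: ae_mono FG => x /= h Dx; rewrite h.
Qed.

End complex_integral.

(** * Jensen's inequality and entire functions *)

Section circle.
Context {R : realType}.
Implicit Types (x y t : R) (z w : R[i]).

Definition cis x : R[i] := expi (2 * pi * x).

Lemma cisD x y : cis (x + y) = cis x * cis y.
Proof. by rewrite /cis mulrDr expiD. Qed.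

Lemma cis0 : cis 0 = 1.
Proof. by rewrite /cis mulr0 expi0. Qed.

Lemma cis_int (k : int) : cis k%:~R = 1.
Proof. exact: expi_2piz. Qed.

Lemma cisMn x n : cis (n%:R * x) = cis x ^+ n.
Proof. by rewrite /cis mulrCA expiMn. Qed.

Lemma normc_cis x : normc (cis x) = 1.
Proof. exact: normc_expi. Qed.

Lemma cisN x : cis (- x) = conjc (cis x).
Proof. by rewrite /cis mulrN expiN. Qed.

(** Once the integer part is removed, [cos (2 pi y) = 1 - 2 sin (pi y) ^ 2] stays below [1] for
    [0 < y < 1]. *)
Lemma cis_eq1 x : cis x = 1 -> exists k : int, x = k%:~R.
Proof.
move=> h; exists (Num.floor x); apply/eqP; rewrite -subr_eq0; apply/eqP.
set y := x - _.
have hy : cis y = 1 by rewrite /y cisD h cisN cis_int conjc1 mulr1.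
have y0 : 0 <= y by rewrite subr_ge0; exact: floor_le.
have y1 : y < 1 by rewrite ltrBlDr addrC; have := floorD1_gt x; rewrite intrD.
apply/eqP; apply: contraT => yn0; have {yn0}y0 : 0 < y by rewrite lt_neqAle eq_sym yn0.
have s0 : 0 < sin (pi * y).
  by apply: sin_gt0_pi; rewrite mulr_gt0 ?pi_gt0//= -[ltRHS]mulr1 ltr_pM2l ?pi_gt0.
move: hy => /(congr1 (@complex.Re R)) /=.
rewrite (_ : 2 * pi * y = (pi * y) *+ 2); last by rewrite -mulr_natl; ring.
rewrite cos_mulr2n cos2sin2 => hc.
by have : 0 < sin (pi * y) ^+ 2 by [rewrite exprn_gt0|]; rewrite ltNge; nra.
Qed.

Lemma sum_roots_unity (N k : nat) : (0 < k < N)%N ->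
  \sum_(l < N) cis (l%:R / N%:R) ^+ k = 0.
Proof.
move=> /andP[k0 kN]; have N0 : (0 < N)%N by apply: leq_ltn_trans kN.
have NR : N%:R != 0 :> R by rewrite pnatr_eq0 -lt0n.
set u := cis (k%:R / N%:R).
have -> : \sum_(l < N) cis (l%:R / N%:R) ^+ k = \sum_(l < N) u ^+ l.
  apply: eq_bigr => l _; rewrite -!cisMn; congr cis; ring.
have u1 : u != 1.
  apply/eqP => /cis_eq1[j hj].
  have h0 : 0 < k%:R / N%:R :> R by rewrite divr_gt0 ?ltr0n.
  have h1 : k%:R / N%:R < 1 :> R by rewrite ltr_pdivrMr ?ltr0n// mul1r ltr_nat.
  move: h0 h1; rewrite hj ltr0z ltrz1 => h0 h1.
  by lia.
apply: (mulfI (x := u - 1)); first by rewrite subr_eq0.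
rewrite mulr0 -subrX1 -cisMn mulrC divfK//.
by rewrite (_ : k%:R = (Posz k)%:~R)// cis_int subrr.
Qed.

(** A discrete mean value property: with at least [size p] nodes, averaging over the roots of unity
    kills every monomial but the constant one. *)
Lemma poly_mean (p : {poly R[i]}) (r : R[i]) (N : nat) : (0 < N)%N -> (size p <= N)%N ->
  \sum_(l < N) p.[r * cis (l%:R / N%:R)] = p.[0] *+ N.
Proof.
move=> N0 sp.
under eq_bigr do rewrite (horner_coef_wide _ sp).
rewrite exchange_big /= (bigD1 (Ordinal N0)) //= [X in _ + X]big1 ?addr0.
  under eq_bigr do rewrite expr0 mulr1.
  by rewrite sumr_const card_ord horner_coef0.
move=> i ni0; under eq_bigr do rewrite exprMn mulrA.
rewrite -mulr_sumr sum_roots_unity ?mulr0// ltn_ord andbT lt0n.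
by apply: contra ni0 => /eqP h; apply/eqP/val_inj.
Qed.

Lemma poly_center_max (p : {poly R[i]}) (r : R[i]) (N : nat) : (0 < N)%N -> (size p <= N)%N ->
  exists2 l : nat, (l < N)%N & normc p.[0] <= normc p.[r * cis (l%:R / N%:R)].
Proof.
move=> N0 sp; pose F (l : 'I_N) := normc p.[r * cis (l%:R / N%:R)].
pose l0 := [arg max_(l > Ordinal N0) F l]%O; exists (val l0); first exact: ltn_ord.
have Fmax l : F l <= F l0 by rewrite /l0; case: arg_maxP => //= i _; exact.
have := poly_mean r N0 sp => /(congr1 (@normc R)).
rewrite normcMn => h; rewrite -(@ler_pMn2r _ N)// -h.
apply: le_trans (ler_normc_sum _ _ _) _.
apply: le_trans (ler_sum _ (fun l _ => Fmax l)) _.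
by rewrite sumr_const card_ord.
Qed.

(** The product [Q] of the [m] rotates of [p] takes the value [p.[0] ^+ m] at [0], and the maximum
    principle yields a node where [|Q|] is at least as large. As [Q] is invariant under rotation by
    [1 / m], the angle [t] of the node may be taken below [1 / m]; the [m] factors then sample one
    point in each arc of length [1 / m]. *)
Lemma poly_jensen_discrete (p : {poly R[i]}) (r : R[i]) (m : nat) : (0 < m)%N ->
  exists t : R, 0 <= t < m%:R^-1 /\
    normc p.[0] ^+ m <= \prod_(j < m) normc p.[r * cis (j%:R / m%:R + t)].
Proof.
move=> m0; have mR : m%:R != 0 :> R by rewrite pnatr_eq0 -lt0n.
pose Q := \prod_(j < m) (p \Po ((cis (j%:R / m%:R))%:P * 'X)).
have QE z : Q.[z] = \prod_(j < m) p.[cis (j%:R / m%:R) * z].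
  by rewrite /Q horner_prod; apply: eq_bigr => j _; rewrite horner_comp !hornerE.
have Qrot z : Q.[cis (m%:R^-1) * z] = Q.[z].
  rewrite !QE; case: m m0 mR @Q QE => // m _ mR _ _.
  rewrite big_ord_recr big_ord_recl /= mulrC; congr (_ * _).
    rewrite mul0r cis0 mul1r mulrA -cisD.
    by rewrite -[X in _ + X]mul1r -mulrDl natr1 divff// (cis_int 1) mul1r.
  apply: eq_bigr => j _; congr (p.[_]); rewrite mulrA -cisD; congr (cis _ * _).
  by rewrite /bump /= add1n -[X in _ = X / _]natr1 mulrDl mul1r.
have Qrotn q z : Q.[cis (q%:R / m%:R) * z] = Q.[z].
  elim: q => [|q IH] in z *; first by rewrite mul0r cis0 mul1r.
  by rewrite -natr1 mulrDl mul1r cisD -mulrA IH Qrot.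
(* The number [m * K] of nodes is a multiple of [m], so the node [l] is a rotation by a multiple of
   [1 / m] of the one with index [l %% K], whose angle is below [1 / m]. *)
pose K := (size Q).+1; have N0 : (0 < m * K)%N by rewrite muln_gt0 m0.
have sQ : (size Q <= m * K)%N by apply: leq_trans (leq_pmull _ m0); exact: leqnSn.
have [l lN] := poly_center_max r N0 sQ.
have KR : K%:R != 0 :> R by rewrite pnatr_eq0.
pose t : R := (l %% K)%N%:R / (m * K)%N%:R.
have -> : cis (l%:R / (m * K)%:R) = cis ((l %/ K)%N%:R / m%:R) * cis t.
  rewrite -cisD; congr cis; rewrite /t {1}(divn_eq l K) natrD natrM natrM mulrDl.
  congr (_ + _); by field; rewrite KR mR.
rewrite mulrCA Qrotn !QE => h; exists t; split.
  rewrite /t divr_ge0//= natrM invfM mulrCA -[ltRHS]mulr1 ltr_pM2l ?invr_gt0 ?ltr0n//.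
  by rewrite ltr_pdivrMr ?ltr0n// mul1r ltr_nat ltn_mod.
move: h; under eq_bigr do rewrite mulr0.
rewrite prodr_const card_ord normcX normc_prod => /le_trans; apply.
apply: ler_prod => j _; rewrite normc_ge0 /= cisD.
by rewrite [in leRHS]mulrCA [in leRHS]mulrA mulrA.
Qed.

Lemma continuous_unif01 (V : R -> R) (e : R) : continuous V -> 0 < e ->
  exists2 m : nat, (0 < m)%N & forall x y, 0 <= x <= 1 -> `|x - y| <= m%:R^-1 ->
    `|V x - V y| <= e.
Proof.
move=> cV e0.
have := @segment_compact R 0 1 => /compact_near_coveringP.
move=> /(_ R (0^'+) (fun d x => forall y, `|x - y| < d -> `|V x - V y| <= e) _).
case.
  move=> x _; have := cV x => /cvgrPdist_lt /(_ (e / 2)); rewrite divr_gt0// => /(_ isT).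
  move=> /nbhs_ballP[d /= d0 hd].
  exists (ball x (d / 2), [set u | u < d / 2]) => /=.
    split; first by apply: nbhsx_ballx; rewrite divr_gt0.
    by apply: nbhs_right_lt; rewrite divr_gt0.
  move=> [x' u] /= [bx ud] y xy.
  have h1 : `|V x - V x'| < e / 2.
    by apply: hd; apply: le_ball bx; lra.
  have h2 : `|V x - V y| < e / 2.
    apply: hd; rewrite /ball /=; move: bx; rewrite /ball /= => bx.
    rewrite (_ : x - y = (x - x') + (x' - y)); last by ring.
    by apply: le_lt_trans (ler_normD _ _) _; lra.
  rewrite (_ : V x' - V y = (V x - V y) - (V x - V x')); last by ring.
  by apply: le_trans (ler_normB _ _) _; lra.
move=> d /= d0 hd.
pose m := (Num.truncn (d / 2)^-1).+1; exists m => // x y xy hxy.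
have m0 : 0 < m%:R^-1 :> R by rewrite invr_gt0 ltr0n.
have hm : m%:R^-1 < d / 2.
  rewrite -[ltRHS]invrK ltf_pV2 ?posrE ?ltr0n// ?invr_gt0 ?divr_gt0//.
  exact: truncnS_gt.
have d20 : 0 < d / 2 by rewrite divr_gt0.
apply: (hd (d / 2) _ d20 x _ y) => //=.
- by rewrite sub0r normrN gtr0_norm//; lra.
- exact: le_lt_trans hxy hm.
Qed.

Notation mu := (@lebesgue_measure R).

Lemma continuous_integrable_itv (V : R -> R) a b : continuous V ->
  mu.-integrable `[a, b] (fun x => (V x)%:E).
Proof.
move=> cV; apply: continuous_compact_integrable; first exact: segment_compact.
exact: continuous_subspaceT.
Qed.

Lemma riemann_sum_le (V : R -> R) (e : R) (m : nat) (s : nat -> R) : continuous V -> (0 < m)%N ->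
  (forall x y, 0 <= x <= 1 -> `|x - y| <= m%:R^-1 -> `|V x - V y| <= e) ->
  (forall j, (j < m)%N -> j%:R / m%:R <= s j <= j.+1%:R / m%:R) ->
  \sum_(j < m) V (s j) <= m%:R * (Rintegral mu `[0, 1] V + e).
Proof.
move=> cV m0 hV hs; have mR : 0 < m%:R :> R by rewrite ltr0n.
have key k : (k <= m)%N ->
  (\sum_(j < k) V (s j)) / m%:R <= Rintegral mu `[0, k%:R / m%:R] V + e * (k%:R / m%:R).
  elim: k => [_|k IH km].
    by rewrite big_ord0 !mul0r mulr0 addr0 set_itv1 Rintegral_set1.
  rewrite big_ord_recr /= mulrDl.
  have kk : k%:R / m%:R <= k.+1%:R / m%:R :> R by rewrite ler_pM2r ?invr_gt0// ler_nat.
  have := @Rintegral_itvB _ V (BLeft 0) (BRight (k.+1%:R / m%:R)) (k%:R / m%:R)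
     (continuous_integrable_itv _ _ cV).
  rewrite !bnd_simp divr_ge0// => /(_ isT kk) /eqP; rewrite subr_eq => /eqP ->.
  have := IH (ltnW km).
  have : V (s k) / m%:R <= Rintegral mu `]k%:R / m%:R, k.+1%:R / m%:R] V + e / m%:R.
    have iV : mu.-integrable `]k%:R / m%:R, k.+1%:R / m%:R] (fun x => (V x)%:E).
      apply: integrableS (continuous_integrable_itv (k%:R / m%:R) (k.+1%:R / m%:R) cV) => //.
      exact: subset_itv_oc_cc.
    have -> : V (s k) / m%:R = Rintegral mu `]k%:R / m%:R, k.+1%:R / m%:R] (fun=> V (s k) - e) + e / m%:R.
      rewrite Rintegral_cst//= lebesgue_measure_itv /= lte_fin.
      rewrite ltr_pM2r ?invr_gt0// ltr_nat ltnSn /= -natr1; field; exact: lt0r_neq0.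
    rewrite lerD2r; apply: le_Rintegral => //.
      apply: integrableS (continuous_integrable_itv (k%:R / m%:R) (k.+1%:R / m%:R) (@cst_continuous _ _ (V (s k) - e))) => //.
      exact: subset_itv_oc_cc.
    move=> x /=; rewrite in_itv /= => /andP[x1 x2].
    have /andP[s1 s2] := hs k km.
    have x01 : 0 <= x <= 1.
      apply/andP; split; first by apply: le_trans (ltW x1); rewrite divr_ge0.
      by apply: le_trans x2 _; rewrite ler_pdivrMr// mul1r ler_nat.
    have : `|x - s k| <= m%:R^-1.
      have hk : k.+1%:R / m%:R = k%:R / m%:R + m%:R^-1 :> R by rewrite -natr1 mulrDl mul1r.
      by move: s2 x2; rewrite hk => s2 x2; rewrite ler_norml; lra.
    by move=> h; move: (hV x (s k) x01 h); rewrite ler_norml; lra.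
  have -> : e * (k.+1%:R / m%:R) = e * (k%:R / m%:R) + e / m%:R by rewrite -natr1; ring.
  by lra.
have := key m (leqnn _); rewrite divff ?lt0r_neq0// mulr1.
by rewrite ler_pdivrMr// mulrC.
Qed.

(** The product over the sample points is bounded by the exponential of a Riemann sum of [V], and an
    [m]-th root is taken. The mesh depends on [V] alone, not on the degree of [p]. Since [V] is a
    continuous majorant of [ln |p|], zeros on the circle do no harm. *)
Lemma poly_jensen (p : {poly R[i]}) (r : R[i]) (V : R -> R) : continuous V ->
  (forall x, normc p.[r * cis x] <= expR (V x)) ->
  normc p.[0] <= expR (Rintegral mu `[0, 1] V).
Proof.
move=> cV hV; apply/ler_addgt0Pr => e e0.
set I := Rintegral _ _ _.
have [d d0 hd] : exists2 d, 0 < d & expR (I + d) <= expR I + e.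
  have := @continuous_expR R I => /cvgrPdist_lt /(_ e e0) /nbhs_ballP[d /= d0 hd].
  exists (d / 2); first by rewrite divr_gt0.
  have := hd (I + d / 2); rewrite /ball /= opprD addrA subrr sub0r normrN gtr0_norm ?divr_gt0//.
  move=> /(_ ltac:(lra)); rewrite ltr_norml => /andP[]; lra.
apply: le_trans _ hd.
have [m m0 hm] := continuous_unif01 cV d0.
have mR : m%:R != 0 :> R by rewrite pnatr_eq0 -lt0n.
have [t [/andP[t0 t1] ht]] := poly_jensen_discrete p r m0.
rewrite -(@ler_pXn2r _ m) ?nnegrE ?normc_ge0 ?expR_ge0//.
apply: le_trans ht _; rewrite -expRM_natl.
apply: le_trans (_ : expR (\sum_(j < m) V (j%:R / m%:R + t)) <= _).
  rewrite expR_sum; apply: ler_prod => j _; by rewrite normc_ge0 hV.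
rewrite ler_expR.
apply: (@riemann_sum_le V d m (fun j => j%:R / m%:R + t)) => // j jm.
by rewrite lerDl t0 /= -natr1 mulrDl mul1r lerD2l ltW.
Qed.

End circle.

(** * Uniform approximation by polynomials and entire functions *)

Section papprox.
Context {R : realType}.
Implicit Types (x y t r e : R) (z w : R[i]) (F G : R[i] -> R[i]) (S : set R[i]).

(** The set [S] is arbitrary so that zeros can be divided out: it is enough to keep the
    approximation at the centre, on the circle and at the remaining zeros. *)
Definition papprox S F := forall e, 0 < e ->
  exists p : {poly R[i]}, forall z, S z -> normc (F z - p.[z]) <= e.

Definition cdisk r : set R[i] := [set z | normc z <= r].

Lemma poly_lipschitz r (p : {poly R[i]}) : 0 <= r -> exists2 M : R, 0 <= M &
  forall z w, cdisk r z -> cdisk r w ->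
    normc p.[z] <= M /\ normc (p.[z] - p.[w]) <= M * normc (z - w).
Proof.
move=> r0; elim/poly_ind: p => [|p c [M M0 IH]].
  by exists 0 => // z w _ _; rewrite !horner0 subr0 normc0 mul0r.
exists (M * r + normc c + M) => [|z w hz hw].
  by rewrite !addr_ge0 ?normc_ge0// mulr_ge0.
have [h1 h2] := IH z w hz hw.
have h1' : normc p.[z] * normc z <= M * r by apply: ler_pM; rewrite ?normc_ge0.
rewrite !hornerE; split.
  by apply: le_trans (le_normcD _ _) _; rewrite normcM; lra.
rewrite (_ : _ - _ = (p.[z] - p.[w]) * w + p.[z] * (z - w)); last by ring.
apply: le_trans (le_normcD _ _) _; rewrite !normcM.
have h3 : normc (p.[z] - p.[w]) * normc w <= (M * normc (z - w)) * r.
  by apply: ler_pM; rewrite ?normc_ge0.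
have h4 : normc p.[z] * normc (z - w) <= M * normc (z - w).
  by rewrite ler_wpM2r ?normc_ge0.
have := mulr_ge0 (normc_ge0 c) (normc_ge0 (z - w)); nra.
Qed.

Lemma papprox_poly S (p : {poly R[i]}) : papprox S (fun z => p.[z]).
Proof. by move=> e e0; exists p => z _; rewrite subrr normc0 ltW. Qed.

Lemma papprox_subset S S' F : S `<=` S' -> papprox S' F -> papprox S F.
Proof. by move=> sS h e /h[p hp]; exists p => z /sS; exact: hp. Qed.

Lemma papprox_eq S F G : (forall z, S z -> F z = G z) -> papprox S F -> papprox S G.
Proof. by move=> FG h e /h[p hp]; exists p => z Sz; rewrite -FG//; exact: hp. Qed.

Lemma papproxD S F G : papprox S F -> papprox S G -> papprox S (fun z => F z + G z).
Proof.
move=> hF hG e e0; have e20 : 0 < e / 2 by rewrite divr_gt0.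
have [p hp] := hF _ e20; have [q hq] := hG _ e20; exists (p + q) => z Sz.
rewrite hornerD (_ : _ - _ = (F z - p.[z]) + (G z - q.[z])); last by ring.
by apply: le_trans (le_normcD _ _) _; move: (hp z Sz) (hq z Sz); lra.
Qed.

Lemma papprox_bounded S F r : 0 <= r -> S `<=` cdisk r -> papprox S F ->
  exists2 M, 0 <= M & forall z, S z -> normc (F z) <= M.
Proof.
move=> r0 sS hF; have [p hp] := hF 1 ltr01; have [M M0 hM] := poly_lipschitz p r0.
exists (1 + M) => [|z Sz]; first by rewrite addr_ge0.
rewrite -(subrK p.[z] (F z)); apply: le_trans (le_normcD _ _) _.
by apply: lerD; [exact: hp|have [] := hM z z (sS _ Sz) (sS _ Sz)].
Qed.

Lemma papproxM S F G r : 0 <= r -> S `<=` cdisk r -> papprox S F -> papprox S G ->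
  papprox S (fun z => F z * G z).
Proof.
move=> r0 sS hF hG e e0.
have [M M0 hM] := papprox_bounded r0 sS hF.
have [N N0 hN] := papprox_bounded r0 sS hG.
(* The error of the product is at most [M d + d (N + d)], hence at most [d (M + N + 1)] because
   [d <= 1]. *)
pose d := Num.min 1 (e / (M + N + 1)).
have K0 : 0 < M + N + 1 by rewrite ltr_wpDl// addr_ge0.
have d0 : 0 < d by rewrite lt_min ltr01 divr_gt0.
have d1 : d <= 1 by rewrite ge_min lexx.
have de : d * (M + N + 1) <= e by rewrite -ler_pdivlMr// ge_min lexx orbT.
have [p hp] := hF _ d0; have [q hq] := hG _ d0; exists (p * q) => z Sz.
rewrite hornerM (_ : _ - _ = F z * (G z - q.[z]) + (F z - p.[z]) * q.[z]); last by ring.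
apply: le_trans (le_normcD _ _) _; rewrite !normcM.
have hqz : normc q.[z] <= N + d.
  rewrite -(subrKC (G z) q.[z]); apply: le_trans (le_normcD _ _) _.
  by apply: lerD; [exact: hN|rewrite normc_distC; exact: hq].
have h1 : normc (F z) * normc (G z - q.[z]) <= M * d.
  by apply: ler_pM; rewrite ?normc_ge0//; [exact: hM|exact: hq].
have h2 : normc (F z - p.[z]) * normc q.[z] <= d * (N + d).
  by apply: ler_pM; rewrite ?normc_ge0//; exact: hp.
by apply: le_trans de; nra.
Qed.

Lemma papprox_lim S F : (forall e, 0 < e -> exists2 G, papprox S G &
  forall z, S z -> normc (F z - G z) <= e) -> papprox S F.
Proof.
move=> h e e0; have e20 : 0 < e / 2 by rewrite divr_gt0.
have [G hG hFG] := h _ e20; have [p hp] := hG _ e20; exists p => z Sz.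
rewrite (_ : F z - p.[z] = (F z - G z) + (G z - p.[z])); last by ring.
by apply: le_trans (le_normcD _ _) _; move: (hp z Sz) (hFG z Sz); lra.
Qed.

Lemma papprox_comp_poly S F r (q : {poly R[i]}) : 0 <= r -> S `<=` cdisk r ->
  papprox S F -> papprox S (fun z => q.[F z]).
Proof.
move=> r0 sS hF; elim/poly_ind: q => [|q c IH].
  by apply: papprox_eq (papprox_poly S 0) => z _; rewrite !horner0.
apply: (@papprox_eq S (fun z => q.[F z] * F z + c)); first by move=> z _; rewrite !hornerE.
apply: papproxD; first exact: (papproxM r0 sS).
by apply: papprox_eq (papprox_poly S c%:P) => z _; rewrite hornerC.
Qed.

Lemma papprox_comp S S' F G r : 0 <= r -> S `<=` cdisk r ->
  (forall z, S z -> S' (G z)) -> papprox S G -> papprox S' F ->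
  papprox S (fun z => F (G z)).
Proof.
move=> r0 sS SS' hG hF; apply: papprox_lim => e /hF[p hp].
by exists (fun z => p.[G z]) => [|z Sz]; [exact: (papprox_comp_poly p r0 sS hG)|exact/hp/SS'].
Qed.

Lemma papprox_conj S F : papprox S F -> papprox (conjc @^-1` S) (fun z => conjc (F (conjc z))).
Proof.
move=> hF e /hF[p hp]; exists (map_poly conjc p) => z /= Sz.
rewrite (_ : (map_poly conjc p).[z] = conjc p.[conjc z]).
  by rewrite -rmorphB normc_conj; exact: hp.
by rewrite -{1}(conjcK z) horner_map.
Qed.

(* The interpolation error p(a) tends to 0 together with the error of p since
   F a = 0, so (p - p(a)) / ('X - a) approximates F(z) / (z - a) away from a. *)
Lemma papprox_div S S' F (a : R[i]) d : 0 < d -> S' `<=` S -> S a -> F a = 0 ->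
  (forall z, S' z -> d <= normc (z - a)) -> papprox S F ->
  papprox S' (fun z => F z / (z - a)).
Proof.
move=> d0 sS Sa Fa hd hF e e0.
have ed0 : 0 < e * d / 2 by rewrite divr_gt0// mulr_gt0.
have [p hp] := hF _ ed0.
have /factor_theorem[q hq] : root (p - p.[a]%:P) a by rewrite /root !hornerE subrr.
exists q => z S'z.
have za : z - a != 0 by rewrite -normc_gt0 (lt_le_trans d0)// hd.
have -> : q.[z] = (p.[z] - p.[a]) / (z - a).
  have : (p - p.[a]%:P).[z] = q.[z] * (z - a) by rewrite hq !hornerE.
  by rewrite !hornerE => ->; rewrite mulfK.
rewrite -mulrBl normcM normcV ler_pdivrMr ?normc_gt0//.
apply: (@le_trans _ _ (e * d)); last by rewrite ler_wpM2l ?(ltW e0)//; exact: hd.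
rewrite (_ : _ - _ = (F z - p.[z]) - (F a - p.[a])); last by rewrite Fa; ring.
by apply: le_trans (ler_normcB _ _) _; move: (hp z (sS _ S'z)) (hp a Sa); lra.
Qed.

(* Being a locally uniform limit of polynomials replaces complex differentiability. *)
Definition entire F := forall r, papprox (cdisk r) F.

Lemma entire_poly (p : {poly R[i]}) : entire (fun z => p.[z]).
Proof. by move=> r; exact: papprox_poly. Qed.

Lemma cdisk_neg r F : r < 0 -> papprox (cdisk r) F.
Proof.
move=> r0 e e0; exists 0 => z; rewrite /cdisk /= => hz.
by move: (le_lt_trans (le_trans (normc_ge0 _) hz) r0); rewrite ltxx.
Qed.

Lemma entireD F G : entire F -> entire G -> entire (fun z => F z + G z).
Proof. by move=> hF hG r; apply: papproxD. Qed.

Lemma entireM F G : entire F -> entire G -> entire (fun z => F z * G z).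
Proof.
move=> hF hG r; have [r0|/cdisk_neg//] := leP 0 r.
by apply: (@papproxM _ _ _ r).
Qed.

Lemma entire_cst c : entire (fun=> c).
Proof. by move=> r; apply: papprox_eq (entire_poly c%:P r) => z _; rewrite hornerC. Qed.

Lemma entire_id : entire (fun z => z).
Proof. by move=> r; apply: papprox_eq (entire_poly 'X r) => z _; rewrite hornerX. Qed.

Lemma entire_conj F : entire F -> entire (fun z => conjc (F (conjc z))).
Proof.
move=> hF r; apply: papprox_subset (papprox_conj (hF r)) => z.
by rewrite /cdisk /= normc_conj.
Qed.

Lemma entire_comp F G : entire F -> entire G -> entire (fun z => F (G z)).
Proof.
move=> hF hG r; have [r0|/cdisk_neg//] := leP 0 r.
have [M M0 hM] := papprox_bounded r0 (@subset_refl _ _) (hG r).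
exact: (papprox_comp r0 (@subset_refl _ _) hM (hG r) (hF M)).
Qed.

(** An arbitrary filter covers both continuity in a real variable and limits of sequences. *)
Lemma entire_cont F (T : Type) (l : set_system T) {FF : Filter l} (u : T -> R[i]) z0 :
  entire F -> (fun t : T => normc (u t - z0)) @ l --> (0 : R) ->
  (fun t : T => normc (F (u t) - F z0)) @ l --> (0 : R).
Proof.
move=> hF hu; apply/cvgrPdist_le => e e0.
have r0 : 0 <= normc z0 + 1 by rewrite addr_ge0 ?normc_ge0.
have e30 : 0 < e / 3 by rewrite divr_gt0.
have [p hp] := hF (normc z0 + 1) _ e30.
have [M M0 hM] := poly_lipschitz p r0.
have dz0 : cdisk (normc z0 + 1) z0 by rewrite /cdisk /= lerDl.
have K0 : 0 < Num.min 1 (e / 3 / (M + 1)) by rewrite lt_min ltr01 divr_gt0// ltr_wpDl.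
move/cvgrPdist_le : hu => /(_ _ K0); apply: filterS => t.
rewrite !sub0r !normrN !(ger0_norm (normc_ge0 _)) le_min => /andP[h1 h2].
have dt : cdisk (normc z0 + 1) (u t).
  rewrite /cdisk /= -(subrKC z0 (u t)); apply: le_trans (le_normcD _ _) _.
  by rewrite lerD2l.
rewrite (_ : F (u t) - F z0 = (F (u t) - p.[u t]) + ((p.[u t] - p.[z0]) - (F z0 - p.[z0]))); last by ring.
have h3 := hp _ dt; have h4 := hp _ dz0; have [_ h5] := hM _ _ dt dz0.
apply: le_trans (le_normcD _ _) _.
have h6 := ler_normcB (p.[u t] - p.[z0]) (F z0 - p.[z0]).
have h7 : M * normc (u t - z0) <= e / 3.
  have h8 : normc (u t - z0) * (M + 1) <= e / 3 by rewrite -ler_pdivlMr// ltr_wpDl.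
  by have := normc_ge0 (u t - z0); nra.
lra.
Qed.

End papprox.

(** * Power series estimates for the exponential and the geometric series *)

Section cexp_entire.
Context {R : realType}.
Implicit Types (x y t r e : R) (z w : R[i]).

Lemma sin_mvt y : exists2 x, `|x| <= `|y| & sin y = y * cos x.
Proof.
have pos t : 0 <= t -> exists2 x, `|x| <= `|t| & sin t = t * cos x.
  move=> t0; have [|c] := @MVT_segment R sin cos 0 t t0 (fun x _ => is_derive_sin x).
    by apply: continuous_subspaceT; exact: continuous_sin.
  rewrite in_itv /= sin0 !subr0 => /andP[c0 ct] h; exists c; last by rewrite h mulrC.
  by rewrite !ger0_norm.
have [y0|y0] := leP 0 y; first exact: pos.
have [|x hx h] := pos (- y); first by lra.
exists x; first by rewrite -(normrN y).
by apply: oppr_inj; rewrite -sinN h mulNr.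
Qed.

Lemma ler_norm_sin y : `|sin y| <= `|y|.
Proof.
have [x _ ->] := sin_mvt y; rewrite normrM -[leRHS]mulr1 ler_wpM2l//; exact: cos_max.
Qed.

Lemma sqr_le_abs x y : `|x| <= `|y| -> x ^+ 2 <= y ^+ 2.
Proof. by move=> h; rewrite -(real_normK (num_real x)) -(real_normK (num_real y)) ler_pXn2r ?nnegrE. Qed.

Lemma cos_taylor1 y : 0 <= 1 - cos y <= y ^+ 2 / 2.
Proof.
have -> : 1 - cos y = sin (y / 2) ^+ 2 *+ 2.
  rewrite {1}(_ : y = (y / 2) *+ 2); last by rewrite -mulr_natr divfK.
  by rewrite cos_mulr2n cos2sin2 -mulr_natl; ring.
rewrite mulrn_wge0 ?sqr_ge0//=.
have := sqr_le_abs (ler_norm_sin (y / 2)); rewrite -mulr_natl expr_div_n; lra.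
Qed.

Lemma sin_taylor1 y : `|sin y - y| <= `|y| * (y ^+ 2 / 2).
Proof.
have [x hx ->] := sin_mvt y.
rewrite (_ : _ - y = - (y * (1 - cos x))); last by ring.
rewrite normrN normrM ler_wpM2l//; have /andP[h1 h2] := cos_taylor1 x.
rewrite ger0_norm//; apply: le_trans h2 _; have := sqr_le_abs hx; lra.
Qed.

Lemma expR_taylor1 x : `|x| <= 1 / 2 -> 0 <= expR x - 1 - x <= 2 * x ^+ 2.
Proof.
rewrite ler_norml => /andP[h1 h2]; have h3 := expR_ge1Dx x; have h4 := expR_ge1Dx (- x).
have h5 := expRxMexpNx_1 x; have h6 := expR_gt0 x; have h7 := expR_gt0 (- x).
apply/andP; split; first by lra.
(* This gives [(expR x - 1 - x) (1 - x) <= x^2], where [1 - x >= 1 / 2]; it follows from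
   [1 - x <= expR (- x)]. *)
suff : expR x * (1 - x) <= 1 by nra.
by rewrite -[leRHS]h5 ler_wpM2l// ltW.
Qed.

Lemma cexp_taylor1 z : normc z <= 1 / 2 -> normc (cexp z - 1 - z) <= 6 * normc z ^+ 2.
Proof.
case: z => x y hz; have hx := le_trans (Re_le_normc _) hz; have hy := le_trans (Im_le_normc _) hz.
rewrite sqr_normcE; apply: le_trans (normc_le_ReIm _) _; rewrite /= in hx hy *.
have /andP[e1 e2] := expR_taylor1 hx.
have /andP[c1 c2] := cos_taylor1 y; have s1 := sin_taylor1 y.
have sy := ler_norm_sin y.
have -> : expR x * cos y - 0 * sin y - 1 - x = (expR x - 1 - x) * cos y - (1 + x) * (1 - cos y) by ring.
have -> : expR x * sin y + 0 * cos y - 0 - y = (expR x - 1) * sin y + (sin y - y) by ring.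
have h1 : `|(expR x - 1 - x) * cos y| <= 2 * x ^+ 2.
  rewrite normrM ger0_norm// -[leRHS]mulr1; apply: ler_pM => //; exact: cos_max.
have h2 : `|(1 + x) * (1 - cos y)| <= 2 * (y ^+ 2 / 2).
  rewrite normrM (ger0_norm c1); apply: ler_pM => //.
  by apply: le_trans (ler_normD _ _) _; rewrite normr1; lra.
have h3 : `|(expR x - 1) * sin y| <= 2 * `|x| * `|y|.
  rewrite normrM; apply: ler_pM => //.
  rewrite (_ : expR x - 1 = (expR x - 1 - x) + x); last by ring.
  apply: le_trans (ler_normD _ _) _; rewrite ger0_norm//.
  have : 2 * x ^+ 2 <= `|x|; last by lra.
  by rewrite -(real_normK (num_real x)); have := normr_ge0 x; nra.
have h4 := ler_normB ((expR x - 1 - x) * cos y) ((1 + x) * (1 - cos y)).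
have h5 := ler_normD ((expR x - 1) * sin y) (sin y - y).
have h6 : 2 * `|x| * `|y| <= x ^+ 2 + y ^+ 2.
  by rewrite -(real_normK (num_real x)) -(real_normK (num_real y)); have := sqr_ge0 (`|x| - `|y|); nra.
have h7 : `|y| * (y ^+ 2 / 2) <= y ^+ 2 by have := sqr_ge0 y; nra.
have := sqr_ge0 x; have := sqr_ge0 y; lra.
Qed.

Lemma normc_exprB (a b : R[i]) (K : R) n : 1 <= K -> normc a <= K -> normc b <= K ->
  normc (a ^+ n - b ^+ n) <= n%:R * K ^+ n * normc (a - b).
Proof.
move=> K1 aK bK; elim: n => [|n IH]; first by rewrite !expr0 subrr normc0 mul0r mul0r.
have K0 : 0 <= K by lra.
rewrite !exprS (_ : _ - _ = a * (a ^+ n - b ^+ n) + (a - b) * b ^+ n); last by ring.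
apply: le_trans (le_normcD _ _) _; rewrite !normcM normcX.
have h1 : normc a * normc (a ^+ n - b ^+ n) <= K * (n%:R * K ^+ n * normc (a - b)).
  by apply: ler_pM; rewrite ?normc_ge0.
have h2 : normc (a - b) * normc b ^+ n <= normc (a - b) * (K * K ^+ n).
  rewrite ler_wpM2l ?normc_ge0//; apply: (@le_trans _ _ (K ^+ n)).
    by rewrite lerXn2r ?nnegrE ?normc_ge0.
  by rewrite ler_peMl// exprn_ge0.
rewrite -natr1; nra.
Qed.

(* The approximating polynomials are (1 + z / n) ^ n. *)
Lemma entire_cexp : entire (@cexp R).
Proof.
move=> r e e0; have [r0|/cdisk_neg//] := leP 0 r; last by exact.
pose C : R := 6 * r ^+ 2 * expR r.
(* From [2 r < n], the point [z / n] is in the range of [cexp_taylor1]; from [C / e < n], the total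
   error [C / n] is at most [e]. *)
pose n := (Num.truncn (2 * r + C / e)).+1.
have nR : 0 < n%:R :> R by rewrite ltr0n.
have hn : 2 * r + C / e < n%:R by exact: truncnS_gt.
have C0 : 0 <= C by rewrite /C !mulr_ge0 ?expR_ge0.
have Ce : 0 <= C / e by rewrite divr_ge0// ltW.
exists ((1 + (n%:R)^-1%:P * 'X) ^+ n) => z; rewrite /cdisk /= => hz.
rewrite !hornerE.
pose v := (n%:R)^-1 * z.
have -> : cexp z = cexp v ^+ n.
  by rewrite -cexpMn /v mulVKf// pnatr_eq0.
have nv : normc v = n%:R^-1 * normc z.
  rewrite normcM normcV (_ : n%:R = (n%:R)%:C) ?normc_real ?ger0_norm//.
  by rewrite rmorph_nat.
have v2 : normc v <= n%:R^-1 * r by rewrite nv ler_wpM2l// invr_ge0 ler0n.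
have v1 : normc v <= 1 / 2.
  apply: le_trans v2 _; rewrite mulrC ler_pdivrMr//; lra.
have K1 : 1 <= expR (n%:R^-1 * r) by rewrite -expR0 ler_expR mulr_ge0// invr_ge0 ltW.
apply: le_trans (normc_exprB n K1 _ _) _.
- rewrite normc_cexp ler_expR; apply: le_trans v2.
  exact: le_trans (ler_norm _) (Re_le_normc _).
- apply: le_trans (le_normcD _ _) _; rewrite normc1.
  by apply: le_trans (expR_ge1Dx _); rewrite lerD2l.
rewrite -expRM_natl mulrA divff ?lt0r_neq0// mul1r.
have h := cexp_taylor1 v1; rewrite -addrA -opprD in h.
apply: le_trans (ler_wpM2l _ h) _; first by rewrite mulr_ge0 ?expR_ge0// ltW.
have h2 : normc v ^+ 2 <= (n%:R^-1 * r) ^+ 2.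
  by rewrite ler_pXn2r ?nnegrE ?normc_ge0// mulr_ge0// invr_ge0 ltW.
have h3 : n%:R * expR r * (6 * normc v ^+ 2) <= n%:R * expR r * (6 * (n%:R^-1 * r) ^+ 2).
  by rewrite ler_wpM2l ?mulr_ge0 ?expR_ge0 ?(ltW nR)// ler_wpM2l.
apply: le_trans h3 _.
have -> : n%:R * expR r * (6 * (n%:R^-1 * r) ^+ 2) = C / n%:R.
  by rewrite /C; field; exact: lt0r_neq0.
rewrite ler_pdivrMr// -ler_pdivrMl// mulrC; lra.
Qed.

Lemma papprox_geom r : r < 1 -> papprox (cdisk r) (fun z => (1 - z)^-1).
Proof.
have [r0 r1|r0 _] := leP 0 r; last exact: cdisk_neg.
move=> e e0; have r1' : 0 < 1 - r by rewrite subr_gt0.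
have : (fun n => r ^+ n) @ \oo --> (0 : R) by apply: cvg_expr; rewrite ger0_norm.
move/cvgrPdist_le => /(_ (e * (1 - r))); rewrite mulr_gt0// => /(_ isT)[n _ hn].
have {}hn : r ^+ n <= e * (1 - r).
  by have := hn n (leqnn _); rewrite sub0r normrN ger0_norm// exprn_ge0.
exists (\sum_(i < n) 'X^i) => z; rewrite /cdisk /= => hz.
have z1 : 1 - r <= normc (1 - z).
  by have := ler_dist_normc 1 z; rewrite normc1; lra.
have z0 : 1 - z != 0 by rewrite -normc_gt0 (lt_le_trans r1').
rewrite horner_sum; under eq_bigr do rewrite hornerXn.
have -> : (1 - z)^-1 - \sum_(i < n) z ^+ i = z ^+ n / (1 - z).
  have h := subrX1 z n; apply: (mulIf z0); rewrite mulrBl mulVf// divfK//.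
  have -> : (\sum_(i < n) z ^+ i) * (1 - z) = - ((z - 1) * \sum_(i < n) z ^+ i) by ring.
  by rewrite -h; ring.
rewrite normcM normcV normcX ler_pdivrMr ?normc_gt0//.
apply: le_trans (_ : e * (1 - r) <= _); last by rewrite ler_wpM2l// ltW.
by apply: le_trans hn; rewrite lerXn2r ?nnegrE ?normc_ge0.
Qed.

End cexp_entire.

(** * Jensen's inequality for functions with prescribed zeros *)

Section jensen.
Context {R : realType}.
Notation mu := (@lebesgue_measure R).
Implicit Types (x y t r e : R) (z w : R[i]) (F G H : R[i] -> R[i]) (S : set R[i]).

Lemma Rintegral_FTC (f F : R -> R) a b : a <= b -> {within `[a, b], continuous f} ->
  (forall x, a <= x <= b -> is_derive x 1 F (f x)) ->
  Rintegral mu `[a, b] f = F b - F a.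
Proof.
rewrite le_eqVlt => /predU1P[->|ab] cf dF; first by rewrite set_itv1 Rintegral_set1 subrr.
have cF x : a <= x <= b -> F @ x --> F x.
  move=> /dF hx; have /derivable1_diffP/differentiable_continuous := @ex_derive _ _ _ _ _ _ _ hx.
  exact.
rewrite /Rintegral (@continuous_FTC2 _ f F)//.
  split.
  - move=> x; rewrite in_itv /= => /andP[ax xb].
    have hx : a <= x <= b by rewrite !ltW.
    exact: (@ex_derive _ _ _ _ _ _ _ (dF x hx)).
  - by apply: cvg_at_right_filter; apply: cF; rewrite lexx ltW.
  - by apply: cvg_at_left_filter; apply: cF; rewrite lexx ltW.
move=> x; rewrite in_itv /= => /andP[ax xb].
have hx : a <= x <= b by rewrite !ltW.
by rewrite derive1E (@derive_val _ _ _ _ _ _ _ (dF x hx)).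
Qed.

Lemma is_derive_mull (c x : R) : is_derive x 1 (fun u : R => c * u) c.
Proof.
have -> : (fun u : R => c * u) = c \*: (@id R) by [].
by apply: is_derive_eq; rewrite /GRing.scale /= mulr1.
Qed.

Lemma Rintegral_abs_sin : Rintegral mu `[0, 1] (fun x => `|sin (2 * pi * x)|) = 2 / pi.
Proof.
have p0 := @pi_gt0 R.
have cs : continuous (fun x : R => sin (2 * pi * x)).
  move=> x; apply: (continuous_comp (f := fun x => 2 * pi * x) (g := sin)).
    by apply: cvgM; [exact: cvg_cst|exact: cvg_id].
  exact: continuous_sin.
have cas : continuous (fun x : R => `|sin (2 * pi * x)|).
  by move=> x; apply: cvg_norm; exact: cs.
have dF (s : R) x : is_derive x 1 (fun x : R => s * (- cos (2 * pi * x) / (2 * pi))) (s * sin (2 * pi * x)).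
  have h : is_derive x 1 (fun x : R => cos (2 * pi * x)) (- sin (2 * pi * x) * (2 * pi)).
    have h1 := is_derive_mull (2 * pi : R) x.
    have h2 := is_derive_cos (2 * pi * x).
    have := @is_derive1_comp _ cos (fun x : R => 2 * pi * x) x _ _ h2 h1; exact.
  have -> : (fun x : R => s * (- cos (2 * pi * x) / (2 * pi))) = ((- s / (2 * pi)) \*: (fun x : R => cos (2 * pi * x))).
    apply/funext => u /=; rewrite /GRing.scale /=.
    by move: (pi : R) (lt0r_neq0 p0) => q q0; field.
  apply: is_derive_eq; rewrite /GRing.scale /=.
  by set u := sin _; move: u (pi : R) (lt0r_neq0 p0) => u q q0; field.
have cc (s : R) a b : {within `[a, b], continuous (fun x : R => s * sin (2 * pi * x))}.
  by apply: continuous_subspaceT => x; apply: cvgM; [exact: cvg_cst|exact: cs].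
have := @Rintegral_itvB _ (fun x => `|sin (2 * pi * x)|) (BLeft 0) (BRight 1) (1 / 2) (continuous_integrable_itv _ _ cas).
rewrite !bnd_simp => /(_ ltac:(lra) ltac:(lra)) /eqP; rewrite subr_eq => /eqP ->.
rewrite Rintegral_itv_obnd_cbnd; last first.
  by apply: integrableS (continuous_integrable_itv (1 / 2) 1 cas) => //; exact: subset_itv_oc_cc.
have -> : Rintegral mu `[0, 1 / 2] (fun x => `|sin (2 * pi * x)|) = Rintegral mu `[0, 1 / 2] (fun x => 1 * sin (2 * pi * x)).
  apply: eq_Rintegral => x; rewrite inE /= in_itv /= => /andP[x0 x1].
  rewrite mul1r ger0_norm//; apply: sin_ge0_pi; apply/andP; split; nra.
have -> : Rintegral mu `[1 / 2, 1] (fun x => `|sin (2 * pi * x)|) = Rintegral mu `[1 / 2, 1] (fun x => - 1 * sin (2 * pi * x)).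
  apply: eq_Rintegral => x; rewrite inE /= in_itv /= => /andP[x0 x1].
  have h : 0 <= sin (2 * pi * x - pi) by apply: sin_ge0_pi; apply/andP; split; nra.
  have hs : sin (2 * pi * x) = - sin (2 * pi * x - pi).
    by rewrite sinB cospi sinpi; ring.
  by rewrite hs normrN ger0_norm//; ring.
rewrite !(Rintegral_FTC _ _ (fun x _ => dF _ x)) //; try lra.
have -> : 2 * pi * (1 / 2) = pi :> R by move: (pi : R) => q; field.
have -> : 2 * pi * 1 = pi *+ 2 :> R by rewrite mulr1 mulr_natl.
by rewrite cos2pi cospi mulr0 cos0; move: (pi : R) (lt0r_neq0 p0) => q q0; field.
Qed.

Lemma expR_right_cont (I e : R) : 0 < e -> exists2 d, 0 < d & expR (I + d) <= expR I + e.
Proof.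
move=> e0; have := @continuous_expR R I => /cvgrPdist_lt /(_ e e0) /nbhs_ballP[d /= d0 hd].
exists (d / 2); first by rewrite divr_gt0.
have := hd (I + d / 2); rewrite /ball /= opprD addrA subrr sub0r normrN gtr0_norm ?divr_gt0//.
move=> /(_ ltac:(lra)); rewrite ltr_norml => /andP[]; lra.
Qed.

(** The lower bound [c] of [V] makes the additive error of the approximating polynomial
    multiplicative: [expR c * d <= expR (V x) * d], and [1 + d <= expR d] moves it into the
    exponent. *)
Lemma papprox_jensen S F (r : R[i]) (V : R -> R) c : papprox S F -> S 0 ->
  (forall x, S (r * cis x)) -> continuous V -> (forall x, c <= V x) ->
  (forall x, normc (F (r * cis x)) <= expR (V x)) ->
  normc (F 0) <= expR (Rintegral mu `[0, 1] V).
Proof.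
move=> hF S0 Sr cV cVx FV; set I := Rintegral _ _ _.
apply/ler_addgt0Pr => e e0; have e20 : 0 < e / 2 by rewrite divr_gt0.
have [d d0 hd] := expR_right_cont I e20.
have [p hp] : exists p : {poly R[i]}, forall z, S z -> normc (F z - p.[z]) <= Num.min (e / 2) (expR c * d).
  by apply: hF; rewrite lt_min e20 mulr_gt0// expR_gt0.
have hp0 : normc p.[0] <= expR (Rintegral mu `[0, 1] (fun x => V x + d)).
  apply: (@poly_jensen _ p r); first by move=> x; apply: cvgD; [exact: cV|exact: cvg_cst].
  move=> x; have := hp _ (Sr x); rewrite le_min => /andP[_ h].
  rewrite -(subrKC (F (r * cis x)) p.[_]); apply: le_trans (le_normcD _ _) _.
  rewrite normc_distC; apply: (@le_trans _ _ (expR (V x) * (1 + d))).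
    rewrite mulrDr mulr1 lerD//; apply: le_trans h _.
    by rewrite ler_wpM2r ?(ltW d0)// ler_expR.
  by rewrite expRD ler_wpM2l ?expR_ge0// expR_ge1Dx.
have hI : Rintegral mu `[0, 1] (fun x => V x + d) = I + d.
  rewrite RintegralD//; [|exact: continuous_integrable_itv|by apply: continuous_integrable_itv => x; exact: cvg_cst].
  congr (_ + _); rewrite Rintegral_cst//= lebesgue_measure_itv /= lte_fin ltr01 /=.
  by rewrite subr0 mulr1.
rewrite hI in hp0.
have := hp _ S0; rewrite le_min => /andP[h _].
rewrite -(subrK p.[0] (F 0)); apply: le_trans (le_normcD _ _) _; lra.
Qed.

Lemma seq_dist_gt0 (s : seq R[i]) a : a \notin s ->
  exists2 d, 0 < d & forall b, b \in s -> d <= normc (b - a).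
Proof.
elim: s => [|b s IH]; first by exists 1.
rewrite inE negb_or => /andP[ab /IH[d d0 hd]].
exists (Num.min d (normc (b - a))) => [|c].
  by rewrite lt_min d0 normc_gt0 subr_eq0 eq_sym.
by rewrite inE => /predU1P[->|/hd h]; rewrite ge_min ?lexx ?orbT// h.
Qed.

(* Multiplying F by (r^2 - conj a z) / (r (z - a)) removes the zero a without
   changing |F| on the circle of radius r. *)
Lemma jensen_zeros (s : seq R[i]) F r (V : R -> R) c : 0 < r -> uniq s ->
  (forall a, a \in s -> [/\ a != 0, normc a < r & F a = 0]) ->
  papprox [set z | [\/ z = 0, normc z = r | z \in s]] F ->
  continuous V -> (forall x, c <= V x) ->
  (forall x, normc (F (r%:C * cis x)) <= expR (V x)) ->
  normc (F 0) * \prod_(a <- s) (r / normc a) <= expR (Rintegral mu `[0, 1] V).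
Proof.
move=> r0 us hs hF cV cVx.
have ncr x : normc (r%:C * cis x) = r by rewrite normcM normc_cis mulr1 normc_real gtr0_norm.
elim: s F us hs hF => [|a s IH] F /=.
  move=> _ _ hF FV; rewrite big_nil mulr1.
  apply: (papprox_jensen hF _ _ cV cVx FV); first by constructor.
  by move=> x; constructor 2.
move=> /andP[nas us] hs hF FV.
have [a0 ar Fa] := hs a (mem_head _ _).
pose F' z := F z / (z - a) * ((r ^+ 2)%:C - conjc a * z) / r%:C.
have [d d0 hd] := seq_dist_gt0 nas.
(* A lower bound for the distance of [a] to the remaining zeros, to the centre and to the circle,
   where [F] is divided by [z - a]. *)
pose d' := Num.min d (Num.min (normc a) (r - normc a)).
have d'0 : 0 < d' by rewrite !lt_min d0 normc_gt0 a0 subr_gt0.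
have hF' : papprox [set z | [\/ z = 0, normc z = r | z \in s]] F'.
  have sd : [set z | [\/ z = 0, normc z = r | z \in s]] `<=` cdisk r.
    move=> z hz; rewrite /cdisk /=; case: hz => [->|->//|zs]; first by rewrite normc0 ltW.
    by have [_ /ltW] := hs z (mem_behead (s := a :: s) zs).
  apply: (papprox_eq (F := fun z => F z / (z - a) * (((r ^+ 2 / r)%:C)%:P - (conjc a / r%:C)%:P * 'X).[z])).
    move=> z _; rewrite !hornerE /F' -[RHS]mulrA; congr (_ * _).
    by rewrite mulrBl rmorphM /= fmorphV /= mulrAC.
  apply: (papproxM (ltW r0) sd); last exact: papprox_poly.
  apply: (papprox_div d'0 _ _ Fa _ hF).
  - by move=> z [->|h|h]; [constructor 1|constructor 2|constructor 3; rewrite inE h orbT].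
  - by constructor 3; rewrite mem_head.
  - move=> z [->|h|h].
    + by rewrite sub0r normcN !ge_min lexx orbT.
    + rewrite !ge_min; apply/orP; right; apply/orP; right.
      by rewrite -h; exact: ler_dist_normc.
    + by rewrite ge_min hd.
have nB z : normc z = r -> normc (F' z) = normc (F z).
  move=> zr; have za : z - a != 0.
    by apply: contraTN ar => /eqP/subr0_eq <-; rewrite zr ltxx.
  (* On the circle [r^2] is [z * conjc z], so the new factor has modulus [r |z - a|]. *)
  have hh : (r ^+ 2)%:C - conjc a * z = z * conjc (z - a).
    by rewrite rmorphB mulrBr mulc_conj zr; congr (_ - _); exact: mulrC.
  rewrite /F' hh !normcM !normcV normc_conj normc_real (gtr0_norm r0) zr.
  have : normc (z - a) != 0 by rewrite normc_eq0.
  by move=> h; field; rewrite h lt0r_neq0.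
have F'0 : normc (F' 0) = normc (F 0) * (r / normc a).
  rewrite /F' sub0r mulr0 subr0 !normcM !normcV normcN !normc_real !gtr0_norm ?exprn_gt0//.
  have : normc a != 0 by rewrite normc_eq0.
  by move=> h; field; rewrite h lt0r_neq0.
rewrite big_cons mulrA -F'0; apply: IH => //.
- move=> b bs; have [b0 br Fb] := hs b (mem_behead (s := a :: s) bs); split => //.
  by rewrite /F' Fb !mul0r.
- by move=> x; rewrite nB.
Qed.

(* Contains the Fourier transforms of integrable functions supported in [-A, A]. *)
Definition PW (A : R) H := entire H /\
  exists2 C, 0 < C & forall z, normc (H z) <= C * expR (2 * pi * A * `|complex.Im z|).

Lemma entire_shift H c : entire H -> entire (fun z => H (c + z)).
Proof. by move=> eH; apply: entire_comp => //; apply: entireD; [exact: entire_cst|exact: entire_id]. Qed.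

Lemma continuous_abs_sin : continuous (fun x : R => `|sin (2 * pi * x)|).
Proof.
move=> x; apply: cvg_norm.
apply: (continuous_comp (f := fun x => 2 * pi * x) (g := sin)); last exact: continuous_sin.
by apply: cvgM; [exact: cvg_cst|exact: cvg_id].
Qed.

(** On the circle [|Im z|] is [r |sin (2 pi x)|], whose mean is [2 r / pi]; the growth exponent
    [2 pi A |Im z|] thus averages to [4 A r]. *)
Lemma PW_jensen A C H x0 r (s : seq R) : 0 <= A -> 0 < C -> 0 < r -> entire H ->
  (forall z, normc (H z) <= C * expR (2 * pi * A * `|complex.Im z|)) ->
  uniq s -> (forall a, a \in s -> [/\ a != x0, `|a - x0| < r & H a%:C = 0]) ->
  normc (H x0%:C) * \prod_(a <- s) (r / `|a - x0|) <= C * expR (4 * A * r).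
Proof.
move=> A0 C0 r0 eH HC us hs; have p0 := @pi_gt0 R.
pose F z := H (x0%:C + z); have eF : entire F by exact: entire_shift.
pose s' := [seq (a - x0)%:C | a <- s].
pose V x := ln C + 2 * pi * A * r * `|sin (2 * pi * x)|.
have K0 : 0 <= 2 * pi * A * r by rewrite !mulr_ge0// ltW.
have cV : continuous V.
  move=> x; apply: cvgD; first exact: cvg_cst.
  by apply: cvgM; [exact: cvg_cst|exact: continuous_abs_sin].
have IV : Rintegral mu `[0, 1] V = ln C + 4 * A * r.
  rewrite RintegralD//; last 2 first.
  - by apply: continuous_integrable_itv => x; exact: cvg_cst.
  - apply: continuous_integrable_itv => x; apply: cvgM; [exact: cvg_cst|exact: continuous_abs_sin].
  rewrite Rintegral_cst//= lebesgue_measure_itv /= lte_fin ltr01 /= subr0 mulr1.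
  rewrite RintegralZl//; last by apply: continuous_integrable_itv; exact: continuous_abs_sin.
  rewrite Rintegral_abs_sin; congr (_ + _).
  by move: (pi : R) (lt0r_neq0 p0) => q q0; field.
have -> : C * expR (4 * A * r) = expR (Rintegral mu `[0, 1] V).
  by rewrite IV expRD lnK.
have -> : \prod_(a <- s) (r / `|a - x0|) = \prod_(a <- s') (r / normc a).
  by rewrite big_map; apply: eq_bigr => a _; rewrite normc_real.
have -> : H x0%:C = F 0 by rewrite /F addr0.
apply: (@jensen_zeros s' F r V (ln C)) => //.
- by rewrite map_inj_uniq// => a b /= [] /addIr.
- move=> _ /mapP[a /hs[a0 ar Ha] ->]; rewrite normc_real; split => //.
    by rewrite (_ : 0 = (0 : R)%:C)// (inj_eq (@complexI _)) subr_eq0.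
  by rewrite /F -rmorphD /= subrKC.
- apply: papprox_subset (eF r) => z hz; rewrite /cdisk /=.
  case: hz => [->|->//|/mapP[a /hs[_ /ltW ar _] ->]]; first by rewrite normc0 ltW.
  by rewrite normc_real.
- by move=> x; rewrite lerDl mulr_ge0.
- move=> x; rewrite expRD lnK//; apply: le_trans (HC _) _.
  rewrite ler_wpM2l ?(ltW C0)// ler_expR.
  rewrite ImD ImM /= add0r mul0r addr0 normrM (gtr0_norm r0) !mulrA; lra.
Qed.

End jensen.

(** * Logarithmic integrals and density of real zeros *)

Section log_integral.
Context {R : realType}.
Notation mu := (@lebesgue_measure R).
Implicit Types (x y t r e : R) (z w : R[i]) (F G H : R[i] -> R[i]).

Definition cayley w : R[i] := (1 + w) / (1 - w).

Lemma cayleyB u v : u != 1 -> v != 1 ->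
  cayley u - cayley v = 2 * (u - v) / ((1 - u) * (1 - v)).
Proof.
move=> u1 v1; have u1' : 1 - u != 0 by rewrite subr_eq0 eq_sym.
have v1' : 1 - v != 0 by rewrite subr_eq0 eq_sym.
by rewrite /cayley; field; rewrite u1' v1'.
Qed.

Lemma cayley_cont (T : Type) (l : set_system T) {FF : Filter l} (u : T -> R[i]) v : v != 1 ->
  (fun t : T => normc (u t - v)) @ l --> (0 : R) ->
  (fun t : T => normc (cayley (u t) - cayley v)) @ l --> (0 : R).
Proof.
move=> v1 hu; have v1' : 1 - v != 0 by rewrite subr_eq0 eq_sym.
set d := normc (1 - v); have d0 : 0 < d by rewrite normc_gt0.
apply/cvgrPdist_le => e e0.
have K0 : 0 < Num.min (d / 2) (e * d ^+ 2 / 4).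
  by rewrite lt_min !divr_gt0// mulr_gt0// exprn_gt0.
move/cvgrPdist_le : hu => /(_ _ K0); apply: filterS => t.
rewrite !sub0r !normrN !(ger0_norm (normc_ge0 _)) le_min => /andP[h1 h2].
have h3 : d / 2 <= normc (1 - u t).
  have := ler_dist_normc (1 - v) (u t - v).
  rewrite (_ : 1 - v - (u t - v) = 1 - u t); last by ring.
  by rewrite -/d; lra.
have u1 : u t != 1.
  apply: contraTN h3 => /eqP ->; rewrite subrr normc0 -ltNge; lra.
rewrite cayleyB// normcM normcV !normcM -/d (_ : 2 = (2%:R)%:C); last by rewrite rmorph_nat.
rewrite normc_real (ger0_norm (ler0n _ 2)).
rewrite ler_pdivrMr ?mulr_gt0//; last by lra.
apply: (@le_trans _ _ (e * (d / 2 * d))); first by rewrite expr2 in h2; lra.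
by rewrite ler_wpM2l ?(ltW e0)// ler_wpM2r ?(ltW d0).
Qed.

Lemma cis_cont x : (fun t => normc (cis t - cis x)) @ x --> (0 : R).
Proof.
have c1 : (fun t : R => cos (2 * pi * t)) @ x --> cos (2 * pi * x).
  apply: (continuous_comp (f := fun x => 2 * pi * x) (g := cos)); last exact: continuous_cos.
  by apply: cvgM; [exact: cvg_cst|exact: cvg_id].
have c2 : (fun t : R => sin (2 * pi * t)) @ x --> sin (2 * pi * x).
  apply: (continuous_comp (f := fun x => 2 * pi * x) (g := sin)); last exact: continuous_sin.
  by apply: cvgM; [exact: cvg_cst|exact: cvg_id].
apply/cvgrPdist_le => e e0; have e20 : 0 < e / 2 by rewrite divr_gt0.
move/cvgrPdist_le : c1 => /(_ _ e20) c1; move/cvgrPdist_le : c2 => /(_ _ e20) c2.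
apply: filterS2 c1 c2 => t; rewrite distrC [X in _ -> X <= _ -> _]distrC => h1 h2.
rewrite sub0r normrN ger0_norm ?normc_ge0//; apply: le_trans (normc_le_ReIm _) _ => /=.
by lra.
Qed.

Lemma cvg_normcM (T : Type) (l : set_system T) {FF : Filter l} (u : T -> R[i]) v c :
  (fun t : T => normc (u t - v)) @ l --> (0 : R) ->
  (fun t : T => normc (c * u t - c * v)) @ l --> (0 : R).
Proof.
move=> h; under eq_fun do rewrite -mulrBr normcM.
by rewrite -(mulr0 (normc c)); apply: cvgM => //; exact: cvg_cst.
Qed.

Lemma cvg_normcDl (T : Type) (l : set_system T) {FF : Filter l} (u : T -> R[i]) v c :
  (fun t : T => normc (u t - v)) @ l --> (0 : R) ->
  (fun t : T => normc ((c + u t) - (c + v))) @ l --> (0 : R).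
Proof. by move=> h; under eq_fun do rewrite opprD addrACA subrr add0r. Qed.

Lemma cvg_normc (T : Type) (l : set_system T) {FF : Filter l} (u : T -> R[i]) v :
  (fun t : T => normc (u t - v)) @ l --> (0 : R) ->
  (fun t : T => normc (u t)) @ l --> normc v.
Proof.
move=> /cvgrPdist_le h; apply/cvgrPdist_le => e /h; apply: filterS => t.
rewrite sub0r normrN ger0_norm ?normc_ge0//; apply: le_trans.
by rewrite distrC; exact: ler_normr_dist_normc.
Qed.

(* The map w |-> x0 + i y0 (1 + w) / (1 - w) sends the unit disk to the upper
   half-plane, 0 to x0 + i y0 and cis x to x0 - y0 cot (pi x). *)
Definition halfplane (x0 y0 : R) w : R[i] := x0%:C + (y0 *i) * cayley w.

Lemma halfplane_cont x0 y0 (T : Type) (l : set_system T) {FF : Filter l} (u : T -> R[i]) v : v != 1 ->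
  (fun t : T => normc (u t - v)) @ l --> (0 : R) ->
  (fun t : T => normc (halfplane x0 y0 (u t) - halfplane x0 y0 v)) @ l --> (0 : R).
Proof. by move=> v1 h; apply: cvg_normcDl; apply: cvg_normcM; exact: cayley_cont. Qed.

Lemma Im_halfplane x0 y0 w : 0 <= y0 -> normc w < 1 -> 0 <= complex.Im (halfplane x0 y0 w).
Proof.
move=> y00 hw; have w1 : 1 - w != 0.
  by rewrite subr_eq0; apply: contraTN hw => /eqP <-; rewrite normc1 ltxx.
rewrite /halfplane ImD ImM /= mul0r !add0r mulr_ge0//.
have n0 : 0 < normc (1 - w) by rewrite normc_gt0.
have -> : cayley w = (1 + w) * conjc (1 - w) * ((normc (1 - w) ^- 2)%:C).
  rewrite /cayley fmorphV /= -mulc_conj invfM mulrACA -mulrA; congr (_ * _).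
  by rewrite divff ?mulr1// conjc_eq0.
rewrite ReM /= mulr0 subr0 mulr_ge0 ?invr_ge0 ?exprn_ge0 ?normc_ge0//.
have : normc w ^+ 2 <= 1 by rewrite expr_le1 ?normc_ge0// ltW.
rewrite sqr_normcE; case: w {hw w1 n0} => a b /=; nra.
Qed.

Lemma papprox_halfplane x0 y0 r : r < 1 -> papprox (cdisk r) (halfplane x0 y0).
Proof.
have [r0 r1|r0 _] := leP 0 r; last exact: cdisk_neg.
have h : papprox (cdisk r) (fun w => (1 + w) * (1 - w)^-1).
  apply: (papproxM r0 (@subset_refl _ _)); last exact: papprox_geom.
  by apply: entireD; [exact: entire_cst|exact: entire_id].
have h2 := papproxM r0 (@subset_refl _ _) (@entire_cst R (y0 *i) r) h.
exact: papproxD (@entire_cst R x0%:C r) h2.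
Qed.

Lemma cayley_cis x : sin (pi * x) != 0 ->
  ('i : R[i]) * cayley (cis x) = (- (cos (pi * x) / sin (pi * x)))%:C.
Proof.
set a := cos _; set b := sin _ => b0.
have ab : a ^+ 2 + b ^+ 2 = 1 by exact: cos2Dsin2.
have hx : cis x = (a ^+ 2 - b ^+ 2) +i* (2 * a * b).
  rewrite /cis /expi (_ : 2 * pi * x = (pi * x) *+ 2); last by rewrite -mulr_natl; ring.
  apply: complex_ext => /=; first by rewrite cos_mulr2n -/a -mulr_natl; lra.
  by rewrite sin_mulr2n -/a -/b -mulr_natl; ring.
have c1 : 1 - cis x != 0.
  rewrite hx; apply/eqP => /(congr1 (@complex.Re R)) /= h.
  by have : 0 < b ^+ 2; [rewrite exprn_even_gt0|lra].
apply: (mulIf c1); rewrite /cayley -!mulrA mulVf// mulr1 hx.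
apply: complex_ext => /=.
  have -> : 0 * (1 + (a ^+ 2 - b ^+ 2)) - 1 * (0 + 2 * a * b) = - (2 * a * b) by ring.
  transitivity (- (a / b) * (1 - (a ^+ 2 - b ^+ 2))); last by ring.
  by rewrite (_ : 1 - (a ^+ 2 - b ^+ 2) = 2 * b ^+ 2); [field|lra].
have -> : 0 * (0 + 2 * a * b) + 1 * (1 + (a ^+ 2 - b ^+ 2)) = 2 * a ^+ 2 by lra.
by field.
Qed.

Lemma dist_maxr_le (a b c : R) : `|Num.max a c - Num.max b c| <= `|a - b|.
Proof.
rewrite /Num.max; case: ifPn; case: ifPn; rewrite -?leNgt => h1 h2; rewrite ?subrr ?normr0//.
- by rewrite !ler_norml; move: (ler_norm (a - b)) (ler_norm (b - a)); rewrite (distrC b a); lra.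
- by rewrite !ler_norml; move: (ler_norm (a - b)) (ler_norm (b - a)); rewrite (distrC b a); lra.
Qed.

Lemma Rintegral_subset (D1 D2 : set R) (f : R -> R) : measurable D1 -> measurable D2 ->
  D1 `<=` D2 -> mu.-integrable D2 (fun x => (f x)%:E) -> (forall x, D2 x -> 0 <= f x) ->
  Rintegral mu D1 f <= Rintegral mu D2 f.
Proof.
move=> m1 m2 s12 i2 f0; have i1 : mu.-integrable D1 (fun x => (f x)%:E) by apply: integrableS i2.
apply: fine_le; [exact: integrable_fin_num|exact: integrable_fin_num|].
by apply: ge0_subset_integral => //; exact: (measurable_int _ i2).
Qed.

Section log_integral_bound.
Variables (A C : R) (H : R[i] -> R[i]) (x0 y0 : R).
Hypotheses (A0 : 0 <= A) (C0 : 0 < C) (eH : entire H)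
  (HC : forall z, normc (H z) <= C * expR (2 * pi * A * `|complex.Im z|))
  (y0_gt0 : 0 < y0) (H0 : H (x0 +i* y0) != 0).

(** The exponential factor offsets the growth of [H] in the upper half-plane, where [h] is bounded
    by [C], and has modulus one on the real line. *)
Let h z : R[i] := H z * cexp ((2 * pi * A) *i * z).

Let eh : entire h.
Proof.
apply: entireM => //; apply: (entire_comp (G := fun z => (2 * pi * A) *i * z)).
  exact: entire_cexp.
by apply: entireM; [exact: entire_cst|exact: entire_id].
Qed.

Let normc_h z : normc (h z) = normc (H z) * expR (- (2 * pi * A * complex.Im z)).
Proof. by rewrite normcM normc_cexp ReM /= mul0r sub0r. Qed.

Let h_real x : normc (h x%:C) = normc (H x%:C).
Proof. by rewrite normc_h /= mulr0 oppr0 expR0 mulr1. Qed.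

Let h_le z : 0 <= complex.Im z -> normc (h z) <= C.
Proof.
move=> z0; rewrite normc_h; apply: le_trans (ler_wpM2r (expR_ge0 _) (HC z)) _.
by rewrite ger0_norm// -[leLHS]mulrA -expRD subrr expR0 mulr1.
Qed.

Let L (e : R) w := ln (Num.max (normc (h (halfplane x0 y0 w))) e).

Let L_le e w : 0 < e -> e <= C -> 0 <= complex.Im (halfplane x0 y0 w) -> L e w <= ln C.
Proof.
move=> e0 eC w1; rewrite ler_ln ?posrE//; last by rewrite lt_max e0 orbT.
by rewrite ge_max eC andbT h_le.
Qed.

Let L_ge e w : 0 < e -> ln e <= L e w.
Proof. by move=> e0; rewrite ler_ln ?posrE// ?lt_max ?e0 ?orbT// le_max lexx orbT. Qed.

Let L_cont e (T : Type) (l : set_system T) {FF : Filter l} (u : T -> R[i]) v : 0 < e -> v != 1 ->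
  (fun t : T => normc (u t - v)) @ l --> (0 : R) -> (fun t : T => L e (u t)) @ l --> L e v.
Proof.
move=> e0 v1 hu; apply: continuous_cvg.
  by apply: continuous_ln; rewrite lt_max e0 orbT.
have : (fun t : T => normc (h (halfplane x0 y0 (u t)))) @ l --> normc (h (halfplane x0 y0 v)).
  by apply: cvg_normc; apply: entire_cont => //; exact: halfplane_cont.
move=> /cvgrPdist_le hc; apply/cvgrPdist_le => d /hc; apply: filterS => t.
exact: le_trans (dist_maxr_le _ _ _).
Qed.

Let halfplane_real x : 0 < x < 1 ->
  halfplane x0 y0 (cis x) = (complex.Re (halfplane x0 y0 (cis x)))%:C.
Proof.
move=> /andP[h1 h2]; apply: complex_ext; first by [].
change (complex.Im (halfplane x0 y0 (cis x)) = 0).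
have b0 : sin (pi * x) != 0.
  rewrite lt0r_neq0//; apply: sin_gt0_pi; rewrite mulr_gt0 ?pi_gt0//= -[ltRHS]mulr1.
  by rewrite ltr_pM2l ?pi_gt0.
rewrite /halfplane (_ : y0 *i = y0%:C * 'i); last by apply: complex_ext => /=; ring.
by rewrite -mulrA cayley_cis//= !mulr0 !(mul0r,addr0,add0r).
Qed.

Let sin_pi_gt0 x : 0 < x < 1 -> 0 < sin (pi * x).
Proof.
move=> /andP[h1 h2]; apply: sin_gt0_pi; rewrite mulr_gt0 ?pi_gt0//= -[ltRHS]mulr1.
by rewrite ltr_pM2l ?pi_gt0.
Qed.

Let cis_neq1 x : 0 < x < 1 -> cis x != 1.
Proof.
move=> h1; apply/eqP => /cis_eq1[k hk]; move: h1; rewrite hk ltr0z ltrz1; lia.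
Qed.

Let normc_rcis (r x : R) : 0 <= r -> normc (r%:C * cis x) = r.
Proof. by move=> r0; rewrite normcM normc_cis mulr1 normc_real ger0_norm. Qed.

(** The radius is kept below [1] because [halfplane] has a pole at [1]. The endpoints of the
    interval, which correspond to the direction of the pole, are dropped in view of the limit
    [r -> 1]. *)
Let jensen_halfplane (r e : R) : 0 < r < 1 -> 0 < e -> e <= C ->
  ln (normc (h (x0 +i* y0))) <= Rintegral mu `]0, 1[ (fun x => L e (r%:C * cis x)).
Proof.
move=> /andP[r0 r1] e0 eC.
have rcis1 x : r%:C * cis x != 1.
  by apply: contraTN r1 => /eqP h1; rewrite -leNgt -(normc_rcis x (ltW r0)) h1 normc1.
have cV : continuous (fun x => L e (r%:C * cis x)).
  by move=> x; apply: L_cont => //; apply: cvg_normcM; exact: cis_cont.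
rewrite Rintegral_itv_obnd_cbnd; last first.
  by apply: integrableS (continuous_integrable_itv 0 1 cV) => //; exact: subset_itv_oo_cc.
rewrite Rintegral_itv_bndo_bndc; last first.
  by apply: integrableS (continuous_integrable_itv 0 1 cV) => //; exact: subset_itv_co_cc.
have hz0 : h (x0 +i* y0) = h (halfplane x0 y0 0).
  congr h; rewrite /halfplane /cayley subr0 addr0 divr1 mulr1.
  by apply: complex_ext; rewrite ?ReD ?ImD /= ?addr0 ?add0r.
have pos : 0 < normc (h (x0 +i* y0)).
  by rewrite normc_h mulr_gt0 ?expR_gt0// normc_gt0.
rewrite -ler_expR lnK ?posrE// hz0.
apply: (@papprox_jensen _ (cdisk r) (fun w => h (halfplane x0 y0 w)) r%:C _ (ln e)) => //.
- have [M M0 hM] := papprox_bounded (ltW r0) (@subset_refl _ _) (papprox_halfplane x0 y0 r1).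
  exact: (papprox_comp (ltW r0) (@subset_refl _ _) hM (papprox_halfplane x0 y0 r1) (eh M)).
- by rewrite /cdisk /mkset normc0 ltW.
- by move=> x; rewrite /cdisk /mkset normc_rcis// ltW.
- by move=> x; exact: L_ge.
- move=> x; rewrite /L lnK ?posrE ?lt_max ?e0 ?orbT// le_max lexx//.
Qed.

(** Dominated convergence as [r -> 1]: the integrands lie between [ln e] and [ln C], and they
    converge wherever [cis x] differs from [1]. *)
Let L_lim_jensen (e : R) : 0 < e -> e <= C ->
  measurable_fun (`]0, 1[%classic : set R) (fun x => L e (cis x)) /\
  ln (normc (h (x0 +i* y0))) <= Rintegral mu `]0, 1[ (fun x => L e (cis x)).
Proof.
(* The shift by [2] keeps [rho 0 = 1 / 2] positive. *)
move=> e0 eC; pose rho n : R := 1 - (n.+2%:R)^-1.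
have rho01 n : 0 < rho n < 1.
  rewrite /rho subr_gt0 gtrBl invr_gt0 ltr0n andbT.
  by rewrite invf_lt1 ?ltr0n// ltr1n.
have hu x : (fun n => normc ((rho n)%:C * cis x - cis x)) @ \oo --> (0 : R).
  under eq_fun do rewrite -[X in _ - X]mul1r -mulrBl normcM normc_cis mulr1.
  rewrite (_ : (fun _ => _) = (fun n : nat => (n.+2%:R)^-1)).
    have hh := @cvg_harmonic R; rewrite -cvg_shiftS in hh; exact: hh.
  apply/funext => n; rewrite /rho (_ : (1 - _)%:C - 1 = (- (n.+2%:R)^-1)%:C).
    by rewrite normc_real normrN ger0_norm// invr_ge0.
  by rewrite rmorphB rmorphN /= addrAC subrr sub0r.
have hlim x : (`]0, 1[%classic : set R) x -> (fun n => L e ((rho n)%:C * cis x)) @ \oo --> L e (cis x).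
  by rewrite /= in_itv /= => x01; apply: L_cont => //; exact: cis_neq1.
have mL n : measurable_fun (`]0, 1[%classic : set R) (fun x => L e ((rho n)%:C * cis x)).
  apply: (@measurable_funS _ _ _ _ setT) => //; apply: continuous_measurable_fun => x.
  have /andP[r0 r1] := rho01 n.
  apply: L_cont => //; last by apply: cvg_normcM; exact: cis_cont.
  by apply: contraTN r1 => /eqP h1; rewrite -leNgt -(normc_rcis x (ltW r0)) h1 normc1.
have mL' : measurable_fun (`]0, 1[%classic : set R) (fun x => L e (cis x)).
  by apply: (@measurable_fun_cvg _ _ _ _ (fun n x => L e ((rho n)%:C * cis x))).
split => //.
have iM : mu.-integrable `]0, 1[ (fun=> (`|ln e| + `|ln C|)%:E).
  apply: integrableS (continuous_integrable_itv 0 1 (@cst_continuous _ _ (`|ln e| + `|ln C|))) => //.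
  exact: subset_itv_oo_cc.
have := @Rintegral_dct _ `]0, 1[%classic (fun n x => L e ((rho n)%:C * cis x)) _ _ (measurable_itv _) mL mL' hlim iM.
have bd n x : `]0, 1[%classic x -> `|L e ((rho n)%:C * cis x)| <= `|ln e| + `|ln C|.
  move=> _; have /andP[r0 r1] := rho01 n.
  have h1 := L_ge ((rho n)%:C * cis x) e0.
  have h2 : L e ((rho n)%:C * cis x) <= ln C.
    by apply: L_le => //; apply: Im_halfplane; rewrite ?(ltW y0_gt0)// normc_rcis ?(ltW r0).
  rewrite ler_norml; have := ler_norm (ln C); have := ler_norm (- ln e); rewrite normrN.
  have := normr_ge0 (ln e); have := normr_ge0 (ln C); lra.
move=> /(_ bd) hc.
rewrite -(cvg_lim _ hc)//; apply: limr_ge; first by apply/cvg_ex; eexists; exact: hc.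
by apply: nearW => n; exact: jensen_halfplane.
Qed.

(** The inverse of the boundary map [x |-> x0 - y0 cot (pi x)]; substituting it turns the mean over
    the circle into the Poisson integral at [x0 + i y0]. *)
Let s x : R := 1 / 2 + pi^-1 * atan (y0^-1 * (x - x0)).

Let s01 x : 0 < s x < 1.
Proof.
have p0 := @pi_gt0 R; rewrite /s; set a := atan _.
have a1 : a < pi / 2 by exact: atan_ltpi2.
have a2 : - (pi / 2) < a by exact: atan_gtNpi2.
have hk : pi^-1 * pi = 1 :> R by rewrite mulVf// lt0r_neq0.
have q0 : 0 < pi^-1 :> R by rewrite invr_gt0.
have h1 : pi^-1 * a < pi^-1 * (pi / 2) by rewrite ltr_pM2l.
have h2 : pi^-1 * - (pi / 2) < pi^-1 * a by rewrite ltr_pM2l.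
move: h1 h2; rewrite mulrN mulrA hk; lra.
Qed.

Let halfplane_s x : halfplane x0 y0 (cis (s x)) = x%:C.
Proof.
have b0 := sin_pi_gt0 (s01 x).
rewrite /halfplane (_ : y0 *i = y0%:C * 'i); last by apply: complex_ext => /=; ring.
rewrite -mulrA cayley_cis ?lt0r_neq0//.
have -> : pi * s x = atan (y0^-1 * (x - x0)) + pi / 2.
  by rewrite /s; move: (atan _) (pi : R) (lt0r_neq0 (@pi_gt0 R)) => a q q0; field.
rewrite sinDpihalf cosDpihalf mulNr opprK.
rewrite (_ : sin _ / cos _ = y0^-1 * (x - x0)); last by have := atanK (y0^-1 * (x - x0)).
by rewrite -rmorphM -rmorphD /= mulVKf ?subrKC// lt0r_neq0.
Qed.

Let ds x : is_derive x 1 s (pi^-1 * ((1 + (y0^-1 * (x - x0)) ^+ 2)^-1 * y0^-1)).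
Proof.
have h1 : is_derive x 1 (fun x : R => y0^-1 * (x - x0)) y0^-1.
  have -> : (fun x : R => y0^-1 * (x - x0)) = (fun x : R => y0^-1 * x + (- (y0^-1 * x0))).
    by apply/funext => u; rewrite mulrBr.
  have hh := is_derive_mull y0^-1 x.
  by have := is_deriveD hh (is_derive_cst (- (y0^-1 * x0)) x 1); rewrite addr0.
have h2 := @is_derive1_comp _ atan (fun x : R => y0^-1 * (x - x0)) x _ _ (is_derive1_atan _) h1.
have h3 := @is_derive1_comp _ (fun u => pi^-1 * u) _ x _ _ (is_derive_mull pi^-1 _) h2.
have := is_deriveD (is_derive_cst (1 / 2 : R) x 1) h3.
by rewrite add0r.
Qed.

(** The derivative of [s], that is, the Poisson kernel [y0 / (pi (y0^2 + (x - x0)^2))]. *)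
Let w x : R := pi^-1 * ((1 + (y0^-1 * (x - x0)) ^+ 2)^-1 * y0^-1).

Let w_cont : continuous w.
Proof.
move=> x; apply: cvgM; first exact: cvg_cst.
apply: cvgM; last exact: cvg_cst.
apply: cvgV; first by rewrite lt0r_neq0// ltr_pwDl// sqr_ge0.
apply: cvgD; first exact: cvg_cst.
have h1 : (fun x : R => y0^-1 * (x - x0)) @ x --> y0^-1 * (x - x0).
  by apply: cvgM; [exact: cvg_cst|apply: cvgB; [exact: cvg_id|exact: cvg_cst]].
exact: (cvgM h1 h1).
Qed.

Let dsE : (s^`())%classic = w.
Proof. by apply/funext => x; rewrite derive1E (@derive_val _ _ _ _ _ _ _ (ds x)). Qed.

Let s_cont : continuous s.
Proof.
move=> x; have /derivable1_diffP/differentiable_continuous := @ex_derive _ _ _ _ _ _ _ (ds x).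
exact.
Qed.

Let s_mono : {homo s : x y / x < y}.
Proof.
move=> x y xy; rewrite /s ltrD2l ltr_pM2l ?invr_gt0 ?pi_gt0//; apply: lt_atan.
by rewrite ltr_pM2l ?invr_gt0// ltrD2r.
Qed.

(* The deficit of ln |H| below its bound ln C, truncated to be continuous at the zeros. *)
Definition logdef (e : R) (x : R) := ln C - ln (Num.max (normc (H x%:C)) e).

Lemma logdef_cont e : 0 < e -> continuous (logdef e).
Proof.
move=> e0 x; apply: cvgB; first exact: cvg_cst.
apply: continuous_cvg; first by apply: continuous_ln; rewrite lt_max e0 orbT.
have : (fun t : R => normc (H t%:C)) @ x --> normc (H x%:C).
  apply: cvg_normc; apply: entire_cont => //.
  under eq_fun do rewrite -rmorphB normc_real.
  have := @cvg_norm _ _ _ (nbhs x) _ (fun t : R => t - x) 0; rewrite normr0; apply.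
  by rewrite -[X in _ --> X](subrr x); apply: cvgB; [exact: cvg_id|exact: cvg_cst].
move=> /cvgrPdist_le hc; apply/cvgrPdist_le => d /hc; apply: filterS => t.
exact: le_trans (dist_maxr_le _ _ _).
Qed.

Lemma logdef_ge0 e x : 0 < e -> e <= C -> 0 <= logdef e x.
Proof.
move=> e0 eC; rewrite subr_ge0 ler_ln ?posrE ?lt_max ?e0 ?orbT// ge_max eC andbT.
by have := HC x%:C; rewrite /= normr0 mulr0 expR0 mulr1.
Qed.

(** The substitution [s] carries [[a, b]] into []0, 1[]. As the deficit is nonnegative, its mean
    over the whole circle is an upper bound, and Jensen's inequality bounds that mean independently
    of [e], [a] and [b]. *)
Lemma logdef_weight_int (e a b : R) : 0 < e -> e <= C -> a <= b ->
  Rintegral mu `[a, b] (fun x => logdef e x * w x) <= ln C - ln (normc (h (x0 +i* y0))).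
Proof.
move=> e0 eC ab.
pose G x := ln C - L e (cis x).
have Gs x : G (s x) = logdef e x.
  by rewrite /G /L halfplane_s h_real.
have G0 x : 0 < x < 1 -> 0 <= G x.
  move=> x01; rewrite /G subr_ge0 /L.
  rewrite ler_ln ?posrE ?lt_max ?e0 ?orbT// ge_max eC andbT.
  have := @halfplane_real x x01; set u := halfplane _ _ _ => ->; rewrite h_real.
  by have := HC (complex.Re u)%:C; rewrite /= normr0 mulr0 expR0 mulr1.
have Gc x : 0 < x < 1 -> G @ x --> G x.
  move=> x01; apply: cvgB; first exact: cvg_cst.
  by apply: L_cont => //; [exact: cis_neq1|exact: cis_cont].
have sab : s a <= s b by move: ab; rewrite le_eqVlt => /predU1P[->//|/s_mono/ltW].
have -> : Rintegral mu `[a, b] (fun x => logdef e x * w x) = Rintegral mu `[s a, s b] G.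
  rewrite /Rintegral; congr fine; rewrite (@integration_by_substitution_increasing _ s G a b)//.
  - apply: eq_integral => x _; rewrite dsE; congr EFin.
    by change (logdef e x * w x = G (s x) * w x); rewrite Gs.
  - by move=> x y _ _; exact: s_mono.
  - by rewrite dsE => x _; exact: w_cont.
  - by rewrite dsE; apply/cvg_ex; exists (w a); apply: cvg_at_right_filter; exact: w_cont.
  - by rewrite dsE; apply/cvg_ex; exists (w b); apply: cvg_at_left_filter; exact: w_cont.
  - split => [x _||].
    + exact: (@ex_derive _ _ _ _ _ _ _ (ds x)).
    + by apply: cvg_at_right_filter; exact: s_cont.
    + by apply: cvg_at_left_filter; exact: s_cont.
  - apply: continuous_in_subspaceT => x; rewrite inE /= in_itv /= => /andP[h1 h2].
    apply: Gc; have /andP[k1 _] := s01 a; have /andP[_ k2] := s01 b.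
    by rewrite (lt_le_trans k1 h1) (le_lt_trans h2 k2).
have [mL hL] := L_lim_jensen e0 eC.
have iL : mu.-integrable (`]0, 1[%classic : set R) (fun x => (L e (cis x))%:E).
  have iM : mu.-integrable (`]0, 1[%classic : set R) (fun=> (`|ln e| + `|ln C|)%:E).
    apply: integrableS (continuous_integrable_itv 0 1 (@cst_continuous _ _ (`|ln e| + `|ln C|))) => //.
    exact: subset_itv_oo_cc.
  apply: le_integrable iM => //; first exact/measurable_EFinP.
  move=> x; rewrite /= in_itv /= => x01; rewrite lee_fin.
  rewrite [leRHS]ger0_norm ?addr_ge0//.
  have h1 := L_ge (cis x) e0; have h2 := G0 x x01; rewrite /G in h2.
  rewrite ler_norml; have := ler_norm (ln C); have := ler_norm (- ln e); rewrite normrN.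
  have := normr_ge0 (ln e); have := normr_ge0 (ln C); lra.
have iG : mu.-integrable (`]0, 1[%classic : set R) (fun x => (G x)%:E).
  apply: (@integrable_subr _ _ (fun=> ln C) (fun x => L e (cis x))) => //.
  apply: integrableS (continuous_integrable_itv 0 1 (@cst_continuous _ _ (ln C))) => //.
  exact: subset_itv_oo_cc.
apply: (@le_trans _ _ (Rintegral mu `]0, 1[ G)).
  apply: Rintegral_subset => //.
    move=> x; rewrite /= !in_itv /= => /andP[h1 h2].
    have /andP[k1 _] := s01 a; have /andP[_ k2] := s01 b.
    by rewrite (lt_le_trans k1 h1) (le_lt_trans h2 k2).
rewrite RintegralB//; last first.
  apply: integrableS (continuous_integrable_itv 0 1 (@cst_continuous _ _ (ln C))) => //.
  exact: subset_itv_oo_cc.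
rewrite Rintegral_cst//= lebesgue_measure_itv /= lte_fin ltr01 /= subr0 mulr1.
by rewrite lerD2l lerN2.
Qed.

End log_integral_bound.

(** By continuity a nonzero value on the real line persists just above it, where the Poisson
    integral can be centred. *)
Lemma PW_shift_nonzero H x0 : entire H -> H x0%:C != 0 ->
  exists2 y0, 0 < y0 & H (x0 +i* y0) != 0.
Proof.
move=> eH Hx; pose u n : R := (n.+1%:R)^-1.
have hu : (fun n => normc (x0 +i* u n - x0%:C)) @ \oo --> (0 : R).
  have hn n : normc (x0 +i* u n - x0%:C) = u n.
    rewrite (_ : _ - _ = 'i * (u n)%:C); last by apply: complex_ext => /=; ring.
    rewrite normcM normc_real ger0_norm ?invr_ge0//=.
    by rewrite expr0n add0r expr1n sqrtr1 mul1r.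
  under eq_fun do rewrite hn; exact: cvg_harmonic.
have hH : (fun n => normc (H (x0 +i* u n) - H x0%:C)) @ \oo --> (0 : R) by exact: entire_cont hu.
move/cvgrPdist_lt : hH => /(_ (normc (H x0%:C))).
rewrite normc_gt0 Hx => /(_ isT)[n _ /(_ n (leqnn n)) hn].
exists (u n); first by rewrite invr_gt0.
apply/eqP => h; move: hn; rewrite /= h sub0r normrN sub0r normcN ger0_norm ?normc_ge0//.
by rewrite ltxx.
Qed.

(** The bound [K] is uniform in the truncation level [e] and in the length [r]: this is the
    finiteness of the logarithmic integral of a function not identically zero on the line. *)
Lemma log_integral A C H x0 : 0 <= A -> 0 < C -> entire H ->
  (forall z, normc (H z) <= C * expR (2 * pi * A * `|complex.Im z|)) -> H x0%:C != 0 ->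
  exists K, forall e r, 0 < e -> e <= C -> 0 <= r ->
    Rintegral mu `[(- r), r] (fun x => logdef C H e x / (1 + x ^+ 2)) <= K.
Proof.
move=> A0 C0 eH HC Hx; have [y0 y00 Hy] := PW_shift_nonzero eH Hx.
pose w x : R := pi^-1 * ((1 + (y0^-1 * (x - x0)) ^+ 2)^-1 * y0^-1).
(* By [(x - x0)^2 <= 2 (x^2 + x0^2)], this constant compares the weight [1 / (1 + x^2)] with the
   Poisson kernel at [x0 + i y0]. *)
pose M := 1 + 2 * y0^-1 ^+ 2 * (1 + x0 ^+ 2).
have p0 := @pi_gt0 R.
have M0 : 0 < M.
  have a0 := sqr_ge0 y0^-1; have b0 := sqr_ge0 x0; have := mulr_ge0 a0 b0.
  by rewrite /M; nra.
pose k := pi * y0 * M; have k0 : 0 < k by rewrite !mulr_gt0.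
have wk x : (1 + x ^+ 2)^-1 <= k * w x.
  have d0 : 0 < 1 + (y0^-1 * (x - x0)) ^+ 2 by rewrite ltr_pwDl// sqr_ge0.
  have d1 : 0 < 1 + x ^+ 2 by rewrite ltr_pwDl// sqr_ge0.
  have -> : k * w x = M / (1 + (y0^-1 * (x - x0)) ^+ 2).
    rewrite /k /w; move: (pi : R) (lt0r_neq0 p0) (1 + _) (lt0r_neq0 d0) => q q0 v v0.
    by field; rewrite v0 q0 lt0r_neq0.
  rewrite ler_pdivlMr// mulrC ler_pdivrMr// /M exprMn.
  set q := _ ^+ 2; have q0 : 0 <= q by exact: sqr_ge0.
  have h1 : (x - x0) ^+ 2 <= 2 * (x ^+ 2 + x0 ^+ 2) by have := sqr_ge0 (x + x0); nra.
  have h2 : q * (x - x0) ^+ 2 <= q * (2 * (x ^+ 2 + x0 ^+ 2)) by rewrite ler_wpM2l.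
  have h3 : 0 <= q * (x ^+ 2 * x0 ^+ 2) by apply: mulr_ge0 => //; apply: mulr_ge0; exact: sqr_ge0.
  have := sqr_ge0 x; nra.
have wc : continuous (fun x : R => (1 + x ^+ 2)^-1).
  move=> x; apply: cvgV; first by rewrite lt0r_neq0// ltr_pwDl// sqr_ge0.
  by apply: cvgD; [exact: cvg_cst|apply: cvgM; exact: cvg_id].
eexists => e r e0 eC r0.
have rr : - r <= r by rewrite ge0_cp.
have := logdef_weight_int A0 C0 eH HC y00 Hy e0 eC rr.
rewrite -/(w _) => hK.
have cl := @logdef_cont C H eH e e0.
have cw : continuous w.
  move=> x; apply: cvgM; first exact: cvg_cst.
  apply: cvgM; last exact: cvg_cst.
  apply: cvgV; first by rewrite lt0r_neq0// ltr_pwDl// sqr_ge0.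
  apply: cvgD; first exact: cvg_cst.
  have h1 : (fun x : R => y0^-1 * (x - x0)) @ x --> y0^-1 * (x - x0).
    by apply: cvgM; [exact: cvg_cst|apply: cvgB; [exact: cvg_id|exact: cvg_cst]].
  exact: (cvgM h1 h1).
have h1 : Rintegral mu `[- r, r] (fun x => logdef C H e x / (1 + x ^+ 2)) <=
    Rintegral mu `[- r, r] (fun x => k * (logdef C H e x * w x)).
  apply: le_Rintegral => //.
  - by apply: continuous_integrable_itv => x; apply: cvgM; [exact: cl|exact: wc].
  - apply: continuous_integrable_itv => x; apply: cvgM; first exact: cvg_cst.
    by apply: cvgM; [exact: cl|exact: cw].
  - by move=> x _; rewrite mulrCA ler_wpM2l// (logdef_ge0 C0 HC).
apply: le_trans h1 _; rewrite RintegralZl//; last first.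
  by apply: continuous_integrable_itv => x; apply: cvgM; [exact: cl|exact: cw].
by apply: (ler_wpM2l (ltW k0)); exact: hK.
Qed.

End log_integral.

(** * Measure and density of the real zeros *)

Section real_zeros.
Context {R : realType}.
Notation mu := (@lebesgue_measure R).
Implicit Types (x y t r e : R) (z w : R[i]) (H : R[i] -> R[i]).

Lemma inv1Dsqr_cont : continuous (fun x : R => (1 + x ^+ 2)^-1).
Proof.
move=> x; apply: cvgV; first by rewrite lt0r_neq0// ltr_pwDl// sqr_ge0.
by apply: cvgD; [exact: cvg_cst|apply: cvgM; exact: cvg_id].
Qed.

(** The final arithmetic of [log_little_o]: [S] is the supremum of the weighted integrals, [J1] and
    [J] are those over [[-r1, r1]] and [[-r, r]], and [I] is the unweighted integral. *)
Lemma little_o_arith (S eta r r1 I J J1 : R) : 0 < eta -> 0 <= S -> 0 <= r1 -> r1 <= r ->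
  1 + 2 * S * (1 + r1 ^+ 2) / eta <= r -> S - eta / 2 <= J1 -> J <= S ->
  (r ^+ 2 - r1 ^+ 2) * J1 <= (1 + r ^+ 2) * J - I -> I <= eta * r ^+ 2.
Proof.
move=> eta0 S0 r10 rr1 rN J1S JS hI.
have w0 x : 0 <= 1 + x ^+ 2 by rewrite addr_ge0// sqr_ge0.
have v0 : 0 <= 2 * S * (1 + r1 ^+ 2) by rewrite !mulr_ge0.
have r1' : 1 <= r by apply: le_trans rN; rewrite lerDl divr_ge0// ltW.
have q0 : 0 <= r ^+ 2 - r1 ^+ 2.
  by rewrite subr_ge0; apply: sqr_le_abs; rewrite !ger0_norm// (le_trans r10).
have h5 : (r ^+ 2 - r1 ^+ 2) * (S - eta / 2) <= (r ^+ 2 - r1 ^+ 2) * J1 by rewrite ler_wpM2l.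
have h6 : (1 + r ^+ 2) * J <= (1 + r ^+ 2) * S by rewrite ler_wpM2l.
have h7 : 2 * S * (1 + r1 ^+ 2) <= eta * r.
  have h : 2 * S * (1 + r1 ^+ 2) / eta <= r by apply: le_trans rN; rewrite lerDr.
  by rewrite ler_pdivrMr// [r * _]mulrC in h.
have h8 : eta * r <= eta * r ^+ 2 by rewrite ler_wpM2l ?(ltW eta0)// expr2 ler_peMl// (le_trans ler01).
have h9 : 0 <= eta * r1 ^+ 2 by rewrite mulr_ge0 ?sqr_ge0// ltW.
by clear - hI h5 h6 h7 h8 h9; nra.
Qed.

Section nonvanishing.
Variables (A C : R) (H : R[i] -> R[i]) (x0 : R).
Hypotheses (A0 : 0 <= A) (C0 : 0 < C) (eH : entire H)
  (HC : forall z, normc (H z) <= C * expR (2 * pi * A * `|complex.Im z|))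
  (Hx0 : H x0%:C != 0).

Let ldc e : 0 < e -> continuous (logdef C H e) := @logdef_cont R C H eH e.
Let ld0 e x : 0 < e -> e <= C -> 0 <= logdef C H e x.
Proof. exact: (logdef_ge0 C0 HC). Qed.

Let ldw e : 0 < e -> continuous (fun x => logdef C H e x / (1 + x ^+ 2)).
Proof. by move=> e0 x; apply: cvgM; [exact: ldc|exact: inv1Dsqr_cont]. Qed.

(** At truncation level [C * expR (- m)] the deficit equals [m] on the zero set. The zeros in
    [[-n, n]] therefore have measure at most [K (1 + n^2) / m] for every positive [m]. *)
Lemma entire_ae_neq0 : {ae mu, forall x, H x%:C != 0}.
Proof.
have [K hK] := log_integral A0 C0 eH HC Hx0.
have mH : measurable_fun setT (fun x : R => normc (H x%:C)).
  apply: continuous_measurable_fun => x; apply: cvg_normc; apply: entire_cont => //.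
  under eq_fun do rewrite -rmorphB normc_real.
  have := @cvg_norm _ _ _ (nbhs x) _ (fun t : R => t - x) 0; rewrite normr0; apply.
  by rewrite -[X in _ --> X](subrr x); apply: cvgB; [exact: cvg_id|exact: cvg_cst].
pose Z n := `[(- n%:R : R), n%:R]%classic `&` [set x | normc (H x%:C) = 0].
have mZ n : measurable (Z n).
  apply: measurableI => //.
  by have := mH measurableT [set 0] (measurable_set1 0); rewrite setTI.
have Zfin n : (mu (Z n) < +oo)%E.
  apply: (@le_lt_trans _ _ (mu `[(- n%:R : R), n%:R])).
    apply: le_measure; [by rewrite inE; exact: mZ|by rewrite inE; exact: measurable_itv|exact: subIsetl].
  by rewrite /= lebesgue_measure_itv /=; case: ifP => _; rewrite ltry.
have Z0 n : mu (Z n) = 0%E.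
  have fz : mu (Z n) \is a fin_num by rewrite ge0_fin_numE.
  rewrite -(fineK fz); congr EFin; set v := fine _.
  have v0 : 0 <= v by rewrite fine_ge0.
  have n1 : 0 < 1 + n%:R ^+ 2 :> R by rewrite ltr_pwDl// sqr_ge0.
  have key m : m%:R * v <= K * (1 + n%:R ^+ 2).
    pose e := C * expR (- m%:R).
    have e0 : 0 < e by rewrite mulr_gt0// expR_gt0.
    have eC : e <= C by rewrite ger_pMr// -expR0 ler_expR oppr_le0.
    have h1 := hK e n%:R e0 eC (ler0n _ _).
    have i1 := continuous_integrable_itv (- n%:R) n%:R (ldw e0).
    have h2 : Rintegral mu (Z n) (fun x => logdef C H e x / (1 + x ^+ 2)) <=
       Rintegral mu `[- n%:R, n%:R] (fun x => logdef C H e x / (1 + x ^+ 2)).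
      apply: Rintegral_subset => //; first exact: subIsetl.
      by move=> x _; rewrite divr_ge0 ?ld0// addr_ge0// sqr_ge0.
    have h3 : Rintegral mu (Z n) (fun=> m%:R / (1 + n%:R ^+ 2)) <=
       Rintegral mu (Z n) (fun x => logdef C H e x / (1 + x ^+ 2)).
      apply: le_Rintegral.
      - exact: mZ.
      - apply: (@integrableS _ _ _ mu `[(- n%:R : R), n%:R]); [exact: measurable_itv|exact: mZ|exact: subIsetl|].
        by apply: continuous_integrable_itv => x; exact: cvg_cst.
      - by apply: (integrableS _ _ _ i1); [exact: measurable_itv|exact: mZ|exact: subIsetl].
      - move=> x [/=]; rewrite in_itv /= => /andP[x1 x2] Hx.
        have -> : logdef C H e x = m%:R.
          rewrite /logdef Hx max_r ?(ltW e0)// lnM ?posrE ?expR_gt0// expRK; ring.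
        rewrite ler_wpM2l// lef_pV2 ?posrE// ?ltr_pwDl ?sqr_ge0// lerD2l.
        by apply: sqr_le_abs; rewrite [leRHS]ger0_norm// ler_norml x1.
    move: (le_trans h3 (le_trans h2 h1)); rewrite (Rintegral_cst mu (mZ n)) -/v.
    by rewrite mulrAC ler_pdivrMr.
  apply/eqP; rewrite eq_le v0 andbT leNgt; apply/negP => vpos.
  have := key (Num.truncn (K * (1 + n%:R ^+ 2) / v)).+1; apply/negP; rewrite -ltNge.
  by rewrite -ltr_pdivrMr//; exact: truncnS_gt.
have : mu.-negligible (\bigcup_n Z n).
  by apply: negligible_bigcup => n; exists (Z n); split => //; [exact: mZ|exact: Z0].
apply: negligibleS => x /= /negP; rewrite negbK => /eqP hx.
exists (Num.truncn `|x|).+1 => //; split => /=; last by rewrite hx normc0.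
by rewrite in_itv /= -ler_norml ltW//; exact: truncnS_gt.
Qed.

(** Some interval [[-r1, r1]] captures the supremum [S] of the weighted integrals up to [eta / 2].
    The deficit is [(1 + r^2)] times its weighted form minus a function [g] that is nonnegative on
    [[-r, r]], so its integral is at most [(1 + r1^2) S + (r^2 - r1^2) eta / 2]. *)
Lemma log_little_o eta : 0 < eta -> exists N, forall e r, 0 < e -> e <= C -> N <= r ->
  Rintegral mu `[(- r), r] (logdef C H e) <= eta * r ^+ 2.
Proof.
move=> eta0; have [K hK] := log_integral A0 C0 eH HC Hx0.
pose J e r := Rintegral mu `[- r, r] (fun x => logdef C H e x / (1 + x ^+ 2)).
pose E := [set v | exists e r, [/\ 0 < e, e <= C, 0 <= r & v = J e r]].
have supE : has_sup E.
  split; first by exists (J C 0), C, 0.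
  by exists K => v [e [r [e0 eC r0 ->]]]; exact: hK.
have eta20 : 0 < eta / 2 by rewrite divr_gt0.
have [_ [e1 [r1 [e10 e1C r10 ->]]] hJ] := sup_adherent eta20 supE.
set S := sup E in hJ.
have JS e r : 0 < e -> e <= C -> 0 <= r -> J e r <= S.
  by move=> e0 eC r0; apply: (sup_upper_bound supE); exists e, r.
have w0 x : 0 < 1 + x ^+ 2 by rewrite ltr_pwDl// sqr_ge0.
have S0 : 0 <= S.
  apply: le_trans (JS C 0 C0 (lexx _) (lexx _)); apply: Rintegral_ge0 => x _.
  by rewrite divr_ge0 ?ld0// ltW.
have ld_anti e e' x : 0 < e' -> e' <= e -> logdef C H e x <= logdef C H e' x.
  move=> e'0 e'e; rewrite lerD2l lerN2 ler_ln ?posrE ?lt_max ?e'0 ?(lt_le_trans e'0 e'e) ?orbT//.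
  by rewrite ge_max !le_max lexx e'e orbT.
(* Beyond the second bound [r >= 1] and [S (1 + r1^2) <= eta r^2 / 2]. *)
pose N := Num.max r1 (1 + 2 * S * (1 + r1 ^+ 2) / eta).
exists N => e r e0 eC; rewrite ge_max => /andP[rr1 rN].
have r1' : 1 <= r.
  apply: le_trans rN; rewrite lerDl divr_ge0 ?(ltW eta0)// mulr_ge0 ?(ltW (w0 _))//.
  by rewrite mulr_ge0.
have r_ge0 : 0 <= r by lra.
(* Lowering the truncation level only raises the deficit, so [e] and [e1] may both be replaced by
   their minimum. *)
pose e' := Num.min e e1.
have e'0 : 0 < e' by rewrite lt_min e0.
have e'C : e' <= C by rewrite ge_min eC.
have il a b f : continuous f -> mu.-integrable `[a, b] (fun x => (f x)%:E) by exact: continuous_integrable_itv.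
apply: (@le_trans _ _ (Rintegral mu `[- r, r] (logdef C H e'))).
  apply: le_Rintegral; [exact: measurable_itv|exact/il/ldc|exact/il/ldc|].
  by move=> x _; apply: ld_anti => //; rewrite ge_min lexx.
pose g x := (1 + r ^+ 2) * (logdef C H e' x / (1 + x ^+ 2)) - logdef C H e' x.
have gE x : g x = (r ^+ 2 - x ^+ 2) * (logdef C H e' x / (1 + x ^+ 2)).
  by rewrite /g; have := lt0r_neq0 (w0 x) => h; field.
have gc : continuous g.
  move=> x; apply: cvgB; last exact: ldc.
  by apply: cvgM; [exact: cvg_cst|exact: ldw].
have gI : Rintegral mu `[- r, r] g = (1 + r ^+ 2) * J e' r - Rintegral mu `[- r, r] (logdef C H e').
  rewrite RintegralB//; [rewrite RintegralZl//|apply: il => x; apply: cvgM|].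
  - by apply: il; exact: ldw.
  - exact: cvg_cst.
  - exact: ldw.
  - by apply: il; exact: ldc.
have h1 : Rintegral mu `[- r1, r1] g <= Rintegral mu `[- r, r] g.
  apply: Rintegral_subset => //; [|exact: il|].
    by apply: subset_itv; rewrite bnd_simp ?lerN2.
  move=> x /=; rewrite in_itv /= => /andP[x1 x2]; rewrite gE.
  rewrite mulr_ge0 ?divr_ge0 ?ld0 ?(ltW (w0 _))// subr_ge0.
  by apply: sqr_le_abs; rewrite [leRHS]ger0_norm// ler_norml x1.
have h2 : (r ^+ 2 - r1 ^+ 2) * J e' r1 <= Rintegral mu `[- r1, r1] g.
  rewrite -RintegralZl//; last by apply: il; exact: ldw.
  apply: le_Rintegral => //; [|exact: il|].
    by apply: il => x; apply: cvgM; [exact: cvg_cst|exact: ldw].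
  move=> x /=; rewrite in_itv /= => /andP[x1 x2]; rewrite -/(g x) gE.
  rewrite ler_wpM2r ?divr_ge0 ?ld0 ?(ltW (w0 _))// lerD2l lerN2.
  by apply: sqr_le_abs; rewrite [leRHS]ger0_norm// ler_norml x1.
have h3 : J e1 r1 <= J e' r1.
  apply: le_Rintegral => //; [by apply: il; exact: ldw|by apply: il; exact: ldw|].
  move=> x _; rewrite ler_wpM2r ?invr_ge0 ?(ltW (w0 _))//.
  by apply: ld_anti => //; rewrite ge_min lexx orbT.
have h4 := JS e' r e'0 e'C (le_trans ler01 r1').
apply: (little_o_arith eta0 S0 r10 rr1 rN (le_trans (ltW hJ) h3) h4).
by rewrite -gI; exact: le_trans h2 h1.
Qed.

End nonvanishing.

(* A bounded truncation of the weight log^+ (1 / |u|) of a zero in Jensen's formula. *)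
Definition tlog (tau u : R) := - ln (Num.min 1 (Num.max `|u| tau)).

Lemma tlog_cont tau : 0 < tau -> continuous (tlog tau).
Proof.
move=> t0 x; apply: cvgN; apply: continuous_cvg.
  by apply: continuous_ln; rewrite lt_min ltr01 lt_max t0 orbT.
apply/cvgrPdist_le => e e0.
have : (fun t : R => `|t|) @ x --> `|x| by apply: cvg_norm; exact: cvg_id.
move=> /cvgrPdist_le /(_ _ e0).
apply: filterS => t; apply: le_trans.
have dm (a b : R) : `|Num.min 1 a - Num.min 1 b| <= `|a - b|.
  have -> : Num.min 1 a = - Num.max (- a) (- 1) by rewrite oppr_max !opprK minC.
  have -> : Num.min 1 b = - Num.max (- b) (- 1) by rewrite oppr_max !opprK minC.
  rewrite -opprD normrN; apply: le_trans (dist_maxr_le _ _ _) _.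
  by rewrite -opprD normrN.
exact: le_trans (dm _ _) (dist_maxr_le _ _ _).
Qed.

Lemma tlog_ge0 tau u : 0 < tau -> 0 <= tlog tau u.
Proof.
by move=> t0; rewrite oppr_ge0 -ln1 ler_ln ?posrE ?ge_min ?lexx// lt_min ltr01 lt_max t0 orbT.
Qed.

Lemma tlog_le tau u : 0 < tau -> tau <= 1 -> tlog tau u <= - ln tau.
Proof.
move=> t0 t1; rewrite lerN2 ler_ln ?posrE//; last by rewrite lt_min ltr01 lt_max t0 orbT.
by rewrite le_min t1 le_max lexx orbT.
Qed.

Lemma tlog_out tau u : 1 <= `|u| -> tlog tau u = 0.
Proof. by move=> u1; rewrite /tlog min_l ?ln1 ?oppr0// le_max u1. Qed.

Lemma expR_tlog_le tau u : 0 < tau -> 0 < `|u| < 1 -> expR (tlog tau u) <= `|u|^-1.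
Proof.
move=> t0 /andP[u0 u1]; rewrite expRN lnK ?posrE ?lt_min ?ltr01 ?lt_max ?t0 ?orbT//.
rewrite lef_pV2 ?posrE//; last by rewrite lt_min ltr01 lt_max t0 orbT.
by rewrite le_min (ltW u1) le_max lexx.
Qed.

Lemma tlog_shift_cont tau a r : 0 < tau -> continuous (fun x => tlog tau ((x - a) / r)).
Proof.
move=> t0 x; apply: (continuous_comp (f := fun x => (x - a) / r) (g := tlog tau)).
  by apply: cvgM; [apply: cvgB; [exact: cvg_id|exact: cvg_cst]|exact: cvg_cst].
exact: tlog_cont.
Qed.

(** The integral of [ln (r / |x - a|)] over [[a - r, a + r]] is [2 r], and truncation at [tau] costs
    [2 r tau]. *)
Lemma Rintegral_tlog tau a r : 0 < tau -> tau < 1 -> 0 < r ->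
  Rintegral mu `[(a - r), (a + r)] (fun x => tlog tau ((x - a) / r)) = 2 * r * (1 - tau).
Proof.
move=> t0 t1 r0; pose f x := tlog tau ((x - a) / r).
have fc : continuous f by exact: tlog_shift_cont.
have if_ b c : mu.-integrable `[b, c] (fun x => (f x)%:E) by exact: continuous_integrable_itv.
(* The parameter [s] is the sign of [x - a], so one primitive serves both sides of the truncated
   middle. *)
have side (s : R) b c : b <= c -> s ^+ 2 = 1 -> (forall x, b <= x <= c -> tau * r <= s * (x - a) <= r) ->
    Rintegral mu `[b, c] f = ((c - a) - (c - a) * ln (s * (c - a) / r)) - ((b - a) - (b - a) * ln (s * (b - a) / r)).
  move=> bc s2 hs.
  have s0 : s != 0 by apply/eqP => h; move: s2; rewrite h expr0n /= => /esym/eqP; rewrite oner_eq0.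
  pose F x := (x - a) - (x - a) * ln (s * (x - a) / r).
  apply: (@Rintegral_FTC _ f F b c bc); first exact: continuous_subspaceT.
  move=> x /hs /andP[h1 h2].
  have sx : 0 < s * (x - a) by apply: lt_le_trans h1; rewrite mulr_gt0.
  have xa : x - a != 0 by apply/eqP => h; move: sx; rewrite h mulr0 ltxx.
  have d1 : is_derive x 1 (fun x : R => x - a) 1.
    have := is_deriveD (is_derive_id x 1) (is_derive_cst (- a) x 1).
    by rewrite addr0.
  have d2 : is_derive x 1 (fun x : R => s * (x - a) / r) (s / r).
    have -> : (fun x : R => s * (x - a) / r) = (fun u => (s / r) * u) \o (fun x => x - a).
      by apply/funext => u /=; ring.
    have := @is_derive1_comp _ (fun u => (s / r) * u) (fun x => x - a) x _ _ (is_derive_mull (s / r) _) d1.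
    by rewrite mulr1.
  have u0 : 0 < s * (x - a) / r by rewrite divr_gt0.
  have d3 := @is_derive1_comp _ (@ln R) (fun x : R => s * (x - a) / r) x _ _ (is_derive1_ln u0) d2.
  have d4 := is_deriveM d1 d3.
  have d5 := is_deriveB d1 d4.
  rewrite (_ : f x = 1 - ((x - a) *: ((s * (x - a) / r)^-1 * (s / r)) + ln (s * (x - a) / r) *: 1)).
    exact: d5.
  rewrite /GRing.scale /= mulr1.
  have -> : (x - a) * ((s * (x - a) / r)^-1 * (s / r)) = 1.
    by field; rewrite s0 xa lt0r_neq0.
  rewrite opprD addrA subrr sub0r /f /tlog; congr (- ln _).
  have ab : `|(x - a) / r| = s * (x - a) / r.
    rewrite -(ger0_norm (ltW u0)) !normrM; congr (_ * _).
    have -> : `|s| = 1 by apply/eqP; rewrite -(@pexpr_eq1 _ _ 2)// -normrX s2 normr1.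
    by rewrite mul1r.
  rewrite ab max_l ?min_r//; first by rewrite ler_pdivrMr// mul1r.
  by rewrite ler_pdivlMr.
have tr : tau * r < r by rewrite gtr_pMl.
have tr0 : 0 < tau * r by rewrite mulr_gt0.
have := @Rintegral_itvB _ f (BLeft (a - r)) (BRight (a + r)) (a + tau * r) (if_ _ _).
rewrite !bnd_simp => /(_ ltac:(lra) ltac:(lra)) /eqP; rewrite subr_eq => /eqP ->.
have := @Rintegral_itvB _ f (BLeft (a - r)) (BRight (a + tau * r)) (a - tau * r) (if_ _ _).
rewrite !bnd_simp => /(_ ltac:(lra) ltac:(lra)) /eqP; rewrite subr_eq => /eqP ->.
have ifo b c : mu.-integrable `]b, c] (fun x => (f x)%:E).
  by apply: integrableS (if_ b c) => //; exact: subset_itv_oc_cc.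
rewrite !Rintegral_itv_obnd_cbnd//.
have -> : Rintegral mu `[a - tau * r, a + tau * r] f = 2 * (tau * r) * - ln tau.
  rewrite (@eq_Rintegral _ _ _ mu _ (fun=> - ln tau)).
    rewrite Rintegral_cst//= lebesgue_measure_itv /= lte_fin ifT; last by lra.
    by rewrite /= mulrC; congr (_ * _); ring.
  move=> x; rewrite inE /= in_itv /= => /andP[x1 x2]; rewrite /f /tlog; congr (- ln _).
  rewrite max_r ?min_r ?(ltW t1)// normrM normfV (gtr0_norm r0) ler_pdivrMr//.
  by rewrite ler_norml; lra.
rewrite (@side 1 (a + tau * r) (a + r)) ?expr1n//; [|lra|by move=> x; lra].
rewrite (@side (- 1) (a - r) (a - tau * r)) ?sqrrN ?expr1n//; [|lra|by move=> x; lra].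
have -> : 1 * (a + r - a) / r = 1 by field; exact: lt0r_neq0.
have -> : 1 * (a + tau * r - a) / r = tau by field; exact: lt0r_neq0.
have -> : - 1 * (a - tau * r - a) / r = tau by field; exact: lt0r_neq0.
have -> : - 1 * (a - r - a) / r = 1 by field; exact: lt0r_neq0.
by rewrite ln1; ring.
Qed.

Lemma Rintegral_sum_ge n (F : nat -> R -> R) (D : set R) c : measurable D ->
  (forall k, (k < n)%N -> mu.-integrable D (fun x => (F k x)%:E)) ->
  (forall k, (k < n)%N -> c <= Rintegral mu D (F k)) ->
  mu.-integrable D (fun x => (\sum_(k < n) F k x)%:E) /\
  n%:R * c <= Rintegral mu D (fun x => \sum_(k < n) F k x).
Proof.
move=> mD; elim: n => [_ _|n IH hF hc].
  split; first by under eq_fun do rewrite big_ord0; exact: integrable0.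
  by rewrite mul0r; apply: Rintegral_ge0 => x _; rewrite big_ord0.
have [i1 h1] := IH (fun k kn => hF k (ltnW kn)) (fun k kn => hc k (ltnW kn)).
split; first by under eq_fun do rewrite big_ord_recr /= EFinD; exact: integrableD (hF n _).
have -> : Rintegral mu D (fun x => \sum_(k < n.+1) F k x) = Rintegral mu D (fun x => \sum_(k < n) F k x + F n x).
  by apply: eq_Rintegral => x _; rewrite big_ord_recr.
by rewrite RintegralD ?hF// -natr1 mulrDl mul1r lerD// hc.
Qed.

(* Jensen's formula on the disks of radius delta * r centred at the points of
   [- delta * r, r + delta * r], averaged over the centre: each zero in [0, r]
   is counted with weight 2 * delta * r, and the sparse set where |H| is small
   costs only o(r ^ 2). *)
Lemma PW_density A H D (om : nat -> R) : PW A H -> 0 < A -> 2 * A < D ->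
  (forall n, (1 <= n)%N -> 0 < om n) ->
  (forall m n, (1 <= m)%N -> (m < n)%N -> om m < om n) ->
  (forall n, (1 <= n)%N -> H (om n)%:C = 0) ->
  (forall N : nat, exists2 n, (N <= n)%N & om n * D < n%:R) ->
  forall x, H x%:C = 0.
Proof.
move=> [eH [C C0 HC]] A0 AD om0 om_mono Hom dens x0.
apply/eqP/negPn/negP => Hx0.
have D0 : 0 < D by lra.
(* The excess [k] pays for three losses of at most [k / 4] each, relative to [2 d r^2]: the
   truncation of the weights ([tau]), the overhang of the interval of centres ([d]), and the centres
   where [H] is small ([eta]). *)
pose k := D - 2 * A; have k0 : 0 < k by rewrite subr_gt0.
pose tau := Num.min (1 / 2) (k / (4 * D)).
have t0 : 0 < tau by rewrite lt_min !divr_gt0// mulr_gt0.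
have t1 : tau < 1 by rewrite gt_min; apply/orP; left; lra.
have tD : tau * D <= k / 4.
  have : tau <= k / (4 * D) by rewrite ge_min lexx orbT.
  rewrite ler_pdivlMr; [|by rewrite mulr_gt0]; lra.
pose d := Num.min 1 (k / (16 * A)).
have d0 : 0 < d by rewrite lt_min ltr01 divr_gt0// mulr_gt0.
have d1 : d <= 1 by rewrite ge_min lexx.
have dA : 4 * A * d <= k / 4.
  have : d <= k / (16 * A) by rewrite ge_min lexx orbT.
  rewrite ler_pdivlMr; [|by rewrite mulr_gt0]; lra.
pose eta := d * k / 8; have eta0 : 0 < eta by rewrite divr_gt0// mulr_gt0.
have [N hN] := log_little_o (ltW A0) C0 eH HC Hx0 eta0.
(* This size of [n] makes [r = n / D] at least [|N|], and [om n < r] places the [n] zeros [om 1],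
   ..., [om n] in []0, r]]. *)
have [n nN omn] := dens (Num.truncn (D * `|N|)).+1.
have n1 : (1 <= n)%N by apply: leq_trans nN.
pose r := n%:R / D.
have nr : n%:R = r * D by rewrite /r divfK// lt0r_neq0.
have r0 : 0 < r by rewrite divr_gt0// ltr0n.
have Nr : `|N| <= r.
  rewrite /r ler_pdivlMr// mulrC; apply: le_trans (ltW (truncnS_gt _)) _.
  by rewrite ler_nat.
have omr j : (j < n)%N -> 0 < om j.+1 <= r.
  move=> jn; rewrite om0//=; apply: (@le_trans _ _ (om n)).
    by move: jn; rewrite leq_eqVlt => /predU1P[->//|jn]; rewrite ltW// om_mono.
  by rewrite /r ler_pdivlMr// ltW.
pose rho := d * r; have rho0 : 0 < rho by rewrite mulr_gt0.
have rhor : rho <= r by rewrite /rho ger_pMl.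
have N2r : N <= 2 * r.
  by rewrite (le_trans (ler_norm N))// (le_trans Nr)// mulr_natl mulr2n lerDl ltW.
have sub2r : `[(- rho), (r + rho)]%classic `<=` `[(- (2 * r)), (2 * r)]%classic.
  apply: subset_itv; rewrite bnd_simp.
    by rewrite lerN2 mulr_natl mulr2n (le_trans rhor)// lerDl ltW.
  by rewrite mulr_natl mulr2n lerD2l.
(* Where [|H|] is below this level the deficit is [- n ln tau], the largest value that [n] truncated
   weights can add up to, so the pointwise bound holds there without Jensen's inequality. *)
pose e := C * expR (n%:R * ln tau).
have lt0 : ln tau <= 0 by rewrite -ln1 ler_ln ?posrE// ltW.
have e0 : 0 < e by rewrite mulr_gt0// expR_gt0.
have eC : e <= C by rewrite ger_pMr// -expR0 ler_expR; rewrite mulr_ge0_le0.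
pose G j x := tlog tau ((x - om j.+1) / rho).
have pointwise x : \sum_(j < n) G j x <= 4 * A * rho + logdef C H e x.
  have [He|He] := ltP (normc (H x%:C)) e.
    have -> : logdef C H e x = - (n%:R * ln tau).
      rewrite /logdef max_r ?(ltW He)// lnM ?posrE ?expR_gt0// expRK; ring.
    apply: (@le_trans _ _ (\sum_(j < n) - ln tau)).
      by apply: ler_sum => j _; apply: tlog_le => //; exact: ltW.
    rewrite sumr_const card_ord -[X in X <= _]mulr_natl mulrN lerDr.
    by apply: mulr_ge0; [apply: mulr_ge0 => //; exact: ltW|exact: ltW].
  have Hpos : 0 < normc (H x%:C) by apply: lt_le_trans He.
  rewrite /logdef max_l//.
  pose s := [seq om j.+1 | j <- iota 0 n & `|om j.+1 - x| < rho].
  have us : uniq s.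
    rewrite map_inj_uniq ?filter_uniq ?iota_uniq// => i j /eqP; apply: contraTeq => ij.
    have [h|h|h] := ltngtP i j; last by rewrite h eqxx in ij.
      by rewrite lt_eqF// om_mono.
    by rewrite gt_eqF// om_mono.
  have hs a : a \in s -> [/\ a != x, `|a - x| < rho & H a%:C = 0].
    move=> /mapP[j]; rewrite mem_filter => /andP[h _] ->; split => //; last exact: Hom.
    by apply: contraTneq Hpos => <-; rewrite Hom// normc0 ltxx.
  have hJ := PW_jensen (ltW A0) C0 rho0 eH HC us hs.
  have hsum : \sum_(j < n) G j x = \sum_(a <- s) tlog tau ((x - a) / rho).
    rewrite big_map big_filter -(big_mkord xpredT (fun j => G j x)) /index_iota subn0.
    rewrite [RHS]big_mkcond /=; apply: eq_bigr => j _; case: ifPn => //.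
    rewrite -leNgt => h; rewrite /G tlog_out// normrM normfV (gtr0_norm rho0).
    by rewrite ler_pdivlMr// mul1r distrC.
  rewrite hsum addrA -ler_expR [in leRHS]expRD expRD lnK// expRN lnK//.
  rewrite ler_pdivlMr// mulrC [expR (4 * _ * _) * _]mulrC; apply: le_trans hJ.
  rewrite ler_wpM2l ?normc_ge0// expR_sum.
  rewrite big_seq [leRHS]big_seq; apply: ler_prod => a /hs[ax ar _]; rewrite expR_ge0 /=.
  have -> : rho / `|a - x| = `|(x - a) / rho|^-1.
    by rewrite normrM normfV invfM invrK (gtr0_norm rho0) mulrC distrC.
  apply: expR_tlog_le => //; rewrite normrM normfV (gtr0_norm rho0) divr_gt0//=.
    by rewrite ltr_pdivrMr// mul1r distrC.
  by rewrite normr_gt0 subr_eq0 eq_sym.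
have Gc j : continuous (G j) by exact: tlog_shift_cont.
have := @Rintegral_sum_ge n G `[(- rho), (r + rho)] (2 * rho * (1 - tau)) (measurable_itv _).
case.
- by move=> j jn; exact: continuous_integrable_itv.
- move=> j /omr /andP[a1 a2]; rewrite -(Rintegral_tlog (om j.+1) t0 t1 rho0).
  apply: Rintegral_subset => //.
  + by apply: subset_itv; rewrite bnd_simp; lra.
  + exact: (continuous_integrable_itv _ _ (Gc j)).
  + by move=> x _; exact: tlog_ge0.
move=> iS hS.
have cld : continuous (logdef C H e) by exact: logdef_cont.
have h1 : Rintegral mu `[- rho, r + rho] (fun x => \sum_(j < n) G j x) <=
    4 * A * rho * (r + 2 * rho) + Rintegral mu `[- rho, r + rho] (logdef C H e).
  have -> : 4 * A * rho * (r + 2 * rho) = Rintegral mu `[- rho, r + rho] (fun=> 4 * A * rho).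
    rewrite Rintegral_cst//= lebesgue_measure_itv /= lte_fin ifT; last by lra.
    by rewrite /=; congr (_ * _); ring.
  rewrite -RintegralD//; [|by apply: continuous_integrable_itv => x; exact: cvg_cst|exact: continuous_integrable_itv].
  apply: le_Rintegral => //.
  by apply: continuous_integrable_itv => x; apply: cvgD; [exact: cvg_cst|exact: cld].
have h2 : Rintegral mu `[- rho, r + rho] (logdef C H e) <= Rintegral mu `[- (2 * r), 2 * r] (logdef C H e).
  apply: Rintegral_subset => //.
  + exact: continuous_integrable_itv.
  + by move=> x _; exact: (logdef_ge0 C0 HC).
have h3 := hN e (2 * r) e0 eC N2r.
have := le_trans hS (le_trans h1 (lerD (lexx _) (le_trans h2 h3))).
rewrite nr /rho /eta.
have -> : r * D * (2 * (d * r) * (1 - tau)) = (2 * d * r ^+ 2) * (D - tau * D) by ring.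
have -> : 4 * A * (d * r) * (r + 2 * (d * r)) + d * k / 8 * (2 * r) ^+ 2 =
   (2 * d * r ^+ 2) * (2 * A + 4 * A * d + k / 4) by field.
rewrite ler_pM2l; last by rewrite mulr_gt0 ?exprn_gt0// mulr_gt0.
have kE : D = k + 2 * A by rewrite /k subrK.
by move=> hfin; clear - tD dA k0 hfin kE; lra.
Qed.

End real_zeros.

(** * Fourier coefficients of integrable functions *)

Section trig_closure.
Context {R : realType}.
Notation mu := (@lebesgue_measure R).
Implicit Types (x y t r e : R) (z w : R[i]).
Variable (L : R).
Hypothesis L0 : 0 < L.

(* The functions on ]-L/2, L/2[ generated from the L-periodic exponentials by
   linear combinations and bounded pointwise limits. Values outside of this
   interval are irrelevant. *)
Inductive trig_closure : (R -> R[i]) -> Prop :=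
| tc_exp (k : int) : trig_closure (fun x => cis (k%:~R * (x / L)))
| tc_add u v : trig_closure u -> trig_closure v -> trig_closure (fun x => u x + v x)
| tc_scale u (c : R[i]) : trig_closure u -> trig_closure (fun x => u x * c)
| tc_lim (u_ : nat -> R -> R[i]) u (M : R) : (forall n, trig_closure (u_ n)) ->
    (forall n x, `|x| < L / 2 -> normc (u_ n x) <= M) ->
    (forall x, `|x| < L / 2 -> ccvg (u_ ^~ x) (u x)) -> trig_closure u.

Lemma tc_bounded u : trig_closure u ->
  exists2 M, 0 <= M & forall x, `|x| < L / 2 -> normc (u x) <= M.
Proof.
elim=> {u} [k|u v _ [M M0 hM] _ [N N0 hN]|u c _ [M M0 hM]|u_ u M _ _ hM hu].
- by exists 1 => // x _; rewrite normc_cis.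
- exists (M + N) => [|x hx]; first by rewrite addr_ge0.
  by apply: le_trans (le_normcD _ _) _; rewrite lerD ?hM ?hN.
- exists (M * normc c) => [|x hx]; first by rewrite mulr_ge0 ?normc_ge0.
  by rewrite normcM ler_wpM2r ?normc_ge0 ?hM.
- have M0 : 0 <= M.
    apply: le_trans (normc_ge0 (u_ 0%N 0)) (hM 0%N 0 _).
    by rewrite normr0 divr_gt0.
  exists M => // x hx; rewrite -[leRHS]addr0 -(cvg_lim _ (hu x hx))//.
  apply/ler_addgt0Pr => e e0.
  have /cvgrPdist_le /(_ _ e0) [n _ /(_ n (leqnn n))] := hu x hx.
  rewrite sub0r normrN ger0_norm ?normc_ge0// => h.
  have h0 : lim ((fun n => normc (u_ n x - u x)) @ \oo) = 0 by apply: cvg_lim => //; exact: hu.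
  rewrite h0 addr0 -(subKr (u_ n x) (u x)).
  apply: le_trans (ler_normcB _ _) _; rewrite lerD//; exact: hM.
Qed.

(** A constant sequence lets the limit rule absorb any change outside of the interval. *)
Lemma tc_ext u v : (forall x, `|x| < L / 2 -> u x = v x) -> trig_closure u -> trig_closure v.
Proof.
move=> uv tu; have [M M0 hM] := tc_bounded tu.
apply: (@tc_lim (fun _ => u) v M) => // x hx; rewrite -uv//; exact: ccvg_cst.
Qed.

Lemma tc_mul u v : trig_closure u -> trig_closure v -> trig_closure (fun x => u x * v x).
Proof.
move=> tu tv; have [N N0 hN] := tc_bounded tv.
elim: tu => {u} [k|u w _ IHu _ IHw|u c _ IH|u_ u M tu IH hM hu].
- elim: tv => {v N N0 hN} [j|u w _ IHu _ IHw|u c _ IH|u_ u M tu IH hM hu].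
  + apply: tc_ext (tc_exp (k + j)) => x _.
    by rewrite -cisD -mulrDl -intrD.
  + by apply: tc_ext (tc_add IHu IHw) => x _; rewrite mulrDr.
  + by apply: tc_ext (tc_scale c IH) => x _; rewrite mulrA.
  + apply: (tc_lim IH (M := M)) => [n x hx|x hx].
      by rewrite normcM normc_cis mul1r hM.
    by apply: ccvgM; [exact: ccvg_cst|exact: hu].
- by apply: tc_ext (tc_add IHu IHw) => x _; rewrite mulrDl.
- by apply: tc_ext (tc_scale c IH) => x _; rewrite mulrAC.
- apply: (tc_lim IH (M := M * N)) => [n x hx|x hx].
    by rewrite normcM ler_pM ?normc_ge0 ?hM ?hN.
  by apply: ccvgM; [exact: hu|exact: ccvg_cst].
Qed.

Lemma tc_cst c : trig_closure (fun=> c).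
Proof. by apply: tc_ext (tc_scale c (tc_exp 0)) => x _; rewrite mul0r cis0 mul1r. Qed.

Lemma tc_sub u v : trig_closure u -> trig_closure v -> trig_closure (fun x => u x - v x).
Proof.
move=> tu tv; apply: tc_ext (tc_add tu (tc_scale (-1) tv)) => x _.
by rewrite mulrN1.
Qed.

(** The iteration [q := q + (y - q^2) / 2], familiar from the Stone-Weierstrass theorem, increases
    to [sqrt y] by ring operations alone; each step contracts the error at least by the factor
    [1 - sqrt y / 2]. *)
Lemma tc_sqrt (y : R -> R) : trig_closure (fun x => (y x)%:C) ->
  (forall x, `|x| < L / 2 -> 0 <= y x <= 1) -> trig_closure (fun x => (Num.sqrt (y x))%:C).
Proof.
move=> ty y01; pose q := fix q n x : R := if n is m.+1 then q m x + (y x - q m x ^+ 2) / 2 else 0.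
have tq n : trig_closure (fun x => (q n x)%:C).
  elim: n => [|n IH]; first by apply: tc_ext (tc_cst 0) => x _.
  apply: tc_ext (tc_add IH (tc_scale (2^-1)%:C (tc_sub ty (tc_mul IH IH)))) => x _ /=.
  by rewrite -rmorphM -rmorphB -rmorphM -rmorphD.
have key x n : `|x| < L / 2 -> 0 <= q n x <= Num.sqrt (y x) /\
   Num.sqrt (y x) - q n x <= (1 - Num.sqrt (y x) / 2) ^+ n * Num.sqrt (y x).
  move=> /y01/andP[y0 y1]; set s := Num.sqrt (y x).
  have s0 : 0 <= s by exact: sqrtr_ge0.
  have s1 : s <= 1 by rewrite -sqrtr1; exact: ler_wsqrtr.
  have ss : y x = s ^+ 2 by rewrite sqr_sqrtr.
  elim: n => [|n [/andP[q0 qs] IH]] /=; first by rewrite lexx s0 expr0 mul1r subr0.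
  set p := q n x in q0 qs IH *; rewrite ss.
  have e1 : s - (p + (s ^+ 2 - p ^+ 2) / 2) = (s - p) * (1 - (s + p) / 2) by field.
  have h1 : 0 <= (s - p) * (1 - (s + p) / 2) by apply: mulr_ge0; lra.
  have h2 : (s - p) * (1 - (s + p) / 2) <= (1 - s / 2) * (s - p).
    by rewrite mulrC ler_wpM2r; lra.
  have h3 : (1 - s / 2) * (s - p) <= (1 - s / 2) * ((1 - s / 2) ^+ n * s).
    by rewrite ler_wpM2l; lra.
  split; last by rewrite e1 exprS -mulrA; exact: le_trans h2 h3.
  apply/andP; split; last by rewrite -subr_ge0 e1.
  rewrite addr_ge0// divr_ge0// subr_ge0 ler_pXn2r ?nnegrE//.
apply: (tc_lim tq (M := 1)) => [n x hx|x hx].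
  have [/andP[q0 qs] _] := key x n hx; rewrite normc_real ger0_norm//.
  apply: le_trans qs _; rewrite -sqrtr1; apply: ler_wsqrtr.
  by have /andP[] := y01 x hx.
apply: ccvg_real; set s := Num.sqrt (y x).
have /andP[y0 y1] := y01 x hx.
have s0 : 0 <= s by exact: sqrtr_ge0.
have s1 : s <= 1 by rewrite -sqrtr1; exact: ler_wsqrtr.
have h : (fun n => (1 - s / 2) ^+ n * s) @ \oo --> (0 : R).
  have [->|sn0] := eqVneq s 0; first by under eq_fun do rewrite mulr0; exact: cvg_cst.
  rewrite -(mul0r s); apply: cvgM; last exact: cvg_cst.
  have sp : 0 < s by rewrite lt0r sn0.
  by apply: cvg_expr; rewrite ger0_norm; lra.
apply/cvgrPdist_le => e e0; move/cvgrPdist_le : h => /(_ _ e0); apply: filterS => n.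
rewrite sub0r normrN; have [/andP[q0 qs] hq] := key x n hx.
rewrite -/s in qs hq; rewrite (ger0_norm (x := s - _)) ?subr_ge0// => h.
exact: le_trans hq (le_trans (ler_norm _) h).
Qed.

(** The positive part [p] comes from [|y| = sqrt (y^2)]; its iterated square roots tend to [1] where
    [p > 0] and stay [0] elsewhere. *)
Lemma tc_indic_pos (y : R -> R) : trig_closure (fun x => (y x)%:C) ->
  (forall x, `|x| < L / 2 -> `|y x| <= 1) ->
  trig_closure (fun x => (if 0 < y x then 1 else 0 : R)%:C).
Proof.
move=> ty y1; pose p x := (Num.sqrt (y x ^+ 2) + y x) * 2^-1.
have pE x : p x = if 0 < y x then y x else 0.
  rewrite /p sqrtr_sqr; case: ltP => h; first by rewrite gtr0_norm//; lra.
  by rewrite ler0_norm//; lra.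
have tp : trig_closure (fun x => (p x)%:C).
  have ty2 : trig_closure (fun x => (y x ^+ 2)%:C).
    by apply: tc_ext (tc_mul ty ty) => x _; rewrite -rmorphM.
  have h : forall x, `|x| < L / 2 -> 0 <= y x ^+ 2 <= 1.
    move=> x /y1 h; rewrite sqr_ge0 -(expr1n _ 2) /=.
    by rewrite -(real_normK (num_real (y x))) ler_pXn2r ?nnegrE.
  apply: tc_ext (tc_scale (2^-1)%:C (tc_add (tc_sqrt ty2 h) ty)) => x _.
  by rewrite -rmorphD -rmorphM.
have p01 x : `|x| < L / 2 -> 0 <= p x <= 1.
  move=> /y1; rewrite ler_norml => /andP[h1 h2]; rewrite pE; case: ltP => h; lra.
pose s n x := iter n (@Num.sqrt R) (p x).
have s01 n x : `|x| < L / 2 -> 0 <= s n x <= 1.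
  move=> hx; elim: n => [|n /andP[IH0 IH1]]; first exact: p01.
  by rewrite /s iterS sqrtr_ge0 -sqrtr1 /= ler_wsqrtr.
have ts n : trig_closure (fun x => (s n x)%:C).
  elim: n => [|n IH]; first exact: tp.
  exact: (tc_sqrt IH (s01 n)).
apply: (tc_lim ts (M := 1)) => [n x hx|x hx].
  by have /andP[h1 h2] := s01 n x hx; rewrite normc_real ger0_norm.
apply: ccvg_real; case: ltP => yx; last first.
  have sn0 n : s n x = 0.
    elim: n => [|n]; first by rewrite /s /= pE ltNge yx.
    by rewrite /s iterS => ->; rewrite sqrtr0.
  by under eq_fun do rewrite sn0; exact: cvg_cst.
have px : 0 < p x by rewrite pE yx.
(* With [s n = (s n.+1)^2] one has [1 - s n.+1 = (1 - s n) / (1 + s n.+1)], and [s n.+1 >= p]. *)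
have key n : p x <= s n x /\ 1 - s n x <= (1 + p x)^-1 ^+ n.
  elim: n => [|n [IH1 IH2]]; first by rewrite lexx expr0 /s /= gerBl ltW.
  have /andP[u0 u1] := s01 n x hx; have /andP[v0 v1] := s01 n.+1 x hx.
  have sE : s n x = s n.+1 x ^+ 2 by rewrite /s iterS sqr_sqrtr.
  set u := s n x in IH1 IH2 u0 u1 sE *; set v := s n.+1 x in v0 v1 sE *.
  have uv : u <= v by rewrite sE expr2; nra.
  split; first exact: le_trans IH1 uv.
  have d0 : 0 < 1 + p x by lra.
  rewrite exprS mulrC ler_pdivlMr//; apply: le_trans IH2.
  by rewrite sE; nra.
have h : (fun n => (1 + p x)^-1 ^+ n) @ \oo --> (0 : R).
  apply: cvg_expr; have d0 : 0 < 1 + p x by lra.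
  by rewrite ger0_norm ?invr_ge0 ?(ltW d0)// invf_lt1//; lra.
apply/cvgrPdist_le => e e0; move/cvgrPdist_le : h => /(_ _ e0); apply: filterS => n.
rewrite sub0r normrN; have [_ hk] := key n; have /andP[u0 u1] := s01 n x hx.
rewrite (ger0_norm (x := 1 - _)) ?subr_ge0// => h.
exact: le_trans hk (le_trans (ler_norm _) h).
Qed.

Let pi0 := @pi_gt0 R.

Lemma tc_cos0 : trig_closure (fun x => (cos (2 * pi * (x / L)))%:C).
Proof.
apply: tc_ext (tc_scale (2^-1)%:C (tc_add (tc_exp 1) (tc_exp (-1)))) => x _.
rewrite mulrNz mul1r mulNr mul1r cisN /cis.
by apply: complex_ext => /=; field.
Qed.

Lemma tc_sin0 : trig_closure (fun x => (sin (2 * pi * (x / L)))%:C).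
Proof.
apply: tc_ext (tc_scale (0 -i* 2^-1) (tc_sub (tc_exp 1) (tc_exp (-1)))) => x _.
rewrite mulrNz mul1r mulNr mul1r cisN /cis.
by apply: complex_ext => /=; field.
Qed.

Let ang x : `|x| < L / 2 -> `|x / L| < 2^-1.
Proof.
move=> h; rewrite normrM normfV (gtr0_norm L0) ltr_pdivrMr//; lra.
Qed.

Lemma cos_ge0_half x : `|x| < 2^-1 -> 0 <= cos (pi * x).
Proof.
rewrite ltr_norml => /andP[h1 h2]; apply: cos_ge0_pihalf.
have hx1 : 0 <= pi * (x + 2^-1) by rewrite mulr_ge0 ?(ltW pi0)//; lra.
have hx2 : 0 <= pi * (2^-1 - x) by rewrite mulr_ge0 ?(ltW pi0)//; lra.
by move: hx1 hx2; rewrite mulrDr mulrBr; lra.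
Qed.

(** The half-angle formula reaches fractions of the base frequency; the positive root is the right
    one, since the cosine of the halved angle is nonnegative on the interval. *)
Lemma tc_cos j : trig_closure (fun x => (cos (2 * pi * (x / L / 2 ^+ j)))%:C).
Proof.
elim: j => [|j IH]; first by apply: tc_ext tc_cos0 => x _; rewrite expr0 divr1.
pose y x := (1 + cos (2 * pi * (x / L / 2 ^+ j))) * 2^-1.
have ty : trig_closure (fun x => (y x)%:C).
  apply: tc_ext (tc_scale (2^-1)%:C (tc_add (tc_cst 1) IH)) => x _.
  by rewrite -(rmorph1 (real_complex R)) -rmorphD -rmorphM.
have y01 x : `|x| < L / 2 -> 0 <= y x <= 1.
  move=> _; have := cos_max (2 * pi * (x / L / 2 ^+ j)); rewrite ler_norml /y; lra.
apply: tc_ext (tc_sqrt ty y01) => x hx; congr (_%:C).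
set a := 2 * pi * (x / L / 2 ^+ j.+1).
have a2 : 2 * pi * (x / L / 2 ^+ j) = a *+ 2.
  rewrite /a -mulr_natl exprS; move: (pi : R) => q; field.
  by rewrite expf_neq0// lt0r_neq0.
have -> : y x = cos a ^+ 2 by rewrite /y a2 cos_mulr2n -mulr_natl; field.
rewrite sqrtr_sqr ger0_norm//.
have -> : a = pi * (x / L / 2 ^+ j).
  rewrite /a exprS; move: (pi : R) => q; field.
  by rewrite expf_neq0// lt0r_neq0.
apply: cos_ge0_half; apply: le_lt_trans (ang hx).
rewrite normrM ler_piMr// normfV invf_le1 ?normr_gt0 ?expf_neq0//.
by rewrite ger0_norm ?exprn_ge0// exprn_ege1// ler1n.
Qed.

(** As the frequency tends to [0], the rescaled [|sin (a j x)|] tends to [|x|], and [|sin|] is a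
    square root of [(1 - cos) / 2] at the doubled angle. *)
Lemma tc_abs : trig_closure (fun x => (`|x|)%:C).
Proof.
pose a j x := pi * (x / L / 2 ^+ j).
pose y j x := (1 - cos (2 * pi * (x / L / 2 ^+ j))) * 2^-1.
have yE j x : y j x = sin (a j x) ^+ 2.
  rewrite /y (_ : 2 * pi * _ = a j x *+ 2); last by rewrite /a -mulr_natl; ring.
  by rewrite cos_mulr2n cos2sin2 mulr2n; field.
have ty j : trig_closure (fun x => (y j x)%:C).
  apply: tc_ext (tc_scale (2^-1)%:C (tc_sub (tc_cst 1) (tc_cos j))) => x _.
  by rewrite -(rmorph1 (real_complex R)) -rmorphB -rmorphM.
have y01 j x : `|x| < L / 2 -> 0 <= y j x <= 1.
  move=> _; have := cos_max (2 * pi * (x / L / 2 ^+ j)); rewrite ler_norml /y; lra.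
pose k j : R := 2 ^+ j * L / pi.
have k0 j : 0 < k j by rewrite divr_gt0// mulr_gt0// exprn_gt0.
have ka j x : k j * `|a j x| = `|x|.
  rewrite -(gtr0_norm (k0 j)) -normrM; congr (`|_|); rewrite /k /a.
  move: (pi : R) (lt0r_neq0 pi0) => q q0; field.
  by rewrite q0 expf_neq0 ?lt0r_neq0.
apply: (tc_lim (u_ := fun j x => (Num.sqrt (y j x))%:C * (k j)%:C) (M := L / 2)).
- by move=> j; exact: (tc_scale _ (tc_sqrt (ty j) (y01 j))).
- move=> j x hx; rewrite normcM !normc_real yE sqrtr_sqr normr_id (gtr0_norm (k0 j)) mulrC.
  by apply: le_trans (ltW hx); rewrite -(ka j x) ler_pM2l// ler_norm_sin.
- move=> x hx; have -> : (fun j => (Num.sqrt (y j x))%:C * (k j)%:C) = (fun j => (Num.sqrt (y j x) * k j)%:C).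
    by apply/funext => j; rewrite -rmorphM.
  apply: ccvg_real.
  have h : (fun j => `|x| * (a 0%N x ^+ 2) * (4^-1 : R) ^+ j) @ \oo --> (0 : R).
    rewrite -(mulr0 (`|x| * a 0%N x ^+ 2)); apply: cvgM; first exact: cvg_cst.
    by apply: cvg_expr; rewrite ger0_norm ?invr_ge0//; lra.
  apply/cvgrPdist_le => e e0; move/cvgrPdist_le : h => /(_ _ e0); apply: filterS => j.
  rewrite sub0r normrN => h; apply: le_trans (le_trans (ler_norm _) h).
  rewrite yE sqrtr_sqr -(ka j x) [`|sin _| * _]mulrC -mulrBr normrM (gtr0_norm (k0 j)).
  rewrite -[leRHS]mulrA -[leRHS]mulrA ler_pM2l//.
  have aj : a j x ^+ 2 = a 0%N x ^+ 2 * 4^-1 ^+ j.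
    have -> : 4^-1 ^+ j = (2 ^+ j)^-1 ^+ 2 :> R.
      by rewrite !exprVn (_ : 4 = 2 ^+ 2 :> R) -?exprM ?(mulnC 2)//; ring.
    by rewrite /a expr0 divr1 mulrA exprMn.
  rewrite -aj; apply: (@le_trans _ _ `|a j x - sin (a j x)|).
    by rewrite -[leRHS]normr_id; exact: le_trans (ler_dist_dist _ _) (ler_norm _).
  rewrite distrC; apply: le_trans (sin_taylor1 _) _.
  by rewrite ler_wpM2l//; have := sqr_ge0 (a j x); lra.
Qed.

(** On the interval [x] has the sign of [sin (2 pi x / L)], and this sign is twice an indicator
    minus [1]; the wrong sign at [0] is multiplied by [|x| = 0]. *)
Lemma tc_id : trig_closure (fun x => x%:C).
Proof.
have h : forall x, `|x| < L / 2 -> `|sin (2 * pi * (x / L))| <= 1 by move=> x _; exact: sin_max.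
have hs := tc_indic_pos tc_sin0 h.
apply: tc_ext (tc_mul tc_abs (tc_sub (tc_scale 2 hs) (tc_cst 1))) => x hx.
have hL := ang hx.
rewrite (_ : 2 = (2%:R : R)%:C); last by rewrite rmorph_nat.
rewrite -(rmorph1 (real_complex R)) -rmorphM -rmorphB -rmorphM; congr (_%:C).
have two (u : R) : 2 * pi * u = pi * (2 * u) by ring.
have [x0|x0|<-] := ltgtP 0 x; last by rewrite normr0 mul0r.
- rewrite ifT; first by rewrite gtr0_norm//; ring.
  rewrite two; apply: sin_gt0_pi; rewrite mulr_gt0 ?mulr_gt0 ?divr_gt0 ?invr_gt0//=.
  rewrite -[ltRHS]mulr1 ltr_pM2l//; move: hL; rewrite ltr_norml; lra.
- rewrite ifF; first by rewrite ltr0_norm//; ring.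
  apply/negbTE; rewrite -leNgt -oppr_ge0 -sinN -mulrN -mulNr two; apply: sin_ge0_pi.
  have : 0 <= - x / L by rewrite divr_ge0 ?(ltW L0)//; lra.
  move: hL; rewrite ltr_norml => /andP[h1 h2] h3; apply/andP; split.
    by rewrite mulr_ge0 ?(ltW pi0)// mulr_ge0.
  rewrite -[leRHS]mulr1 ler_pM2l//; rewrite mulNr in h3 *; lra.
Qed.

Lemma tc_poly (p : {poly R[i]}) : trig_closure (fun x => p.[x%:C]).
Proof.
elim/poly_ind: p => [|p c IH].
  by apply: tc_ext (tc_cst 0) => x _; rewrite horner0.
apply: tc_ext (tc_add (tc_mul IH tc_id) (tc_cst c)) => x _.
by rewrite !hornerE.
Qed.

(** Exponentials that are not [L]-periodic are uniform limits of polynomials on the interval. *)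
Lemma tc_cexp (c : R[i]) : trig_closure (fun x => cexp (c * x%:C)).
Proof.
have L20 : 0 <= L / 2 by rewrite divr_ge0// ltW.
have eF : entire (fun z => cexp (c * z)).
  apply: (entire_comp (G := fun z => c * z)); first exact: entire_cexp.
  by apply: entireM; [exact: entire_cst|exact: entire_id].
have hp n : exists p : {poly R[i]}, forall z, cdisk (L / 2) z -> normc (cexp (c * z) - p.[z]) <= n.+1%:R^-1.
  by apply: eF; rewrite invr_gt0.
have [p_ hp_] := choice hp.
have [M M0 hM] := papprox_bounded L20 (@subset_refl _ _) (eF (L / 2)).
have dx x : `|x| < L / 2 -> cdisk (L / 2) x%:C by move=> h; rewrite /cdisk /mkset normc_real ltW.
apply: (tc_lim (u_ := fun n x => (p_ n).[x%:C]) (M := M + 1)) => [n|n x hx|x hx].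
- exact: tc_poly.
- rewrite -(subKr (cexp (c * x%:C)) (p_ n).[x%:C]).
  apply: le_trans (ler_normcB _ _) _; apply: lerD; first exact: hM (dx x hx).
  apply: le_trans (hp_ n _ (dx x hx)) _; rewrite invf_le1 ?ltr0n// ler1n//.
- rewrite /ccvg; apply: (@squeeze_cvgr _ _ _ _ (fun=> 0) (@harmonic R)).
  + apply: nearW => n; rewrite normc_ge0 andTb normc_distC; exact: hp_ (dx x hx).
  + exact: cvg_cst.
  + exact: cvg_harmonic.
Qed.

Lemma tc_indic_gt d : trig_closure (fun x => (if d < x then 1 else 0 : R)%:C).
Proof.
pose K := (L / 2 + `|d|)^-1.
have K0 : 0 < K by rewrite invr_gt0 ltr_pwDl// divr_gt0.
have ty : trig_closure (fun x => (K * (x - d))%:C).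
  apply: tc_ext (tc_scale K%:C (tc_sub tc_id (tc_cst d%:C))) => x _.
  by rewrite -rmorphB -rmorphM mulrC.
have y1 x : `|x| < L / 2 -> `|K * (x - d)| <= 1.
  move=> hx; rewrite normrM (gtr0_norm K0) mulrC ler_pdivrMr ?ltr_pwDl ?divr_gt0// mul1r.
  by apply: le_trans (ler_normB _ _) _; rewrite lerD2r ltW.
apply: tc_ext (tc_indic_pos ty y1) => x hx.
by rewrite pmulr_rgt0// subr_gt0.
Qed.

End trig_closure.

(** * Vanishing of all Fourier coefficients *)

Section fourier.
Context {R : realType}.
Notation mu := (@lebesgue_measure R).
Implicit Types (x y t r e : R) (z w : R[i]).
Variable (L : R).
Hypothesis L0 : 0 < L.

(** Orthogonality to [h] survives linear combinations and, by dominated convergence, bounded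
    pointwise limits. Measurability on [D] is carried through the same induction, as the values
    outside of [D] are arbitrary. *)
Lemma tc_pairing (c : R) (h : R -> R[i]) : let D := `]c - L / 2, c + L / 2[%classic in
  cintble D h ->
  (forall k : int, cint D (fun x => h x * cis (k%:~R * (x / L))) = 0) ->
  forall v, trig_closure L v ->
    cmeas D (fun x => v (x - c)) /\ cint D (fun x => h x * v (x - c)) = 0.
Proof.
move=> D ih h0 v tv.
have mD : measurable D by exact: measurable_itv.
have Dc x : D x -> `|x - c| < L / 2.
  by rewrite /D /= in_itv /= => /andP[a1 a2]; rewrite ltr_norml; lra.
have ihv u : trig_closure L u -> cmeas D (fun x => u (x - c)) -> cintble D (fun x => h x * u (x - c)).
  move=> tu mu_; have [M M0 hM] := tc_bounded L0 tu.
  by apply: (cintbleM (M := M)) => // x /Dc; exact: hM.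
elim: tv => {v} [k|u v tu [mu_ IHu] tv [mv IHv]|u d tu [mu_ IHu]|u_ u M tu IH hM hu].
- split.
    by apply: cmeas_expi; do ?[exact: measurable_cst|exact: measurable_id|apply: measurable_funM|apply: measurable_funB].
  rewrite -(mul0r (cis (- (k%:~R * (c / L))))) -(h0 k) -cintZ//; last first.
    apply: (cintbleM (M := 1)) => // [|x _]; last by rewrite normc_cis.
    by apply: cmeas_expi; do ?[exact: measurable_cst|exact: measurable_id|apply: measurable_funM].
  by apply: eq_cint => x _; rewrite -mulrA -cisD; congr (_ * cis _); ring.
- split; first exact: cmeasD.
  rewrite (_ : (fun x => _) = (fun x => h x * u (x - c) + h x * v (x - c))); last first.
    by apply/funext => x; rewrite mulrDr.
  by rewrite cintD ?IHu ?IHv ?addr0//; exact: ihv.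
- split; first by apply: cmeasM => //; exact: cmeas_cst.
  rewrite (_ : (fun x => _) = (fun x => h x * u (x - c) * d)); last first.
    by apply/funext => x; rewrite mulrA.
  by rewrite cintZ ?IHu ?mul0r//; exact: ihv.
- have mu_ : cmeas D (fun x => u (x - c)).
    apply: (cmeas_cvg mD (F_ := fun n x => u_ n (x - c))) => [n|x /Dc]; last exact: hu.
    by case: (IH n).
  split => //.
  have := cint_dct mD (F_ := fun n x => h x * u_ n (x - c)) (F := fun x => h x * u (x - c))
    (g := fun x => M * normc (h x)) => cv.
  apply: (ccvg_unique (u := fun=> 0)); last exact: ccvg_cst.
  rewrite (_ : (fun=> 0) = (fun n => cint D (fun x => h x * u_ n (x - c)))); last first.
    by apply/funext => n; case: (IH n).
  apply: cv.
  + by move=> n; apply: cmeasM; [exact: cintble_meas|case: (IH n)].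
  + by move=> x /Dc hx; apply: ccvgM; [exact: ccvg_cst|exact: hu].
  + under eq_fun do rewrite EFinM; apply: integrableZl => //; exact: cintble_normc.
  + by move=> n x /Dc hx; rewrite normcM mulrC ler_wpM2r ?normc_ge0// hM.
Qed.

(** The primitive of [g] vanishes near every point of [D], and Lebesgue's differentiation theorem
    identifies its derivative with [g] almost everywhere. *)
Lemma Rintegral_primitive0 (c : R) (g : R -> R) : let D := `]c - L / 2, c + L / 2[%classic in
  mu.-integrable D (fun x => (g x)%:E) ->
  (forall y, D y -> Rintegral mu D (fun x => g x * (if x <= y then 1 else 0)) = 0) ->
  {ae mu, forall x, D x -> g x = 0}.
Proof.
move=> D ig h0.
have mD : measurable D by exact: measurable_itv.
have iT : mu.-integrable setT (EFin \o (g \_ D)).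
  by rewrite -restrict_EFin; apply/integrable_restrict => //; rewrite setTI.
have iy y : mu.-integrable `]-oo, y] (EFin \o (g \_ D)).
  by apply: integrableS iT => //; exact: measurable_itv.
have ll := integrable_locally_restrict mD ig.
apply: ae_mono (FTC1Ny iy ll) => x [_ dx] Dx.
transitivity ((g \_ D) x); first by rewrite patchE mem_set.
rewrite -dx derive1E (near_eq_derive (g := cst 0)) ?derive_cst//.
have oD : nbhs x D by apply: open_nbhs_nbhs; split => //; exact: itv_open.
near=> y; have Dy : D y by near: y.
rewrite /cst /= Rintegral_mkcond -[RHS](h0 y Dy) [RHS]Rintegral_mkcond.
apply: eq_Rintegral => z _; rewrite !patchE.
have -> : (z \in `]-oo, y]%classic) = (z <= y).
  by apply/idP/idP => [/set_mem|zy]; [|apply/mem_set]; rewrite /= in_itv.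
by case: ifP => _; case: ifP => //; rewrite ?mulr1 ?mulr0.
Unshelve. all: by end_near.
Qed.

(** Indicators of half-lines belong to the closure of the exponentials, so the primitive of [h]
    vanishes throughout [D]. *)
Lemma fourier_uniqueness (c : R) (h : R -> R[i]) : let D := `]c - L / 2, c + L / 2[%classic in
  cintble D h ->
  (forall k : int, cint D (fun x => h x * cis (k%:~R * (x / L))) = 0) ->
  {ae mu, forall x, D x -> h x = 0}.
Proof.
move=> D ih h0.
have key y : cint D (fun x => h x * (if x <= y then 1 else 0 : R)%:C) = 0.
  have tv := tc_sub L0 (tc_cst L0 1) (tc_indic_gt L0 (y - c)).
  have [_ <-] := tc_pairing ih h0 tv.
  apply: eq_cint => x _; congr (_ * _); rewrite ltrD2r ltNge.
  by case: leP => _; rewrite /= ?subr0 // subrr.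
have [iR iI] := ih.
have hR : {ae mu, forall x, D x -> complex.Re (h x) = 0}.
  apply: Rintegral_primitive0 => // y _; rewrite -[RHS](congr1 (@complex.Re _) (key y)).
  by apply: eq_Rintegral => x _; rewrite ReM /= mulr0 subr0.
have hI : {ae mu, forall x, D x -> complex.Im (h x) = 0}.
  apply: Rintegral_primitive0 => // y _; rewrite -[RHS](congr1 (@complex.Im _) (key y)).
  by apply: eq_Rintegral => x _; rewrite ImM /= mulr0 add0r.
by apply: ae_mono (ae_conj hR hI) => x [h1 h2] Dx; apply: complex_ext; rewrite ?h1 ?h2.
Qed.
End fourier.

(** * Sampling the power spectrum on the critical lattice *)

Section critical_sampling.
Context {R : realType}.
Notation mu := (@lebesgue_measure R).
Implicit Types (x y t r e : R) (z w : R[i]).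
Variables (B c : R).
Hypothesis B0 : 0 < B.
Let I : set R := `]c - B, c + B[%classic.
(** Differences of points of [I] fill []-2B, 2B[], an interval of length [4B]. *)
Let L := 4 * B.
Let mI : measurable I. Proof. exact: measurable_itv. Qed.
Let L0 : 0 < L. Proof. by rewrite mulr_gt0. Qed.
Let Idist x y : I x -> I y -> `|x - y| < L / 2.
Proof. by rewrite /I /= !in_itv /= /L ltr_norml => /andP[h1 h2] /andP[h3 h4]; lra. Qed.

(** [pairing h v] is the integral of [v] against the autocorrelation of [h], kept as an iterated
    integral: limits in [v] pass through it by two dominated convergences, and the order of
    integration is never changed. *)
Definition corr (h : R -> R[i]) (v : R -> R[i]) x := cint I (fun y => conjc (h y) * v (x - y)).
Definition pairing (h v : R -> R[i]) := cint I (fun x => h x * corr h v x).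

Lemma cmeas_cis D a : cmeas D (fun x => cis (a * x)).
Proof.
by apply: cmeas_expi; do ?[exact: measurable_cst|exact: measurable_id|apply: measurable_funM].
Qed.

Lemma corr_cis h a x : cintble I h ->
  corr h (fun x => cis (a * x)) x = conjc (cint I (fun y => h y * cis (a * y))) * cis (a * x).
Proof.
move=> ih.
have ihc : cintble I (fun y => h y * cis (a * y)).
  by apply: (cintbleM (M := 1)) => //; [exact: cmeas_cis|move=> y _; rewrite normc_cis].
rewrite -cint_conj// -cintZ//; last exact: cintble_conj.
apply: eq_cint => y _; rewrite rmorphM -mulrA; congr (_ * _).
by rewrite mulrBr cisD cisN mulrC.
Qed.

Lemma pairing_cis h a : cintble I h ->
  pairing h (fun x => cis (a * x)) = (normc (cint I (fun x => h x * cis (a * x))) ^+ 2)%:C.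
Proof.
move=> ih; rewrite -mulc_conj -cintZ//; last first.
  by apply: (cintbleM (M := 1)) => //; [exact: cmeas_cis|move=> y _; rewrite normc_cis].
by apply: eq_cint => x _; rewrite corr_cis// mulrCA mulrC.
Qed.

Lemma tc_meas v : trig_closure L v -> forall x, I x -> cmeas I (fun y => v (x - y)).
Proof.
elim=> {v} [k|u v tu IHu tv IHv|u d tu IHu|u_ u M tu IH hM hu] x Ix.
- by apply: cmeas_expi; do ?[exact: measurable_cst|exact: measurable_id|apply: measurable_funM|apply: measurable_funB].
- by apply: cmeasD; [exact: IHu|exact: IHv].
- by apply: cmeasM; [exact: IHu|exact: cmeas_cst].
- apply: (cmeas_cvg mI (F_ := fun n y => u_ n (x - y))) => [n|y Iy]; first exact: IH.
  by apply: hu; exact: Idist.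
Qed.

Lemma corr_cintble h v x : cintble I h -> trig_closure L v -> I x ->
  cintble I (fun y => conjc (h y) * v (x - y)).
Proof.
move=> ih tv Ix; have [M M0 hM] := tc_bounded L0 tv.
apply: (cintbleM (M := M)) => //; first exact: cintble_conj.
  exact: tc_meas.
by move=> y Iy; apply: hM; exact: Idist.
Qed.

Lemma normc_corr h v M x : cintble I h -> trig_closure L v ->
  (forall x, `|x| < L / 2 -> normc (v x) <= M) -> I x ->
  normc (corr h v x) <= M * Rintegral mu I (fun y => normc (h y)).
Proof.
move=> ih tv hM Ix; apply: le_trans (le_normc_cint _ _) _ => //; first exact: corr_cintble.
rewrite -RintegralZl//; last exact: cintble_normc.
apply: le_Rintegral => //.
- by apply: cintble_normc => //; exact: corr_cintble.
- rewrite (_ : _ \o _ = fun x => (M%:E * (normc (h x))%:E)%E); last exact/funext.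
  by apply: integrableZl => //; exact: cintble_normc.
- by move=> y Iy; rewrite normcM normc_conj mulrC ler_wpM2r ?normc_ge0// hM// Idist.
Qed.

Lemma corrD h u v x : cintble I h -> trig_closure L u -> trig_closure L v -> I x ->
  corr h (fun x => u x + v x) x = corr h u x + corr h v x.
Proof.
move=> ih tu tv Ix; rewrite -cintD//; try exact: corr_cintble.
by apply: eq_cint => y _; rewrite mulrDr.
Qed.

Lemma corrZ h u d x : cintble I h -> trig_closure L u -> I x ->
  corr h (fun x => u x * d) x = corr h u x * d.
Proof.
move=> ih tu Ix; rewrite -cintZ//; last exact: corr_cintble.
by apply: eq_cint => y _; rewrite mulrA.
Qed.

Lemma corr_lim h (u_ : nat -> R -> R[i]) u M x : cintble I h ->
  (forall n, trig_closure L (u_ n)) ->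
  (forall n x, `|x| < L / 2 -> normc (u_ n x) <= M) ->
  (forall x, `|x| < L / 2 -> ccvg (u_ ^~ x) (u x)) -> I x ->
  ccvg (fun n => corr h (u_ n) x) (corr h u x).
Proof.
move=> ih tu hM hu Ix.
apply: (cint_dct mI (g := fun y => M * normc (h y))).
- by move=> n; apply: cintble_meas; exact: corr_cintble.
- by move=> y Iy; apply: ccvgM; [exact: ccvg_cst|apply: hu; exact: Idist].
- under eq_fun do rewrite EFinM; apply: integrableZl => //; exact: cintble_normc.
- by move=> n y Iy; rewrite normcM normc_conj mulrC ler_wpM2r ?normc_ge0// hM// Idist.
Qed.

Lemma corr_meas h v : cintble I h -> trig_closure L v -> cmeas I (corr h v).
Proof.
move=> ih; elim=> {v} [k|u v tu IHu tv IHv|u d tu IHu|u_ u M tu IH hM hu].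
- rewrite (_ : corr h _ = fun x => conjc (cint I (fun y => h y * cis (k%:~R / L * y))) * cis (k%:~R / L * x)).
    by apply: cmeasM; [exact: cmeas_cst|exact: cmeas_cis].
  by apply/funext => x; rewrite -corr_cis//; apply: eq_cint => y _; rewrite mulrA mulrAC.
- by apply: cmeas_eq (cmeasD IHu IHv) => // x; rewrite inE => Ix; rewrite corrD.
- by apply: cmeas_eq (cmeasM IHu (cmeas_cst _ d)) => // x; rewrite inE => Ix; rewrite corrZ.
- by apply: (cmeas_cvg mI (F_ := fun n => corr h (u_ n))) => // x Ix; exact: (corr_lim (M := M)).
Qed.

Lemma pairing_cintble h v : cintble I h -> trig_closure L v ->
  cintble I (fun x => h x * corr h v x).
Proof.
move=> ih tv; have [M M0 hM] := tc_bounded L0 tv.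
apply: (cintbleM (M := M * Rintegral mu I (fun y => normc (h y)))) => //.
  exact: corr_meas.
by move=> x Ix; exact: normc_corr.
Qed.

(** On the generators the two sides are the squared moduli given by the hypothesis, and each rule of
    the closure preserves the equality. *)
Lemma eq_pairing h1 h2 : cintble I h1 -> cintble I h2 ->
  (forall k : int, normc (cint I (fun x => h1 x * cis (k%:~R / L * x))) =
                   normc (cint I (fun x => h2 x * cis (k%:~R / L * x)))) ->
  forall v, trig_closure L v -> pairing h1 v = pairing h2 v.
Proof.
move=> i1 i2 h12 v.
elim=> {v} [k|u v tu IHu tv IHv|u d tu IHu|u_ u M tu IH hM hu].
- rewrite (_ : (fun x => _) = (fun x => cis (k%:~R / L * x))).
    by rewrite !pairing_cis// h12.
  by apply/funext => x; rewrite mulrA mulrAC.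
- have pD h : cintble I h -> pairing h (fun x => u x + v x) = pairing h u + pairing h v.
    move=> ih; rewrite /pairing -(cintD mI (pairing_cintble ih tu) (pairing_cintble ih tv)).
    by apply: eq_cint => x; rewrite inE => Ix; rewrite (corrD ih tu tv Ix) mulrDr.
  rewrite (pD _ i1) (pD _ i2) IHu IHv; reflexivity.
- have pZ h : cintble I h -> pairing h (fun x => u x * d) = pairing h u * d.
    move=> ih; rewrite /pairing -(cintZ d mI (pairing_cintble ih tu)).
    by apply: eq_cint => x; rewrite inE => Ix; rewrite (corrZ d ih tu Ix) mulrA.
  rewrite (pZ _ i1) (pZ _ i2) IHu; reflexivity.
- have pL h : cintble I h -> ccvg (fun n => pairing h (u_ n)) (pairing h u).
    move=> ih; apply: (cint_dct mI (g := fun x => M * Rintegral mu I (fun y => normc (h y)) * normc (h x))).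
    + move=> n; exact: cintble_meas (pairing_cintble ih (tu n)).
    + move=> x Ix; exact: ccvgM (ccvg_cst (h x)) (corr_lim ih tu hM hu Ix).
    + under eq_fun do rewrite EFinM; apply: integrableZl; [exact: mI|exact: cintble_normc mI ih].
    + move=> n x Ix; rewrite normcM mulrC ler_wpM2r ?normc_ge0//; exact: normc_corr ih (tu n) (hM n) Ix.
  apply: ccvg_unique (pL _ i1) _.
  by under eq_fun do rewrite IH; exact: pL i2.
Qed.

(* The measurements on the lattice determine the autocorrelation of [h] through
   the coefficients of exponentials; the closure contains every [cis (w * x)]. *)
Lemma critical_sampling h1 h2 : cintble I h1 -> cintble I h2 ->
  (forall k : int, normc (cint I (fun x => h1 x * cis (k%:~R / L * x))) =
                   normc (cint I (fun x => h2 x * cis (k%:~R / L * x)))) ->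
  forall a : R, normc (cint I (fun x => h1 x * cis (a * x))) =
                normc (cint I (fun x => h2 x * cis (a * x))).
Proof.
move=> i1 i2 h12 a.
have tv : trig_closure L (fun x => cis (a * x)).
  apply: tc_ext (tc_cexp L0 ((2 * pi * a) *i)) => // x _.
  by rewrite (_ : (2 * pi * a) *i * x%:C = (2 * pi * (a * x)) *i) ?cexp_i//; apply: complex_ext => /=; ring.
have := eq_pairing i1 i2 h12 tv; rewrite !pairing_cis// => /(congr1 (@complex.Re R)) /= /eqP.
by rewrite eqrXn2 ?normc_ge0// => /eqP.
Qed.

End critical_sampling.

(** * Periodic functions *)

Section measure_preserving.
Context {R : realType}.
Notation mu := (@lebesgue_measure R).
Implicit Types (s : R -> R) (F : R -> R[i]) (a : R).

Definition mpres s := measurable_fun [set: R] s /\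
  forall A : set R, measurable A -> mu (s @^-1` A) = mu A.

Lemma mpres_comp s1 s2 : mpres s1 -> mpres s2 -> mpres (fun x => s1 (s2 x)).
Proof.
move=> [m1 h1] [m2 h2]; split; first exact: measurableT_comp.
move=> A mA; rewrite -(h1 A mA) -(h2 (s1 @^-1` A))//.
by rewrite -[X in measurable X]setTI; exact: m1.
Qed.

Lemma mpres_opp : mpres (fun x => - x).
Proof. by split; [exact: (measurableT_comp (@oppr_measurable R setT) (@measurable_id _ _ setT))|move=> A mA; exact: lebesgue_measureN]. Qed.

Lemma mpres_add a : mpres (fun x => x + a).
Proof.
have m : measurable_fun [set: R] (fun x => x + a).
  by apply: measurable_funD; [exact: measurable_id|exact: measurable_cst].
split=> // A mA; apply/esym; change (mu A = pushforward mu (fun x : measurableTypeR R => (x + a : measurableTypeR R)) A).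
apply: lebesgue_measure_unique => //= _ [[u v]] _ <-.
rewrite /pushforward.
have -> : (fun x : R => x + a) @^-1` `]u, v]%classic = `]u - a, v - a]%classic.
  by apply/seteqP; split => x /=; rewrite !in_itv /=; lra.
rewrite !lebesgue_measure_itv/= !lte_fin ltrD2r; case: ifP => // _.
by congr (_%:E); ring.
Qed.

Lemma mpres_ae s (P : set R) : mpres s -> {ae mu, forall x, P x} -> {ae mu, forall x, P (s x)}.
Proof.
move=> [ms h] [N [mN N0 sub]]; exists (s @^-1` N); split.
- by rewrite -[X in measurable X]setTI; exact: ms.
- by rewrite -N0; exact: h.
- by move=> x /= nP; exact: sub.
Qed.

Lemma mpres_integrable s (f : R -> R) : mpres s -> mu.-integrable setT (fun x => (f x)%:E) ->
  mu.-integrable setT (fun x => (f (s x))%:E) /\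
  Rintegral mu setT (fun x => f (s x)) = Rintegral mu setT f.
Proof.
move=> [ms h] fi.
have hA (g : R -> \bar R) : (\int[pushforward mu (s : measurableTypeR R -> measurableTypeR R)]_x g x = \int[mu]_x g x)%E.
  apply: (eq_measure_integral mu) => A mA _; exact: h.
have si : mu.-integrable setT (fun x => (f (s x))%:E).
  apply/integrableP; split.
    exact: (measurableT_comp (measurable_int mu fi) ms).
  move/integrableP : fi => [mf]; congr (_ < _)%E.
  rewrite -(hA (fun x => `|(f x)%:E|%E)).
  rewrite ge0_integral_pushforward//.
  by apply: measurableT_comp.
split=> //; congr fine.
pose s' : measurableTypeR R -> measurableTypeR R := s.
have ms' : measurable_fun setT s' by exact: ms.
have := integral_pushforward ms' (measurable_int mu fi) (D := setT) si measurableT.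
move=> /esym; rewrite preimage_setT => ->.
exact: (hA (fun x => (f x)%:E)).
Qed.

Lemma mpres_cintble s F : mpres s -> cintble setT F -> cintble setT (fun x => F (s x)).
Proof. by move=> ps [h1 h2]; split; [have [] := mpres_integrable ps h1|have [] := mpres_integrable ps h2]. Qed.

Lemma mpres_cint s F : mpres s -> cintble setT F -> cint setT (fun x => F (s x)) = cint setT F.
Proof. by move=> ps [h1 h2]; congr Complex; [have [] := mpres_integrable ps h1|have [] := mpres_integrable ps h2]. Qed.

Lemma ae_ex (P : set R) : {ae mu, forall x, P x} -> exists x, P x.
Proof.
move=> [N [mN N0 sub]]; apply: contrapT => h.
have NT : N = setT by apply/seteqP; split => // x _; apply: sub => /= Px; apply: h; exists x.
have : (mu `[0%R, 1%R] <= mu N)%E by apply: le_measure => //; rewrite ?inE ?NT//; exact: measurable_itv.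
by rewrite N0 lebesgue_measure_itv /= lte_fin ltr01 sube0 lee_fin ler10.
Qed.

End measure_preserving.

Section periodic.
Context {R : realType}.
Notation mu := (@lebesgue_measure R).
Implicit Types (F u v : R -> R[i]) (a b c s T x : R) (D : set R).

Definition aeper T F := {ae mu, forall x, F (x + T) = F x}.

Lemma ae_neq c : {ae mu, forall x, x != c}.
Proof.
exists [set c]; split; [exact: measurable_set1|exact: lebesgue_measure_set1|].
by move=> x /= /negP; rewrite negbK => /eqP.
Qed.

Lemma aeperN T F : aeper T F -> aeper (- T) F.
Proof.
move=> h; apply: ae_mono (mpres_ae (mpres_add (- T)) h) => x /=.
by rewrite subrK => ->.
Qed.

Lemma aeperMn T F (n : nat) : aeper T F -> aeper (n%:R * T) F.
Proof.
move=> h; elim: n => [|n IH]; first by apply: ae_all => x; rewrite mul0r addr0.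
apply: ae_mono (ae_conj IH (mpres_ae (mpres_add (n%:R * T)) h)) => x [e1 e2].
by rewrite -[n.+1]addn1 natrD mulrDl mul1r addrA e2 e1.
Qed.

Lemma aeperMz T F (k : int) : aeper T F -> aeper (k%:~R * T) F.
Proof.
case: k => n h; first by rewrite -pmulrn; exact: aeperMn.
by rewrite NegzE mulrNz mulNr -pmulrn; apply: aeperN; exact: aeperMn.
Qed.

(** Merging countably many exceptional sets allows the multiple of the period to depend on the
    point. *)
Lemma ae_allint (P : int -> set R) : (forall k, {ae mu, forall x, P k x}) ->
  {ae mu, forall x, forall k, P k x}.
Proof.
move=> h; apply: ae_mono (ae_conj (ae_foralln (fun n => h (Posz n))) (ae_foralln (fun n => h (Negz n)))).
by move=> x [h1 h2] [n|n].
Qed.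

Lemma floor_shift T c x : 0 < T -> exists k : int, c <= x + k%:~R * T < c + T.
Proof.
move=> T0; exists (- Num.floor ((x - c) / T)); rewrite mulrNz mulNr.
have /andP[h1 h2] := floor_itv ((x - c) / T).
rewrite ler_pdivlMr// in h1; rewrite ltr_pdivrMr// intrD mulrDl mul1r in h2.
by apply/andP; split; lra.
Qed.

(** A multiple of [T] moves each point into [[-B, -B + T[], which lies in [[-B, B[]; the points that
    land on [-B] form a null set. *)
Lemma periodic_ext B T u v : 0 < T <= 2 * B -> aeper T u -> aeper T v ->
  {ae mu, forall x, - B < x < B -> u x = v x} -> {ae mu, forall x, u x = v x}.
Proof.
move=> /andP[T0 TB] pu pv uv.
have h1 := ae_allint (fun k => aeperMz k pu).
have h2 := ae_allint (fun k => aeperMz k pv).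
have h3 := ae_allint (fun k => mpres_ae (mpres_add (k%:~R * T)) uv).
have h4 := ae_allint (fun k => mpres_ae (mpres_add (k%:~R * T)) (ae_neq (- B))).
apply: ae_mono (ae_conj (ae_conj h1 h2) (ae_conj h3 h4)) => x [[e1 e2] [e3 e4]].
have [k /andP[k1 k2]] := floor_shift (- B) x T0.
rewrite -(e1 k) -(e2 k); apply: (e3 k); apply/andP; split; last by lra.
by rewrite lt_neqAle eq_sym (e4 k).
Qed.

Definition cut a b F x := F x * (if (a < x) && (x < b) then 1 else 0 : R)%:C.

Lemma cint_mkcond D F : cint D F = cint setT (fun x => F x * (if x \in D then 1 else 0 : R)%:C).
Proof.
congr Complex; rewrite Rintegral_mkcond; apply: eq_Rintegral => x _; rewrite patchE; case: ifP => _.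
- by rewrite ReM /= mulr0 subr0 mulr1.
- by rewrite ReM /= !mulr0 subr0.
- by rewrite ImM /= mulr0 add0r mulr1.
- by rewrite ImM /= !mulr0 addr0.
Qed.

Lemma cintble_mkcond D F : measurable D -> cintble D F ->
  cintble setT (fun x => F x * (if x \in D then 1 else 0 : R)%:C).
Proof.
move=> mD [h1 h2]; split.
- move/integrable_mkcond : h1 => /(_ mD); apply: eq_integrable => // x _.
  by rewrite patchE ReM /= mulr0 subr0; case: ifP => _; rewrite ?mulr1 ?mulr0.
- move/integrable_mkcond : h2 => /(_ mD); apply: eq_integrable => // x _.
  by rewrite patchE ImM /= mulr0 add0r; case: ifP => _; rewrite ?mulr1 ?mulr0.
Qed.

Lemma in_itvoo a b x : (x \in `]a, b[%classic) = (a < x) && (x < b).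
Proof. by apply/idP/idP => [/set_mem|h]; [|apply/mem_set]; rewrite /= in_itv. Qed.

Lemma cint_itv a b F : cint `]a, b[%classic F = cint setT (cut a b F).
Proof. by rewrite cint_mkcond; apply: eq_cint => x _; rewrite in_itvoo. Qed.

Lemma cintble_cut a b F : cintble `]a, b[%classic F -> cintble setT (cut a b F).
Proof.
move=> h; apply: cintble_eq (cintble_mkcond (measurable_itv _) h) => // x _.
by rewrite in_itvoo.
Qed.

Lemma cut_split a c b F : a <= c <= b -> cintble `]a, b[%classic F ->
  cint setT (cut a b F) = cint setT (cut a c F) + cint setT (cut c b F).
Proof.
move=> /andP[ac cb] h.
have h1 : cintble setT (cut a c F).
  apply: cintble_cut; apply: cintbleS h; [exact: measurable_itv|exact: measurable_itv|].
  by move=> x /=; rewrite !in_itv /= => /andP[-> xc]; exact: lt_le_trans cb.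
have h2 : cintble setT (cut c b F).
  apply: cintble_cut; apply: cintbleS h; [exact: measurable_itv|exact: measurable_itv|].
  by move=> x /=; rewrite !in_itv /= => /andP[cx ->]; rewrite (le_lt_trans ac cx).
rewrite -(cintD measurableT h1 h2); apply: ae_eq_cint => //.
- exact: cintble_meas (cintble_cut h).
- exact: cmeasD (cintble_meas h1) (cintble_meas h2).
- apply: ae_mono (ae_neq c) => x xc _; rewrite /cut -mulrDr -rmorphD; congr (_ * _%:C).
  have [h3|h3|h3] := ltgtP x c.
  + by rewrite andbT (lt_le_trans h3 cb) andbT; case: ifP => _; rewrite addr0.
  + by rewrite andbF add0r (le_lt_trans ac h3).
  + by rewrite h3 eqxx in xc.
Qed.

Definition locint F := forall a b, cintble `]a, b[%classic F.

(** The piece of the shifted interval beyond [c + T] is moved back by one period onto []c, c +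
    s[]. *)
Lemma periodic_shift T c s F : 0 <= s <= T -> locint F -> aeper T F ->
  cint `]c, c + T[%classic (fun x => F (x + s)) = cint `]c, c + T[%classic F.
Proof.
move=> /andP[s0 sT] iF pF; rewrite !cint_itv.
have tr r a b : (fun x => cut a b F (x + r)) = cut (a - r) (b - r) (fun x => F (x + r)).
  by apply/funext => x; rewrite /cut ltrBlDr ltrBrDr.
have sh r a b : cint setT (cut (a - r) (b - r) (fun x => F (x + r))) = cint setT (cut a b F).
  by rewrite -tr (mpres_cint (mpres_add r))//; exact: cintble_cut.
have := sh s (c + s) (c + T + s); rewrite !addrK => ->.
rewrite (@cut_split c (c + s) (c + T)) ?lerDl ?s0 ?lerD2l//.
rewrite (@cut_split (c + s) (c + T) (c + T + s)) ?lerDl ?lerD2l ?sT//.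
rewrite addrC; congr (_ + _); rewrite -(sh T) addrK.
have -> : c + T + s - T = c + s by ring.
apply: ae_eq_cint => //.
- have := cintble_meas (mpres_cintble (mpres_add T) (cintble_cut (iF (c + T) (c + T + s)))).
  by rewrite tr addrK (_ : c + T + s - T = c + s)//; ring.
- exact: cintble_meas (cintble_cut (iF _ _)).
- by apply: ae_mono pF => x e _; rewrite /cut e.
Qed.

Lemma locintM F u M : locint F -> cmeas setT u -> (forall x, normc (u x) <= M) ->
  locint (fun x => F x * u x).
Proof.
move=> iF mu_ uM a b; apply: (cintbleM (M := M)) => //.
exact: cmeasS mu_.
Qed.

End periodic.

(** * Phase retrieval at one time *)

Section fourier_transform.
Context {R : realType}.
Notation mu := (@lebesgue_measure R).
Implicit Types (h u : R -> R[i]) (w x y M : R) (z : R[i]).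
Variable B : R.
Hypothesis B0 : 0 < B.

Definition supp h := forall x, B <= `|x| -> h x = 0.
Definition ft h w := cint setT (fun x => h x * cis (- (w * x))).
Definition ft_ext h z := cint setT (fun x => h x * cexp ((0 +i* (- (2 * pi * x))) * z)).

Lemma supp_cintbleM h u M : cintble setT h -> supp h -> cmeas setT u ->
  (forall x, `|x| < B -> normc (u x) <= M) ->
  cintble setT (fun x => h x * u x) /\
  normc (cint setT (fun x => h x * u x)) <= M * Rintegral mu setT (fun x => normc (h x)).
Proof.
move=> ih sh mu_ uM.
have hb x : normc (h x * u x) <= M * normc (h x).
  rewrite normcM mulrC; have [/sh->|/uM hx] := leP B `|x|; first by rewrite normc0 !mulr0.
  by rewrite ler_wpM2r ?normc_ge0.
have i1 : mu.-integrable setT (fun x => (M * normc (h x))%:E).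
  by under eq_fun do rewrite EFinM; apply: integrableZl; [exact: measurableT|exact: cintble_normc measurableT ih].
have i2 : cintble setT (fun x => h x * u x).
  by apply: (cintble_le measurableT _ i1) => //; exact: cmeasM (cintble_meas ih) mu_.
split=> //; apply: le_trans (le_normc_cint measurableT i2) _.
rewrite -RintegralZl//; last exact: cintble_normc measurableT ih.
apply: le_Rintegral => //; exact: cintble_normc measurableT i2.
Qed.

Lemma cmeas_imag : cmeas setT (fun x : R => 0 +i* (- (2 * pi * x))).
Proof.
split=> /=; first exact: measurable_cst.
by apply: measurableT_comp; [exact: oppr_measurable|apply: measurable_funM; [exact: measurable_cst|exact: measurable_id]].
Qed.

Lemma normc_imag (t : R) : normc (0 +i* t) = `|t|.
Proof. by rewrite /= expr0n /= add0r sqrtr_sqr. Qed.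

Lemma normc_kernel x z : `|x| < B ->
  normc (cexp ((0 +i* (- (2 * pi * x))) * z)) <= expR (2 * pi * B * `|complex.Im z|).
Proof.
move=> xB; rewrite normc_cexp ReM /= mul0r sub0r mulNr opprK ler_expR -!mulrA.
rewrite ler_wpM2l// ler_wpM2l ?pi_ge0//.
apply: le_trans (ler_norm _) _; rewrite normrM ler_wpM2r//; exact: ltW.
Qed.

Lemma cmeas_kernel z : cmeas setT (fun x : R => cexp ((0 +i* (- (2 * pi * x))) * z)).
Proof. by apply: cmeas_cexp; apply: cmeasM; [exact: cmeas_imag|exact: cmeas_cst]. Qed.

(** A polynomial close to [cexp] on the disk of radius [2 pi B r] is put under the integral.
    Integrated term by term it becomes a polynomial in [z], whose coefficients are moments of
    [h]. *)
Lemma ft_ext_entire h : cintble setT h -> supp h -> entire (ft_ext h).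
Proof.
move=> ih sh r e e0; have [r0|/cdisk_neg] := leP 0 r; last by apply.
pose N := Rintegral mu setT (fun x => normc (h x)).
have N0 : 0 <= N by apply: Rintegral_ge0 => x _; exact: normc_ge0.
have pB0 : 0 <= 2 * pi * B :> R by rewrite !mulr_ge0 ?pi_ge0 ?(ltW B0).
have d0 : 0 < e / (N + 1) by rewrite divr_gt0// ltr_wpDl.
have [p hp] := entire_cexp (2 * pi * B * r) d0.
pose a x : R[i] := 0 +i* (- (2 * pi * x)).
have na x : `|x| < B -> normc (a x) <= 2 * pi * B.
  move=> xB; rewrite normc_imag normrN normrM ger0_norm ?mulr_ge0 ?pi_ge0//.
  by rewrite ler_wpM2l ?mulr_ge0 ?pi_ge0// ltW.
have i1 k : cintble setT (fun x => h x * a x ^+ k).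
  have [] // := @supp_cintbleM h (fun x => a x ^+ k) ((2 * pi * B) ^+ k) ih sh.
    by apply: cmeasX; exact: cmeas_imag.
  by move=> x xB; rewrite normcX; apply: lerXn2r; rewrite ?nnegrE ?normc_ge0//; exact: na.
exists (\poly_(k < size p) (p`_k * cint setT (fun x => h x * a x ^+ k))) => z zr.
have qE : (\poly_(k < size p) (p`_k * cint setT (fun x => h x * a x ^+ k))).[z] =
    cint setT (fun x => h x * p.[a x * z]).
  rewrite horner_poly.
  transitivity (\sum_(k < size p) cint setT (fun x => h x * a x ^+ k * (p`_k * z ^+ k))).
    by apply: eq_bigr => k _; rewrite (cintZ _ measurableT (i1 k)) mulrCA mulrA.
  rewrite -(cint_sum _ measurableT); last by move=> k _; exact: cintbleZ measurableT (i1 k).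
  apply: eq_cint => x _; rewrite horner_coef mulr_sumr; apply: eq_bigr => k _.
  by rewrite exprMn; ring.
have [i2 _] := supp_cintbleM ih sh (cmeas_kernel z) (fun x => @normc_kernel x z).
have mp : cmeas setT (fun x => p.[a x * z]).
  elim/poly_ind: (p) => [|q c IH].
    by under eq_fun do rewrite horner0; exact: cmeas_cst.
  under eq_fun do rewrite hornerMXaddC.
  apply: cmeasD; last exact: cmeas_cst.
  by apply: cmeasM IH _; apply: cmeasM; [exact: cmeas_imag|exact: cmeas_cst].
have mk : cmeas setT (fun x => cexp (a x * z) - p.[a x * z]) by apply: cmeasB mp; exact: cmeas_kernel.
have kb x : `|x| < B -> normc (cexp (a x * z) - p.[a x * z]) <= e / (N + 1).
  move=> /na nx; apply: hp; rewrite /cdisk /mkset normcM.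
  by apply: ler_pM => //; exact: normc_ge0.
have [i3 b3] := supp_cintbleM ih sh mk kb.
have i4 : cintble setT (fun x => h x * p.[a x * z]).
  apply: cintble_eq measurableT _ (cintbleB measurableT i2 i3) => x _.
  by rewrite -mulrBr opprB addrC subrK.
rewrite qE /ft_ext -(cintB measurableT i2 i4).
have -> : cint setT (fun x => h x * cexp (a x * z) - h x * p.[a x * z]) =
    cint setT (fun x => h x * (cexp (a x * z) - p.[a x * z])).
  by apply: eq_cint => x _; rewrite mulrBr.
apply: le_trans b3 _; rewrite mulrAC ler_pdivrMr ?ltr_wpDl// ler_wpM2l ?(ltW e0)// lerDl.
exact: ler01.
Qed.

Lemma PW_ft h : cintble setT h -> supp h -> PW B (ft_ext h).
Proof.
move=> ih sh; split; first exact: ft_ext_entire.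
have N0 : 0 <= Rintegral mu setT (fun x => normc (h x)).
  by apply: Rintegral_ge0 => x _; exact: normc_ge0.
exists (Rintegral mu setT (fun x => normc (h x)) + 1) => [|z]; first by rewrite ltr_wpDl.
have [_ b2] := supp_cintbleM ih sh (cmeas_kernel z) (fun x => @normc_kernel x z).
apply: le_trans b2 _; rewrite mulrC ler_wpM2r ?expR_ge0// lerDl; exact: ler01.
Qed.

Lemma ft_extE h w : ft_ext h w%:C = ft h w.
Proof.
apply: eq_cint => x _; congr (_ * _).
rewrite (_ : _ * w%:C = (- (2 * pi * x * w)) *i); last by apply: complex_ext => /=; ring.
by rewrite cexp_i /cis; congr expi; ring.
Qed.

Lemma ft_cintble h w : cintble setT h -> cintble setT (fun x => h x * cis (- (w * x))).
Proof.
move=> ih; apply: (cintbleM (M := 1) measurableT ih) => [|x _]; last by rewrite normc_cis.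
by apply: cmeas_expi; do ?[exact: measurable_cst|exact: measurable_id|apply: measurable_funM|apply: measurableT_comp; [exact: oppr_measurable|]].
Qed.

Lemma PWM A A' F G : PW A F -> PW A' G -> PW (A + A') (fun z : R[i] => F z * G z).
Proof.
move=> [eF [C C0 FC]] [eG [C' C'0 GC]]; split; first exact: entireM.
exists (C * C') => [|z]; first exact: mulr_gt0.
rewrite normcM (_ : 2 * pi * (A + A') * _ = 2 * pi * A * `|complex.Im z| + 2 * pi * A' * `|complex.Im z|); last by ring.
by rewrite expRD mulrACA ler_pM ?normc_ge0.
Qed.

Lemma PWB A F G : PW A F -> PW A G -> PW A (fun z : R[i] => F z - G z).
Proof.
move=> [eF [C C0 FC]] [eG [C' C'0 GC]]; split.
  move=> r; apply: papprox_eq (entireD eF (entireM (entire_cst (-1)) eG) r) => z _.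
  by rewrite mulN1r.
exists (C + C') => [|z]; first exact: addr_gt0.
by apply: le_trans (ler_normcB _ _) _; rewrite mulrDl lerD.
Qed.

Lemma PW_conj A F : PW A F -> PW A (fun z : R[i] => conjc (F (conjc z))).
Proof.
move=> [eF [C C0 FC]]; split; first exact: entire_conj.
by exists C => // z; rewrite normc_conj; have := FC (conjc z); rewrite Im_conj normrN.
Qed.

Lemma PW_shift A F (c : R) : PW A F -> PW A (fun z : R[i] => F (c%:C + z)).
Proof.
move=> [eF [C C0 FC]]; split; first exact: entire_shift.
by exists C => // z; have := FC (c%:C + z); rewrite ImD /= add0r.
Qed.

Lemma PW_ae_neq0 A F w : 0 <= A -> PW A F -> F w%:C != 0 -> {ae mu, forall x, F x%:C != 0}.
Proof. by move=> A0 [eF [C C0 FC]] w0; exact: entire_ae_neq0 A0 C0 eF FC w0. Qed.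

Lemma conjc_real w : conjc (w%:C) = w%:C :> R[i].
Proof. by apply: complex_ext => /=; rewrite ?oppr0. Qed.

(** The factor [conjc (F (conjc z))] makes [H] entire with value [|F|^2 - |G|^2] on the real line.
    Its type corresponds to [A = 2 B], whence the critical density [2 A = 4 B]. *)
Lemma supercritical_sampling (om : nat -> R) h1 h2 :
  cintble setT h1 -> supp h1 -> cintble setT h2 -> supp h2 ->
  supercritical_density B om ->
  (forall n, (1 <= n)%N -> normc (ft h1 (om n)) = normc (ft h2 (om n))) ->
  forall w, normc (ft h1 w) = normc (ft h2 w).
Proof.
move=> i1 s1 i2 s2 [om0 omS oml] h12 w.
pose F := ft_ext h1; pose G := ft_ext h2.
pose H z := F z * conjc (F (conjc z)) - G z * conjc (G (conjc z)).
have pF : PW B F by exact: PW_ft.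
have pG : PW B G by exact: PW_ft.
have pH : PW (B + B) H by apply: PWB; apply: PWM => //; exact: PW_conj.
have HE x : H x%:C = (normc (ft h1 x) ^+ 2 - normc (ft h2 x) ^+ 2)%:C.
  by rewrite /H conjc_real /F /G !ft_extE !mulc_conj rmorphB.
(* An intermediate density; the upper limit may be infinite, in which case any [D] above [4 B] will
   do. *)
have [D D1 D2] : exists2 D : R, 4 * B < D & (D%:E < limn_esup (fun n => (n%:R / om n)%:E))%E.
  case: (limn_esup _) oml => [l| |//]; last by move=> _; exists (4 * B + 1); rewrite ?ltrDl ?ltry.
  rewrite lte_fin => hl; exists ((4 * B + l) / 2); rewrite ?lte_fin; lra.
have hD N : exists2 n, (N <= n)%N & om n * D < n%:R.
  move: D2; rewrite limn_esup_lim => D2.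
  apply: contrapT => hN.
  have : (limn (esups (fun n => (n%:R / om n)%:E)) <= D%:E)%E.
    apply: lime_le; first exact: is_cvg_esups.
    (* Indices start at [1], where [om] is known to be positive. *)
    exists (maxn N 1) => // m /= hm.
    apply: ge_ereal_sup => _ [n hn <-]; rewrite lee_fin.
    have n1 : (1 <= n)%N by apply: leq_trans hn; apply: leq_trans hm; rewrite leq_maxr.
    have nN : (N <= n)%N by apply: leq_trans hn; apply: leq_trans hm; rewrite leq_maxl.
    rewrite ler_pdivrMr ?om0// leNgt mulrC; apply/negP => hlt; apply: hN.
    by exists n.
  by rewrite leNgt D2.
have Hom n : (1 <= n)%N -> H (om n)%:C = 0.
  by move=> n1; rewrite HE h12// subrr.
have A0 : 0 < B + B by rewrite addr_gt0.
have AD : 2 * (B + B) < D by apply: le_lt_trans D1; lra.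
have := PW_density pH A0 AD om0 omS Hom hD w.
rewrite HE => /(congr1 (@complex.Re R)) /= /eqP; rewrite subr_eq0 eqrXn2 ?normc_ge0//.
by move/eqP.
Qed.

End fourier_transform.

(** * From power spectra to the windowed function *)

Section phase_retrieval.
Context {R : realType}.
Notation mu := (@lebesgue_measure R).
Implicit Types (h u : R -> R[i]) (w x y : R) (z : R[i]).
Variable B : R.
Hypothesis B0 : 0 < B.

Lemma supp_cint D h u : supp B h -> (forall x, `|x| < B -> D x) ->
  cint D (fun x => h x * u x) = cint setT (fun x => h x * u x).
Proof.
move=> sh BD; rewrite cint_mkcond; apply: eq_cint => x _.
case: ifPn => [_|/negP xD]; first by rewrite mulr1.
rewrite mulr0; have [/sh->|/BD Dx] := leP B `|x|; first by rewrite mul0r.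
by case: xD; exact: mem_set.
Qed.

Lemma sampling (om : nat -> R) h1 h2 :
  cintble setT h1 -> supp B h1 -> cintble setT h2 -> supp B h2 ->
  critical_lattice B om \/ supercritical_density B om ->
  (forall n, (1 <= n)%N -> normc (ft h1 (om n)) = normc (ft h2 (om n))) ->
  forall w, normc (ft h1 w) = normc (ft h2 w).
Proof.
move=> i1 s1 i2 s2 [cr|su] h12 w; last exact: (supercritical_sampling B0 i1 s1 i2 s2 su h12).
have mI : measurable `]0 - B, 0 + B[%classic by exact: measurable_itv.
have BI x : `|x| < B -> `]0 - B, 0 + B[%classic x.
  by rewrite /= in_itv /= sub0r add0r ltr_norml.
have ftE h a : supp B h -> cint `]0 - B, 0 + B[%classic (fun x => h x * cis (a * x)) = ft h (- a).
  by move=> sh; rewrite supp_cint//; apply: eq_cint => x _; rewrite mulNr opprK.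
have j1 := cintbleS mI measurableT (@subsetT _ _) i1.
have j2 := cintbleS mI measurableT (@subsetT _ _) i2.
have := critical_sampling B0 j1 j2 _ (- w); rewrite !ftE// opprK; apply => k.
rewrite !ftE//.
have : [set j%:~R / (4 * B) | j in [set: int]] (- (k%:~R / (4 * B))).
  by exists (- k) => //; rewrite mulrNz mulNr.
by rewrite -cr => -[n n1 <-]; exact: h12.
Qed.

(** By polarization the three moduli give the real part of [a' * conjc a], and two of them its
    modulus; the imaginary part is thus known up to its sign. *)
Lemma eq_or_conj (a a' c c' : R[i]) : normc a = normc c -> normc a' = normc c' ->
  normc (a' - a) = normc (c' - c) ->
  (a' * conjc a - c' * conjc c) * (a' * conjc a - conjc (c' * conjc c)) = 0.
Proof.
move=> e1 e2 e3.
have hRe : complex.Re (a' * conjc a) = complex.Re (c' * conjc c).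
  have ex (u v : R[i]) : normc (v - u) ^+ 2 = normc v ^+ 2 + normc u ^+ 2 - 2 * complex.Re (v * conjc u).
    by rewrite !sqr_normcE ReM ReD ImD ReN ImN Re_conj Im_conj; ring.
  by have := ex a a'; have := ex c c'; rewrite e1 e2 e3; lra.
have hn : normc (a' * conjc a) = normc (c' * conjc c) by rewrite !normcM !normc_conj e1 e2.
move: (a' * _) (c' * _) hRe hn => [p1 p2] [q1 q2] /= hRe /(congr1 (fun t => t ^+ 2)).
rewrite !sqr_sqrtr ?addr_ge0 ?sqr_ge0// hRe => /addrI /eqP; rewrite eqf_sqr => /orP[]/eqP->.
  by rewrite subrr mul0r.
by rewrite subrr mulr0.
Qed.

(* With P, Q the extensions of H1 (w + b) * conj (H1 w) and H2 (w + b) * conj (H2 w),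
   (P - Q) * (P - conj Q) vanishes on the real line, so one factor does. *)
Lemma cross_dichotomy b h1 h2 :
  cintble setT h1 -> supp B h1 -> cintble setT h2 -> supp B h2 ->
  (forall w, normc (ft h1 w) = normc (ft h2 w)) ->
  (forall w, normc (ft h1 (b + w) - ft h1 w) = normc (ft h2 (b + w) - ft h2 w)) ->
  (forall w, ft h1 (b + w) * conjc (ft h1 w) = ft h2 (b + w) * conjc (ft h2 w)) \/
  (forall w, ft h1 (b + w) * conjc (ft h1 w) = conjc (ft h2 (b + w) * conjc (ft h2 w))).
Proof.
move=> i1 s1 i2 s2 e1 e2.
pose P h z := ft_ext h (b%:C + z) * conjc (ft_ext h (conjc z)).
have pP h : cintble setT h -> supp B h -> PW (B + B) (P h).
  move=> ih sh; have pw := PW_ft B0 ih sh.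
  by apply: PWM; [exact: PW_shift|exact: PW_conj].
have PE h w : P h w%:C = ft h (b + w) * conjc (ft h w).
  by rewrite /P conjc_real -rmorphD !ft_extE.
pose U z := P h1 z - P h2 z; pose V z := P h1 z - conjc (P h2 (conjc z)).
have pU : PW (B + B) U by apply: PWB; exact: pP.
have pV : PW (B + B) V by apply: PWB; [exact: pP|apply: PW_conj; exact: pP].
have BB : 0 <= B + B by rewrite addr_ge0 ?ltW.
have UV w : U w%:C * V w%:C = 0.
  by rewrite /U /V conjc_real !PE; apply: eq_or_conj.
have [hU|/existsNP[w1 /eqP U1]] := pselect (forall w, U w%:C = 0).
  by left => w; have /eqP := hU w; rewrite subr_eq0 !PE => /eqP.
have [hV|/existsNP[w2 /eqP V2]] := pselect (forall w, V w%:C = 0).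
  by right => w; have /eqP := hV w; rewrite /V conjc_real subr_eq0 !PE => /eqP.
have [w [/negP hU /negP hV]] := ae_ex (ae_conj (PW_ae_neq0 BB pU U1) (PW_ae_neq0 BB pV V2)).
by have /eqP := UV w; rewrite mulf_eq0 => /orP[].
Qed.

(* The cross products transport the ratio F / G = lam from one point of the
   progression w + bZ to the next, in both directions. *)
Lemma phase_propagation (F G : R -> R[i]) b w :
  (forall v, normc (F v) = normc (G v)) ->
  (forall v, F (b + v) * conjc (F v) = G (b + v) * conjc (G v)) ->
  (forall k : int, G (w + k%:~R * b) != 0) ->
  exists2 lam, normc lam = 1 & forall k : int, F (w + k%:~R * b) = lam * G (w + k%:~R * b).
Proof.
move=> e1 e2 G0; have Gw : G w != 0 by have := G0 0; rewrite mul0r addr0.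
pose lam := F w / G w.
have nl : normc lam = 1.
  by rewrite /lam normcM normcV e1 divff// lt0r_neq0// normc_gt0.
have ll : lam * conjc lam = 1 by rewrite mulc_conj nl expr1n.
have up v : F v = lam * G v -> G v != 0 -> F (b + v) = lam * G (b + v).
  move=> Fv Gv; have := e2 v; rewrite Fv rmorphM mulrA => /mulIf h.
  by rewrite -[LHS]mulr1 -ll mulrCA h// conjc_eq0.
have dn v : F (b + v) = lam * G (b + v) -> G (b + v) != 0 -> F v = lam * G v.
  move=> Fv Gv.
  have h : conjc lam * F v = G v.
    have : conjc (conjc lam * F v) = conjc (G v).
      by rewrite conjcM conjcK; apply: (mulfI Gv); rewrite -(e2 v) Fv; ring.
    exact: (can_inj (@conjcK R)).
  by rewrite -h mulrA ll mul1r.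
exists lam => //.
have nat_up (n : nat) : F (w + n%:R * b) = lam * G (w + n%:R * b).
  elim: n => [|n IH]; first by rewrite mul0r addr0 /lam divfK.
  have := up _ IH (G0 n%:Z); rewrite addrCA (_ : b + n%:R * b = n.+1%:R * b)//.
  by rewrite -natr1; ring.
have nat_dn (n : nat) : F (w - n%:R * b) = lam * G (w - n%:R * b).
  elim: n => [|n IH]; first by rewrite mul0r subr0 /lam divfK.
  have e : b + (w - n.+1%:R * b) = w - n%:R * b by rewrite -natr1; ring.
  apply: dn; rewrite e//; have := G0 (- n%:Z); by rewrite mulrNz mulNr.
case=> n; first exact: nat_up.
by rewrite NegzE mulrNz mulNr -pmulrn; exact: nat_dn.
Qed.

(** The values on [w + bZ] are the Fourier coefficients of a modulated [h] on an interval of length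
    [1 / b], which contains the support because [b <= 1 / (2 B)]. *)
Lemma ft_uniqueness b w h : 0 < b <= 1 / (2 * B) -> cintble setT h -> supp B h ->
  (forall k : int, ft h (w + k%:~R * b) = 0) -> {ae mu, forall x, h x = 0}.
Proof.
move=> /andP[b0 bB] ih sh h0.
have L0 : 0 < b^-1 by rewrite invr_gt0.
have BL : B <= b^-1 / 2.
  rewrite ler_pdivlMr// -[leLHS]invrK lef_pV2 ?posrE ?invr_gt0 ?mulr_gt0//.
  by rewrite mulrC -div1r.
set D : set R := `]0 - b^-1 / 2, 0 + b^-1 / 2[%classic.
have mD : measurable D by exact: measurable_itv.
have BD x : `|x| < B -> D x.
  by rewrite /D /= in_itv /= sub0r add0r ltr_norml; lra.
have i1 := cintbleS mD measurableT (@subsetT _ _) (ft_cintble w ih).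
have key (k : int) : cint D (fun x => h x * cis (- (w * x)) * cis (k%:~R * (x / b^-1))) = 0.
  rewrite -(h0 (- k)) -[RHS](@supp_cint D)//; apply: eq_cint => x _.
  by rewrite -mulrA -cisD; congr (_ * cis _); rewrite invrK mulrNz; ring.
apply: ae_mono (fourier_uniqueness L0 i1 key) => x hx.
have [/sh//|/BD /hx/eqP] := leP B `|x|.
by rewrite mulf_eq0 (negbTE (expi_neq0 _)) orbF => /eqP.
Qed.

Lemma suppB h1 h2 (lam : R[i]) : supp B h1 -> supp B h2 -> supp B (fun x => h1 x - h2 x * lam).
Proof. by move=> s1 s2 x xB; rewrite s1// s2// mul0r subrr. Qed.

(** Unless the transform of [h2] vanishes identically, its real zeros form a null set, so almost
    every progression [w + bZ] avoids them and carries a single phase. *)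
Lemma retrieval_direct b h1 h2 : 0 < b <= 1 / (2 * B) ->
  cintble setT h1 -> supp B h1 -> cintble setT h2 -> supp B h2 ->
  (forall w, normc (ft h1 w) = normc (ft h2 w)) ->
  (forall w, ft h1 (b + w) * conjc (ft h1 w) = ft h2 (b + w) * conjc (ft h2 w)) ->
  exists2 lam, normc lam = 1 & {ae mu, forall x, h1 x = lam * h2 x}.
Proof.
move=> hb i1 s1 i2 s2 e1 e2.
have [h0|/existsNP[w0 /eqP G0]] := pselect (forall w, ft h2 w = 0).
  exists 1; first by rewrite normc_real normr1.
  have z2 : {ae mu, forall x, h2 x = 0} by apply: (ft_uniqueness (w := 0) hb i2 s2) => k.
  have z1 : {ae mu, forall x, h1 x = 0}.
    apply: (ft_uniqueness (w := 0) hb i1 s1) => k; apply: eq0_normc.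
    by rewrite e1 h0 normc0.
  by apply: ae_mono (ae_conj z1 z2) => x [-> ->]; rewrite mulr0.
have pG := PW_ft B0 i2 s2.
have g0 : {ae mu, forall w, ft h2 w != 0}.
  have := PW_ae_neq0 (w := w0) (ltW B0) pG; rewrite ft_extE => /(_ G0).
  by apply: ae_mono => w; rewrite ft_extE.
have [w Gw] := ae_ex (ae_allint (fun k => mpres_ae (mpres_add (k%:~R * b)) g0)).
have [lam nl hl] := phase_propagation e1 e2 Gw.
exists lam => //.
have := ft_uniqueness (w := w) hb (cintbleB measurableT i1 (cintbleZ lam measurableT i2)) (suppB lam s1 s2).
have hk (k : int) : ft (fun x => h1 x - h2 x * lam) (w + k%:~R * b) = 0.
  transitivity (ft h1 (w + k%:~R * b) - ft h2 (w + k%:~R * b) * lam); last first.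
    by rewrite hl mulrC subrr.
  have j1 := ft_cintble (w + k%:~R * b) i1; have j2 := ft_cintble (w + k%:~R * b) i2.
  rewrite /ft -(cintZ lam measurableT j2) -(cintB measurableT j1 (cintbleZ lam measurableT j2)).
  by apply: eq_cint => x _; ring.
move=> /(_ hk); apply: ae_mono => x /eqP; rewrite subr_eq0 mulrC => /eqP.
by [].
Qed.

Definition conj_reflect h x := conjc (h (- x)).

Lemma reflect_cintble h : cintble setT h -> cintble setT (conj_reflect h).
Proof. by move=> ih; apply: cintble_conj measurableT (mpres_cintble mpres_opp ih). Qed.

Lemma reflect_supp h : supp B h -> supp B (conj_reflect h).
Proof. by move=> sh x xB; rewrite /conj_reflect sh ?normrN// rmorph0. Qed.

Lemma ft_reflect h w : cintble setT h -> ft (conj_reflect h) w = conjc (ft h w).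
Proof.
move=> ih; have i1 := ft_cintble w ih.
rewrite -(cint_conj measurableT i1) -(mpres_cint mpres_opp (cintble_conj measurableT i1)).
apply: eq_cint => x _; rewrite /conj_reflect [RHS]rmorphM; congr (_ * _).
by rewrite -[RHS]cisN; congr cis; ring.
Qed.

Lemma local_retrieval (om : nat -> R) b h1 h2 : 0 < b <= 1 / (2 * B) ->
  cintble setT h1 -> supp B h1 -> cintble setT h2 -> supp B h2 ->
  critical_lattice B om \/ supercritical_density B om ->
  (forall n, (1 <= n)%N -> normc (ft h1 (om n)) = normc (ft h2 (om n))) ->
  (forall n, (1 <= n)%N -> normc (ft h1 (b + om n) - ft h1 (om n)) =
                           normc (ft h2 (b + om n) - ft h2 (om n))) ->
  exists2 lam, normc lam = 1 & {ae mu, forall x, h1 x = lam * h2 x} \/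
                               {ae mu, forall x, h1 x = lam * conj_reflect h2 x}.
Proof.
move=> hb i1 s1 i2 s2 hom m1 m2.
have e1 := sampling i1 s1 i2 s2 hom m1.
(* [d h] has the transform [H (b + w) - H w] and is again supported in the window, so the sampling
   result also extends the differences from the sequence to all [w]. *)
pose d h x := h x * (cis (- (b * x)) - 1).
have md : cmeas setT (fun x => cis (- (b * x)) - 1).
  apply: cmeasB; last exact: cmeas_cst.
  by under eq_fun do rewrite -mulNr; exact: cmeas_cis.
have di h : cintble setT h -> cintble setT (d h).
  move=> ih; apply: (cintbleM (M := 2) measurableT ih md) => x _.
  by apply: le_trans (ler_normcB _ _) _; rewrite normc_cis normc_real normr1; lra.
have ds h : supp B h -> supp B (d h) by move=> sh x xB; rewrite /d sh// mul0r.
have dE h w : cintble setT h -> ft (d h) w = ft h (b + w) - ft h w.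
  move=> ih; rewrite /ft -(cintB measurableT (ft_cintble (b + w) ih) (ft_cintble w ih)).
  apply: eq_cint => x _; rewrite /d -mulrA mulrBl mul1r mulrBr -cisD.
  by congr (_ * cis _ - _); ring.
have e2 w : normc (ft h1 (b + w) - ft h1 w) = normc (ft h2 (b + w) - ft h2 w).
  rewrite -(dE _ _ i1) -(dE _ _ i2).
  apply: (sampling (di _ i1) (ds _ s1) (di _ i2) (ds _ s2) hom) => n n1.
  by rewrite (dE _ _ i1) (dE _ _ i2) m2.
have [c1|c2] := cross_dichotomy i1 s1 i2 s2 e1 e2.
  by have [lam nl hl] := retrieval_direct hb i1 s1 i2 s2 e1 c1; exists lam => //; left.
(* The conjugated cross products of [h2] are the cross products of its reflection. *)
have [||lam nl hl] := retrieval_direct hb i1 s1 (reflect_cintble i2) (reflect_supp s2).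
- by move=> w; rewrite (ft_reflect w i2) normc_conj e1.
- by move=> w; rewrite !(ft_reflect _ i2) c2 rmorphM.
- by exists lam => //; right.
Qed.

End phase_retrieval.

(** * Short-time Fourier transforms as transforms of windowed functions *)

Section windowed.
Context {R : realType}.
Notation mu := (@lebesgue_measure R).
Implicit Types (f g h u : R -> R[i]) (w x y t : R) (z : R[i]).

Lemma locint_locally f : locally_integrable setT (fun x => complex.Re (f x)) ->
  locally_integrable setT (fun x => complex.Im (f x)) -> cmeas setT f /\ locint f.
Proof.
move=> [m1 _ k1] [m2 _ k2]; split; first by split.
have key (q : R -> R) a b : measurable_fun setT q ->
    (forall K, K `<=` setT -> compact K -> (\int[mu]_(x in K) `|q x|%:E < +oo)%E) ->
    mu.-integrable `]a, b[%classic (fun x => (q x)%:E).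
  move=> mq hK; apply: (@integrableS _ _ _ mu `[a, b]%classic); [exact: measurable_itv|exact: measurable_itv| |].
    by move=> x /=; rewrite !in_itv /= => /andP[/ltW-> /ltW->].
  apply/integrableP; split; first by apply/measurable_EFinP; exact: measurable_funTS.
  exact: (hK _ (@subsetT _ _) (@segment_compact _ a b)).
by move=> a b; split; exact: key.
Qed.

(** The open sets in [ess_supp] form an uncountable family; intervals with rational endpoints,
    enumerated by [unpickle], reduce the union to a countable one. *)
Lemma ess_supp_ae (phi : R -> R[i]) B : ess_supp phi `<=` [set x | - B <= x <= B] ->
  {ae mu, forall x, B < `|x| -> phi x = 0}.
Proof.
move=> hs.
pose P (pq : rat * rat) := {ae mu, forall x, ratr pq.1 < x < ratr pq.2 -> phi x = 0}.
pose Q n x := forall pq, unpickle n = Some pq -> P pq -> ratr pq.1 < x < ratr pq.2 -> phi x = 0.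
have hQ n : {ae mu, forall x, Q n x}.
  rewrite /Q; case: (unpickle n) => [pq|]; last by apply: ae_all.
  have [Pp|nP] := pselect (P pq).
    by apply: ae_mono Pp => x hx _ [<-] _.
  by apply: ae_all => x _ [<-] /nP.
apply: ae_mono (ae_foralln hQ) => x hx xB.
have : (~` ess_supp phi) x.
  by move=> /hs /= /andP[h1 h2]; move: xB; rewrite ltNge ler_norml h1 h2.
rewrite /ess_supp setCK => -[U [oU hU] Ux].
have /nbhs_ballP[e /= e0 hb] : nbhs x U by exact: open_nbhs_nbhs.
have [p] := @rat_in_itvoo R (x - e) x ltac:(by rewrite ltrBlDr ltrDl).
rewrite in_itv /= => /andP[p1 p2].
have [q] := @rat_in_itvoo R x (x + e) ltac:(by rewrite ltrDl).
rewrite in_itv /= => /andP[q1 q2].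
apply: (hx (pickle (p, q)) (p, q)); rewrite ?pickleK//=; last by rewrite p2 q1.
apply: ae_mono hU => y hy /andP[py yq]; apply: hy; apply: hb.
by rewrite /ball /= ltr_distl; lra.
Qed.

Variables (B b : R) (phi psi : R -> R[i]).
Hypotheses (B0 : 0 < B) (iphi : cintegrable phi).
Hypothesis sphi : ess_supp phi `<=` [set x | - B <= x <= B].
Hypothesis psiE : forall x, psi x = phi x * (expi (2 * pi * x * b) - 1).

(** The explicit cut-off is needed because [phi] vanishes outside [[-B, B]] only almost everywhere,
    whereas [supp] is a pointwise condition. *)
Definition win f t x := if `|x| < B then f (x + t) * conjc (phi x) else 0.

Let mphi : cmeas setT phi. Proof. exact: (cintble_meas (D := setT) iphi). Qed.

Lemma win_supp f t : supp B (win f t).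
Proof. by move=> x; rewrite /win leNgt => /negbTE->. Qed.

Lemma cmeas_shift f t : cmeas setT f -> cmeas setT (fun x => f (x + t)).
Proof.
have [mt _] := @mpres_add R t; move=> [m1 m2].
by split; [exact: (measurableT_comp m1 mt)|exact: (measurableT_comp m2 mt)].
Qed.

Lemma prod_cintble f t : cmeas setT f -> stft_defined phi f t ->
  cintble setT (fun x => f (x + t) * conjc (phi x)).
Proof.
move=> mf df.
have i1 : cintble setT (fun x => f (x + t) * phi x).
  have := mpres_cintble (mpres_add t) (df : cintble setT _).
  by apply: cintble_eq => // x _; rewrite addrK.
apply: (cintble_le measurableT _ (cintble_normc measurableT i1)).
  by apply: cmeasM; [exact: cmeas_shift|exact: cmeas_conj].
by move=> x _; rewrite !normcM normc_conj.
Qed.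

Lemma win_ae f t : {ae mu, forall x, win f t x = f (x + t) * conjc (phi x)}.
Proof.
apply: ae_mono (ae_conj (ess_supp_ae sphi) (ae_conj (ae_neq B) (ae_neq (- B)))).
move=> x [p0 [x1 x2]]; rewrite /win; case: ltP => // h.
rewrite p0 ?rmorph0 ?mulr0// lt_neqAle h andbT eq_sym.
by have [x0|x0] := leP 0 x; [rewrite ger0_norm|rewrite ltr0_norm// eqr_oppLR].
Qed.

Lemma win_cintble f t : cmeas setT f -> stft_defined phi f t -> cintble setT (win f t).
Proof.
move=> mf df; have i1 := prod_cintble mf df.
have mi : cmeas setT (fun x => (if x \in `]- B, B[%classic then 1 else 0 : R)%:C).
  apply: cmeas_real; rewrite (_ : (fun x => _) = \1_(`]- B, B[%classic)).
    by apply: measurable_indic; exact: measurable_itv.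
  by apply/funext => x; rewrite indicE; case: (_ \in _).
have : cintble setT (fun x => f (x + t) * conjc (phi x) * (if x \in `]- B, B[%classic then 1 else 0 : R)%:C).
  apply: (cintbleM (M := 1) measurableT i1 mi) => x _.
  by rewrite normc_real; case: ifP => _; rewrite ?normr1 ?normr0.
apply: cintble_eq => // x _; rewrite in_itvoo -ltr_norml /win.
by case: ifP => _; rewrite ?mulr1 ?mulr0.
Qed.

(** A common form for both windows: [q = 1] gives [phi] and [q = cis (b * x) - 1] gives [psi].
    Moving the window to the origin costs the unimodular factor [cis (- (w * t))]. *)
Lemma stft_shift f t w (q : R -> R[i]) : cmeas setT f -> stft_defined phi f t ->
  cmeas setT q -> (forall x, normc (q x) <= 2) ->
  stft (fun x => phi x * q x) f t w =
  ft (fun x => win f t x * conjc (q x)) w * cis (- (w * t)).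
Proof.
move=> mf df mq q2; have i1 := prod_cintble mf df.
have i2 : cintble setT (fun x => f (x + t) * conjc (phi x) * (conjc (q x) * cis (- (w * x)))).
  apply: (cintbleM (M := 2) measurableT i1) => [|x _].
    by apply: cmeasM; [exact: cmeas_conj|under eq_fun do rewrite -mulNr; exact: cmeas_cis].
  by rewrite normcM normc_cis mulr1 normc_conj.
have i3 := cintbleZ (cis (- (w * t))) measurableT i2.
transitivity (cint setT (fun x => f (x + t) * conjc (phi x) * (conjc (q x) * cis (- (w * x))) * cis (- (w * t)))).
  rewrite -(mpres_cint (mpres_add (- t)) i3) /stft.
  apply: eq_cint => x _; rewrite subrK -!mulrA; congr (_ * _).
  rewrite (_ : conjc (phi (x - t) * q (x - t)) = conjc (phi (x - t)) * conjc (q (x - t))); last exact: rmorphM.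
  by rewrite -!mulrA -cisD; congr (_ * (_ * _)); rewrite /cis; congr expi; ring.
rewrite (cintZ _ measurableT i2); congr (_ * _).
have mw : cmeas setT (win f t) by exact: cintble_meas (win_cintble mf df).
apply: ae_eq_cint => //; first exact: cintble_meas i2.
  apply: cmeasM; first by apply: cmeasM => //; exact: cmeas_conj.
  by under eq_fun do rewrite -mulNr; exact: cmeas_cis.
by apply: ae_mono (win_ae f t) => x -> _; rewrite !mulrA.
Qed.

Lemma normc_stft f t w : cmeas setT f -> stft_defined phi f t ->
  normc (stft phi f t w) = normc (ft (win f t) w).
Proof.
move=> mf df; have := @stft_shift f t w (fun=> 1) mf df (cmeas_cst _ _) _.
rewrite (_ : (fun x => phi x * 1) = phi); last by apply/funext => x; rewrite mulr1.
rewrite (_ : (fun x => win f t x * conjc 1) = win f t); last first.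
  by apply/funext => x; rewrite (_ : conjc 1 = 1) ?mulr1//; exact: rmorph1.
move=> -> => [|x]; first by rewrite normcM normc_cis mulr1.
by rewrite normc_real normr1 ler1n.
Qed.

Lemma normc_stft_diff f t w : cmeas setT f -> stft_defined phi f t ->
  normc (stft psi f t w) = normc (ft (win f t) (b + w) - ft (win f t) w).
Proof.
move=> mf df; have iw := win_cintble mf df.
have q2 x : normc (cis (b * x) - 1) <= 2 :> R.
  by apply: le_trans (ler_normcB _ _) _; rewrite normc_cis normc_real normr1.
have mq : cmeas setT (fun x : R => cis (b * x) - 1).
  by apply: cmeasB; [exact: cmeas_cis|exact: cmeas_cst].
have := @stft_shift f t w (fun x => cis (b * x) - 1) mf df mq q2.
rewrite (_ : (fun x => phi x * (cis (b * x) - 1)) = psi); last first.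
  by apply/funext => x; rewrite psiE /cis; congr (_ * (expi _ - 1)); ring.
move=> ->; rewrite normcM normc_cis mulr1; congr normc.
rewrite -(cintB measurableT (ft_cintble (b + w) iw) (ft_cintble w iw)).
apply: eq_cint => x _; rewrite rmorphB rmorph1 -mulrA mulrBl mul1r mulrBr; congr (_ * _ - _).
transitivity (cis (- (b * x)) * cis (- (w * x))); first by congr (_ * _); exact: esym (cisN _).
by rewrite -cisD; congr cis; ring.
Qed.

(** On the window [phi] can be cancelled, and its symmetry turns the reflection of the windowed
    function into the reflection of [g] about [t]; periodicity extends the relation beyond the
    window. *)
Lemma retrieval_at f g t T (om : nat -> R) : 0 < b <= 1 / (2 * B) -> 0 < T <= 2 * B ->
  {ae mu, forall x, conjc (phi (- x)) = phi x} ->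
  {ae mu, forall x, - B <= x <= B -> phi x != 0} ->
  critical_lattice B om \/ supercritical_density B om ->
  cmeas setT f -> cmeas setT g -> aeper T f -> aeper T g ->
  stft_defined phi f t -> stft_defined phi g t ->
  (forall n, (1 <= n)%N -> normc (stft phi f t (om n)) = normc (stft phi g t (om n))) ->
  (forall n, (1 <= n)%N -> normc (stft psi f t (om n)) = normc (stft psi g t (om n))) ->
  exists2 lam, normc lam = 1 & {ae mu, forall x, f x = lam * g x} \/
    {ae mu, forall x, f x = lam * conjc (g (2 * t - x))}.
Proof.
move=> hb hT sym nz hom mf mg pf pg df dg m1 m2.
have pfs : aeper T (fun x => f (x + t)).
  by apply: ae_mono (mpres_ae (mpres_add t) pf) => x; rewrite addrAC.
have [n1|n1|lam nl [hl|hl]] := local_retrieval (om := om) B0 hb (win_cintble mf df) (win_supp f t)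
  (win_cintble mg dg) (win_supp g t) hom.
- by move=> n11; rewrite -(normc_stft _ mf df) -(normc_stft _ mg dg); exact: m1.
- by move=> n11; rewrite -(normc_stft_diff _ mf df) -(normc_stft_diff _ mg dg); exact: m2.
- exists lam => //; left.
  suff h : {ae mu, forall x, f (x + t) = lam * g (x + t)}.
    by apply: ae_mono (mpres_ae (mpres_add (- t)) h) => x; rewrite subrK.
  apply: (periodic_ext hT) => //.
    by apply: ae_mono (mpres_ae (mpres_add t) pg) => x; rewrite addrAC => ->.
  apply: ae_mono (ae_conj hl nz) => x [e1 e2] /andP[x1 x2].
  have px : conjc (phi x) != 0 by rewrite conjc_eq0; apply: e2; rewrite !ltW.
  apply: (mulIf px); move: e1; rewrite /win ltr_norml x1 x2 /= => ->.
  by rewrite mulrA.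
- exists lam => //; right.
  suff h : {ae mu, forall x, f (x + t) = lam * conjc (g (- x + t))}.
    apply: ae_mono (mpres_ae (mpres_add (- t)) h) => x; rewrite subrK => ->.
    by congr (_ * conjc (g _)); ring.
  apply: (periodic_ext hT) => //.
    have := mpres_ae (mpres_comp (mpres_add t) mpres_opp) (aeperN pg).
    by apply: ae_mono => x <-; congr (_ * conjc (g _)); ring.
  apply: ae_mono (ae_conj (ae_conj hl nz) sym) => x [[e1 e2] e3] /andP[x1 x2].
  have px : conjc (phi x) != 0 by rewrite conjc_eq0; apply: e2; rewrite !ltW.
  apply: (mulIf px); move: e1; rewrite /conj_reflect /win normrN ltr_norml x1 x2 /= => ->.
  rewrite -e3 -mulrA; congr (_ * _).
  by rewrite [LHS]rmorphM; congr (_ * _); rewrite e3 -e3.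
Qed.

End windowed.

(** * Two times *)

Section irrational_shift.
Context {R : realType}.
Notation mu := (@lebesgue_measure R).
Implicit Types (f g u v : R -> R[i]) (c : R[i]) (x y s : R) (k m : int).
Variable T : R.
Hypothesis T0 : 0 < T.
Let D : set R := `]0 - T / 2, 0 + T / 2[%classic.
Let mD : measurable D. Proof. exact: measurable_itv. Qed.

Definition coef k u := cint D (fun x => u x * cis (k%:~R * (x / T))).

Lemma cmeas_ek D' k : cmeas D' (fun x => cis (k%:~R * (x / T))).
Proof.
rewrite (_ : (fun x => _) = (fun x => cis (k%:~R / T * x))); first exact: cmeas_cis.
by apply/funext => x; rewrite mulrA mulrAC.
Qed.

Lemma locint_ek u k : locint u -> locint (fun x => u x * cis (k%:~R * (x / T))).
Proof. by move=> iu; apply: (locintM (M := 1) iu (cmeas_ek _ k)) => x; rewrite normc_cis. Qed.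

Lemma aeper_ek u k : aeper T u -> aeper T (fun x => u x * cis (k%:~R * (x / T))).
Proof.
apply: ae_mono => x ->; congr (_ * _).
by rewrite mulrDl divff ?lt0r_neq0// mulrDr mulr1 cisD cis_int mulr1.
Qed.

Lemma locint_shift u s : locint u -> locint (fun x => u (x + s)).
Proof.
move=> iu a b; have h := cintble_cut (iu (a + s) (b + s)).
have := mpres_cintble (mpres_add s) h => h'.
have := cintbleS (measurable_itv `]a, b[) measurableT (@subsetT _ _) h'.
apply: cintble_eq (measurable_itv _) _ => x; rewrite inE /= in_itv /= => /andP[x1 x2].
by rewrite /cut !ltrD2r x1 x2 mulr1.
Qed.

Lemma coef_shift u s k : 0 <= s <= T -> locint u -> aeper T u ->
  coef k (fun x => u (x + s)) = coef k u * cis (- (k%:~R * (s / T))).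
Proof.
move=> hs iu pu; have i1 := locint_ek k iu.
have DE : D = `]0 - T / 2, 0 - T / 2 + T[%classic by rewrite /D (_ : 0 + T / 2 = 0 - T / 2 + T)//; field.
have := periodic_shift (0 - T / 2) hs i1 (aeper_ek k pu); rewrite -DE => e.
rewrite /coef -e -(cintZ _ mD); last exact: (locint_shift s i1).
apply: eq_cint => x _; rewrite -mulrA -cisD; congr (_ * cis _).
by field; rewrite lt0r_neq0.
Qed.

(** Translation multiplies the coefficient of index [k] by a fixed unimodular number, which a
    nonzero coefficient forces to be the eigenvalue. The shift is first reduced modulo [T], where
    [coef_shift] applies. *)
Lemma coef_eigen u (c : R[i]) tau k : locint u -> aeper T u ->
  {ae mu, forall x, u (x + tau) = c * u x} -> coef k u != 0 ->
  c = cis (- (k%:~R * (tau / T))).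
Proof.
move=> iu pu hu ck; have [j] := floor_shift 0 tau T0; rewrite add0r => /andP[j1 j2].
set s := tau + j%:~R * T in j1 j2.
have hs : {ae mu, forall x, u (x + s) = c * u x}.
  apply: ae_mono (ae_conj hu (mpres_ae (mpres_add tau) (aeperMz j pu))) => x [e1 e2].
  by rewrite /s addrA e2 e1.
have sT : 0 <= s <= T by rewrite j1 ltW.
have i1 := locint_ek k iu (0 - T / 2) (0 + T / 2).
have : coef k (fun x => u (x + s)) = coef k u * c.
  have i2 := locint_ek k (locint_shift s iu) (0 - T / 2) (0 + T / 2).
  rewrite -(cintZ _ mD i1); apply: ae_eq_cint => //; first exact: cintble_meas i2.
    exact: cintble_meas (cintbleZ c mD i1).
  by apply: ae_mono hs => x -> _; ring.
rewrite coef_shift// => /(mulfI ck) <-.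
rewrite /s mulrDl mulfK ?lt0r_neq0// mulrDr opprD cisD -intrM -mulrNz cis_int mulr1.
by [].
Qed.

Lemma coef_uniqueness u : locint u -> aeper T u -> (forall k, coef k u = 0) ->
  {ae mu, forall x, u x = 0}.
Proof.
move=> iu pu h0; have := fourier_uniqueness T0 (iu _ _) h0 => hD.
have hT : 0 < T <= 2 * (T / 2) by rewrite T0 /=; lra.
apply: (periodic_ext hT pu); first by apply: ae_all.
apply: ae_mono hD => x hx /andP[x1 x2]; apply: hx.
by rewrite /= in_itv /=; lra.
Qed.

Lemma locint_bounded u M : cmeas setT u -> (forall x, normc (u x) <= M) -> locint u.
Proof.
move=> mu_ uM a b; apply: (cintble_le (g := fun=> M)) => //.
- exact: cmeasS mu_.
- apply: integrableS (continuous_integrable_itv a b (@cst_continuous _ _ M)) => //.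
  by move=> x /=; rewrite !in_itv /= => /andP[/ltW-> /ltW->].
Qed.

Lemma coef_cst0 : coef 0 (fun=> 1) = T%:C.
Proof.
rewrite /coef (@eq_cint _ _ _ (fun=> 1)); last by move=> x _; rewrite mul0r cis0 mul1r.
have h (r : R) : Rintegral mu D (fun=> r) = r * T.
  rewrite Rintegral_cst//= /D lebesgue_measure_itv /= lte_fin.
  have h : 0 - T / 2 < 0 + T / 2 by move: T0; lra.
  by rewrite h /=; congr (_ * _); field.
by apply: complex_ext; rewrite /cint /= h ?mul1r ?mul0r.
Qed.

(** Irrationality makes the eigenvalues attached to distinct indices distinct, so at most one
    coefficient of [u] survives. Modulating [u] by that frequency moves the index to [0] and the
    eigenvalue to [1], which leaves a constant. *)
Lemma irrational_eigen u c tau : locint u -> cmeas setT u -> aeper T u ->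
  (forall k, k%:~R * (tau / T) \is a Num.int -> k = 0) ->
  {ae mu, forall x, u (x + tau) = c * u x} ->
  exists C k, {ae mu, forall x, u x = C * cis (k%:~R * (x / T))}.
Proof.
move=> iu mu_ pu irr hu.
have cis1 k : 1 = cis (- (k%:~R * (tau / T))) -> k = 0.
  move=> /esym/cis_eq1[j hj]; apply: irr.
  by rewrite -(opprK (_ * _)) hj -intrN intr_int.
have i1 : locint (fun _ : R => 1 : R[i]).
  by apply: (@locint_bounded _ 1) => [|x]; [exact: cmeas_cst|rewrite normc_real normr1].
have p1 : aeper T (fun _ : R => 1 : R[i]) by apply: ae_all.
(* The constant function is an eigenvector for the eigenvalue 1, which yields
   the orthogonality of exponentials without computing an integral. *)
have c1 m : m != 0 -> coef m (fun=> 1) = 0.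
  move=> m0; apply/eqP/negPn/negP => h; move/eqP : m0; apply; apply: cis1.
  by apply: coef_eigen h => //; apply: ae_all => x; rewrite mulr1.
have [h|/existsNP[k /eqP ck]] := pselect (forall k, coef k u = 0).
  by exists 0, 0; apply: ae_mono (coef_uniqueness iu pu h) => x ->; rewrite mul0r.
have cE := coef_eigen iu pu hu ck.
pose v x := u x * cis (k%:~R * (x / T)).
have iv : locint v by exact: locint_ek.
have pv : aeper T v by exact: aeper_ek.
have hv : {ae mu, forall x, v (x + tau) = 1 * v x}.
  apply: ae_mono hu => x; rewrite /v => ->.
  rewrite mulrDl mulrDr cisD cE mulrACA -!cisD mul1r mulrC -mulrA -cisD.
  by congr (_ * cis _); ring.
have cv m : m != 0 -> coef m v = 0.
  move=> m0; apply/eqP/negPn/negP => h; move/eqP : m0; apply; apply: cis1.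
  exact: coef_eigen h.
pose C := coef 0 v / T%:C.
have T0C : T%:C != 0 by rewrite -(rmorph0 (real_complex R)) (inj_eq (@complexI R)) lt0r_neq0.
have iD : locint (fun x => v x - 1 * C).
  by move=> a b; apply: cintbleB (measurable_itv _) (iv a b) (cintbleZ C (measurable_itv _) (i1 a b)).
have hw : {ae mu, forall x, v x - 1 * C = 0}.
  apply: coef_uniqueness => // [|m]; first by apply: ae_mono pv => x ->.
  transitivity (coef m v - coef m (fun=> 1) * C).
    have j1 := locint_ek m iv (0 - T / 2) (0 + T / 2).
    have j2 := locint_ek m i1 (0 - T / 2) (0 + T / 2).
    rewrite /coef -(cintZ C mD j2) -(cintB mD j1 (cintbleZ C mD j2)).
    by apply: eq_cint => x _; ring.
  have [->|m0] := eqVneq m 0; last by rewrite cv// c1// mul0r subrr.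
  by rewrite coef_cst0 /C mulrC divfK// subrr.
exists C, (- k); apply: ae_mono hw => x /eqP; rewrite mul1r subr_eq0 => /eqP <-.
by rewrite /v -mulrA -cisD mulrNz mulNr subrr cis0 mulr1.
Qed.

Lemma double_reflection f g t0 t1 (l0 l1 : R[i]) : locint f -> cmeas setT f -> aeper T f ->
  irrational ((t1 - t0) / T) -> normc l0 = 1 -> normc l1 = 1 ->
  {ae mu, forall x, f x = l0 * conjc (g (2 * t0 - x))} ->
  {ae mu, forall x, f x = l1 * conjc (g (2 * t1 - x))} ->
  exists2 lam, normc lam = 1 & {ae mu, forall x, f x = lam * g x}.
Proof.
move=> if_ mf pf irr n0 n1 h0 h1; pose tau := 2 * (t1 - t0).
have l00 : l0 != 0 by rewrite -normc_gt0 n0.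
(* Doubling keeps the ratio irrational: a nonzero [k] with [2 k (t1 - t0) / T = j] would make it
   [j / (2 k)]. *)
have irr' k : k%:~R * (tau / T) \is a Num.int -> k = 0.
  move=> /intrP[j hj]; apply/eqP/negPn/negP => k0; apply: irr.
  exists (j%:~R / (2 * k)%:~R) => //.
  rewrite fmorph_div /= !ratr_int intrM.
  have k0R : k%:~R != 0 :> R by rewrite intr_eq0.
  apply: (mulfI (x := 2%:~R * k%:~R)); first by rewrite mulf_neq0// intr_eq0.
  rewrite mulrC divfK ?mulf_neq0 ?intr_eq0// -hj /tau; ring.
have hu : {ae mu, forall x, f (x + tau) = l1 / l0 * f x}.
  apply: ae_mono (ae_conj h0 (mpres_ae (mpres_add tau) h1)) => x [-> ->].
  rewrite mulrA divfK//; congr (_ * conjc (g _)); rewrite /tau; ring.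
have [C [k fC]] := irrational_eigen if_ mf pf irr' hu.
(* Reflection followed by conjugation maps an exponential to a multiple of the same exponential, so
   [g] has the frequency of [f]. *)
have gC : {ae mu, forall y, g y = l0 * conjc C * cis (- (k%:~R * (2 * t0 / T))) * cis (k%:~R * (y / T))}.
  have sw := mpres_ae (mpres_comp (mpres_add (2 * t0)) mpres_opp).
  apply: ae_mono (ae_conj (sw _ h0) (sw _ fC)) => y [e1 e2].
  move: e1; rewrite e2 (_ : 2 * t0 - (- y + 2 * t0) = y); last by ring.
  move=> /(congr1 (fun z => l0 * conjc z)).
  rewrite [in RHS]conjcM conjcK mulrA mulc_conj n0 expr1n mul1r => <-.
  rewrite conjcM -!mulrA; congr (_ * (_ * _)).
  rewrite -cisD -[LHS]cisN; congr cis; field; exact: lt0r_neq0.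
have [C0|C0] := eqVneq C 0.
  exists 1; first by rewrite normc_real normr1.
  by apply: ae_mono (ae_conj fC gC) => x [-> ->]; rewrite C0 rmorph0 mulr0 !mul0r mulr0.
pose d := l0 * conjc C * cis (- (k%:~R * (2 * t0 / T))).
have nd : normc d = normc C by rewrite !normcM n0 normc_conj normc_cis mul1r mulr1.
have d0 : d != 0 by rewrite -normc_gt0 nd normc_gt0.
exists (C / d); first by rewrite normcM normcV nd divff// lt0r_neq0// normc_gt0.
by apply: ae_mono (ae_conj fC gC) => x [-> ->]; rewrite -/d [RHS]mulrA divfK.
Qed.

End irrational_shift.

(** * Failure at rational ratios *)

Section rational_shift.
Context {R : realType}.
Notation mu := (@lebesgue_measure R).
Implicit Types (f g phi : R -> R[i]) (x w t : R).

(** The substitution [x |-> 2 t - x] and the symmetry of the window turn the transform of the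
    reflected function into the conjugate of that of [f], up to a unimodular factor. *)
Lemma normc_stft_reflect phi f t w : stft_defined phi f t -> cmeas setT phi -> cmeas setT f ->
  {ae mu, forall x, conjc (phi (- x)) = phi x} ->
  normc (stft phi (fun x => conjc (f (2 * t - x))) t w) = normc (stft phi f t w).
Proof.
move=> df mphi mf sym.
have mpt : cmeas setT (fun x => conjc (phi (x - t))) by apply: cmeas_conj; exact: cmeas_shift.
pose F x := f x * conjc (phi (x - t)) * expi (- (2 * pi * x * w)).
have me : cmeas setT (fun x : R => expi (- (2 * pi * x * w))).
  apply: cmeas_expi; apply: measurableT_comp; first exact: oppr_measurable.
  by do ?[exact: measurable_cst|exact: measurable_id|apply: measurable_funM].
have mF : cmeas setT F by apply: cmeasM => //; exact: cmeasM.
have iF : cintble setT F.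
  apply: (cintble_le measurableT mF (cintble_normc measurableT df)) => x _.
  by rewrite !normcM normc_expi mulr1 normc_conj.
have ps : mpres (fun x : R => - x + 2 * t) := mpres_comp (mpres_add (2 * t)) mpres_opp.
have iF' := cintbleZ (cis (- (2 * t * w))) measurableT (cintble_conj measurableT iF).
have mr : cmeas setT (fun x => conjc (f (2 * t - x)) * conjc (phi (x - t)) * expi (- (2 * pi * x * w))).
  apply: cmeasM me; apply: cmeasM mpt; apply: cmeas_conj.
  have [mp _] := ps; have [m1 m2] := mf.
  by split; under eq_fun do rewrite addrC; [exact: (measurableT_comp m1 mp)|exact: (measurableT_comp m2 mp)].
have -> : stft phi (fun x => conjc (f (2 * t - x))) t w = conjc (stft phi f t w) * cis (- (2 * t * w)).
  change (cint setT (fun x => conjc (f (2 * t - x)) * conjc (phi (x - t)) * expi (- (2 * pi * x * w))) =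
    conjc (cint setT F) * cis (- (2 * t * w))).
  rewrite -(cint_conj measurableT iF).
  rewrite -(cintZ _ measurableT (cintble_conj measurableT iF)) -(mpres_cint ps iF').
  apply: ae_eq_cint => //; first exact: cintble_meas (mpres_cintble ps iF').
  have sy := mpres_ae (mpres_add (- t)) sym.
  apply: ae_mono sy => x sx _; rewrite /F !conjcM conjcK.
  rewrite (_ : - x + 2 * t - t = - (x - t)); last by ring.
  rewrite (_ : - x + 2 * t = 2 * t - x); last by ring.
  have -> : phi (- (x - t)) = conjc (phi (x - t)) by rewrite -sx conjcK.
  rewrite -!mulrA; congr (_ * (_ * _)).
  by rewrite -expiN /cis -expiD; congr expi; ring.
by rewrite normcM normc_conj normc_cis mulr1.
Qed.

Lemma stft_defined_bounded phi f t M : cintegrable phi -> cmeas setT f ->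
  (forall x, normc (f x) <= M) -> stft_defined phi f t.
Proof.
move=> ip mf fM.
have i1 : cintble setT (fun x => phi (x - t)) := mpres_cintble (mpres_add (- t)) ip.
apply: (cintble_eq measurableT _ (cintbleM measurableT i1 mf (fun x _ => fM x))) => x _.
by rewrite mulrC.
Qed.

Lemma L1_periodic_bounded T f M : cmeas setT f -> (forall x, normc (f x) <= M) ->
  (forall x, f (x + T) = f x) -> L1_periodic T f.
Proof.
move=> mf fM pf; have lf := locint_bounded mf fM; have [m1 m2] := mf.
have key (q : R -> R) : measurable_fun setT q -> (forall x, `|q x| <= M) -> locally_integrable setT q.
  move=> mq qM; split => //; first exact: openT.
  move=> K _ cK; have [a [_ hK]] := compact_bounded cK.
  have aK x : K x -> - (a + 1) <= x <= a + 1.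
    by move=> Kx; rewrite -ler_norml; apply: hK => //; rewrite ltrDl.
  have mK : measurable K by apply: closed_measurable; apply: compact_closed.
  pose I : set R := `[- (a + 1), a + 1]%classic.
  apply: (@le_lt_trans _ _ (\int[mu]_(x in I) `|q x|%:E)%E).
    apply: ge0_subset_integral => //.
    - exact: measurable_itv.
    - by apply/measurable_EFinP; apply: measurableT_comp => //; exact: measurable_funTS.
  have : mu.-integrable I (fun x => (q x)%:E).
    apply: le_integrable (continuous_integrable_itv _ _ (@cst_continuous _ _ M)) => //.
      by apply/measurable_EFinP; exact: measurable_funTS.
    by move=> x _; rewrite lee_fin; apply: le_trans (qM x) (ler_norm _).
  by move=> /integrableP[].
split; [| |exact: ae_all].
- by apply: key => // x; apply: le_trans (Re_le_normc _) (fM x).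
- by apply: key => // x; apply: le_trans (Im_le_normc _) (fM x).
Qed.

Lemma normC_eq (z1 z2 : R[i]) : `|z1| = `|z2| -> normc z1 = normc z2.
Proof. by rewrite !normc_norm => /complexI. Qed.

Lemma cis_half : cis (2^-1) = -1 :> R[i].
Proof. by rewrite /cis mulrAC divff// mul1r expi_pi. Qed.

Lemma rational_counterexample (b T t0 t1 : R) (phi psi : R -> R[i]) (om : nat -> R) :
  cintegrable phi -> {ae mu, forall x, conjc (phi (- x)) = phi x} ->
  (forall x, psi x = phi x * (expi (2 * pi * x * b) - 1)) -> 0 < T ->
  rational ((t1 - t0) / T) ->
  exists f, [/\ L1_periodic T f, stft_defined phi f t0, stft_defined phi f t1 &
    ~ determined_up_to_phase T phi psi om t0 t1 f].
Proof.
move=> iphi sym psiE T0 [p _ hp].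
pose q : R := (denq p)%:~R; pose n := numq p.
have q0 : q != 0 by rewrite intr_eq0 denq_eq0.
have qn : q * (t1 - t0) = n%:~R * T.
  have : ratr p = n%:~R / q :> R by [].
  rewrite hp => h; rewrite -[t1 - t0](divfK (lt0r_neq0 T0)) h.
  by field.
pose e x := cis (q * ((x - t0) / T)).
pose J : R[i] := 0 +i* 1.
have nJ : normc J = 1 by rewrite normc_imag normr1.
have cJ : conjc J = - J by apply: complex_ext => /=; rewrite ?oppr0.
(* Since [J] is the imaginary unit, reflection about [t0] with conjugation changes the sign of the
   second term and gives [g]. The same holds about [t1], because [e] is unchanged by the translation
   by [2 (t1 - t0)], which is [2 n] of its periods [T / q]. *)
pose f x := 1 + J * e x; pose g x := 1 - J * e x.
have me : cmeas setT e.
  rewrite (_ : e = (fun x => cis (q / T * x) * cis (- (q * (t0 / T))))).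
    by apply: cmeasM; [exact: cmeas_cis|exact: cmeas_cst].
  by apply/funext => x; rewrite -cisD /e; congr cis; ring.
have mf : cmeas setT f.
  by apply: cmeasD; [exact: cmeas_cst|apply: cmeasM => //; exact: cmeas_cst].
have mg : cmeas setT g.
  by apply: cmeasB; [exact: cmeas_cst|apply: cmeasM => //; exact: cmeas_cst].
have n1 : normc (1 : R[i]) = 1 by rewrite normc_real normr1.
have fb x : normc (f x) <= 2.
  by apply: le_trans (le_normcD _ _) _; rewrite normcM nJ normc_cis n1 mul1r.
have gb x : normc (g x) <= 2.
  by apply: le_trans (ler_normcB _ _) _; rewrite normcM nJ normc_cis n1 mul1r.
have eT x : e (x + T) = e x.
  rewrite /e (_ : q * _ = q * ((x - t0) / T) + q); last by field; rewrite lt0r_neq0.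
  by rewrite cisD cis_int mulr1.
have cf y : conjc (f y) = 1 - J * conjc (e y).
  transitivity (conjc 1 + conjc (J * e y)); first exact: rmorphD.
  by rewrite conjcM cJ mulNr; congr (_ - _); exact: rmorph1.
have gf0 : g = (fun x => conjc (f (2 * t0 - x))).
  apply/funext => x; rewrite cf /g; congr (_ - _ * _).
  by rewrite /e -cisN; congr cis; ring.
have gf1 : g = (fun x => conjc (f (2 * t1 - x))).
  apply/funext => x; rewrite cf /g; congr (_ - _ * _).
  rewrite /e -cisN.
  rewrite (_ : - (q * _) = q * ((x - t0) / T) - (2 * (q * (t1 - t0))) / T); last by ring.
  have -> : 2 * (q * (t1 - t0)) / T = (2 * n)%:~R by rewrite qn intrM; field; exact: lt0r_neq0.
  by rewrite -mulrNz cisD cis_int mulr1.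
have df t : stft_defined phi f t by exact: stft_defined_bounded fb.
have dg t : stft_defined phi g t by exact: stft_defined_bounded gb.
have mphi : cmeas setT phi by exact: (cintble_meas (D := setT) iphi).
have mk : cmeas setT (fun x : R => expi (2 * pi * x * b) - 1).
  apply: cmeasB; last exact: cmeas_cst.
  by apply: cmeas_expi; do ?[exact: measurable_cst|exact: measurable_id|apply: measurable_funM].
have psiE' : psi = (fun x => phi x * (expi (2 * pi * x * b) - 1)) by exact/funext.
have mpsi : cmeas setT psi by rewrite psiE'; exact: cmeasM.
have ipsi : cintegrable psi.
  rewrite psiE'; apply: (cintbleM (M := 2) measurableT (iphi : cintble setT phi) mk) => x _.
  by apply: le_trans (ler_normcB _ _) _; rewrite normc_expi n1.
(* The factor [expi (2 pi x b) - 1] is itself invariant under reflection with conjugation, so [psi]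
   inherits the symmetry of [phi]. *)
have sypsi : {ae mu, forall x, conjc (psi (- x)) = psi x}.
  apply: ae_mono sym => x; rewrite !psiE conjcM => ->; congr (_ * _).
  transitivity (conjc (expi (2 * pi * - x * b)) - conjc 1); first exact: rmorphB.
  by rewrite -expiN; congr (expi _ - _); [ring|exact: rmorph1].
have fT x : f (x + T) = f x by rewrite /f eT.
have gT x : g (x + T) = g x by rewrite /g eT.
exists f; split; [exact: L1_periodic_bounded mf fb fT|exact: df|exact: df|].
move=> /(_ g) []; first exact: L1_periodic_bounded mg gb gT.
- by move=> t _; split=> //; exact: stft_defined_bounded gb.
- have h (ph : R -> R[i]) t w : g = (fun x => conjc (f (2 * t - x))) -> cintegrable ph ->
      cmeas setT ph -> {ae mu, forall x, conjc (ph (- x)) = ph x} ->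
      `|stft ph f t w| = `|stft ph g t w|.
    move=> -> iph mph sph.
    have e1 := normc_stft_reflect w (stft_defined_bounded t iph mf fb) mph mf sph.
    by rewrite !normc_norm e1.
  by move=> t [->|->] m _; split; apply: h.
- move=> lam [_ hl].
  (* Half a period of [e], after which [e] changes sign and [f], [g] exchange values. Comparing
     [f = lam g] at [x] and [x + s] gives [lam = 1] and then [e x = 0], which is impossible. *)
  pose s := T / (2 * q).
  have es x : e (x + s) = - e x.
    rewrite /e (_ : q * _ = q * ((x - t0) / T) + 2^-1).
      by rewrite cisD cis_half mulrN1.
    by rewrite /s; field; rewrite q0 lt0r_neq0.
  have [x [e1 e2]] := ae_ex (ae_conj hl (mpres_ae (mpres_add s) hl)).
  move: e1 e2; rewrite /f /g es mulrN opprK => e1 e2.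
  have two : (2 : R[i]) != 0 by rewrite pnatr_eq0.
  have l1 : lam = 1.
    apply: (mulIf two); transitivity (lam * (1 - J * e x) + lam * (1 + J * e x)); first by ring.
    by rewrite -e1 -e2; ring.
  have : 2 * (J * e x) = 0.
    by rewrite (_ : 2 * _ = (1 + J * e x) - (1 - J * e x)); [rewrite e1 l1 mul1r subrr|ring].
  move/eqP; rewrite !mulf_eq0 (negbTE two) (negbTE (expi_neq0 _)) orbF => /eqP J0.
  by move: nJ; rewrite J0 normc0 => /eqP; rewrite eq_sym oner_eq0.
Qed.

End rational_shift.

Theorem theorem4p1 (R : realType) (B : R) (phi psi : R -> R[i]) (b : R)
    (omega : nat -> R) (T t0 t1 : R)
    (hB : 0 < B)
    (hphi : cintegrable phi)
    (hsupp : ess_supp phi `<=` [set x | - B <= x <= B])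
    (hsym : {ae (@lebesgue_measure R), forall x, conjc (phi (- x)) = phi x})
    (hnz : {ae (@lebesgue_measure R), forall x, - B <= x <= B -> phi x != 0})
    (hb : 0 < b <= 1 / (2 * B))
    (hpsi : forall x, psi x = phi x * (expi (2 * pi * x * b) - 1))
    (homega : critical_lattice B omega \/ supercritical_density B omega)
    (hT : 0 < T <= 2 * B) :
  (irrational ((t1 - t0) / T) ->
     forall f : R -> R[i], L1_periodic T f ->
       stft_defined phi f t0 -> stft_defined phi f t1 ->
       determined_up_to_phase T phi psi omega t0 t1 f) /\
  (rational ((t1 - t0) / T) ->
     exists f : R -> R[i],
       [/\ L1_periodic T f,
           stft_defined phi f t0, stft_defined phi f t1 &
           ~ determined_up_to_phase T phi psi omega t0 t1 f]).
Proof.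
have /andP[T0 _] := hT.
split; last by move=> hr; exact: rational_counterexample hphi hsym hpsi T0 hr.
move=> irr f [f1 f2 pf] df0 df1 g [g1 g2 pg] dg hm.
have [mf lf] := locint_locally f1 f2; have [mg lg] := locint_locally g1 g2.
suff [lam nl hl] : exists2 lam, normc lam = 1 & {ae (@lebesgue_measure R), forall x, f x = lam * g x}.
  by exists lam; rewrite normc_norm nl.
have at_t t : t = t0 \/ t = t1 -> stft_defined phi f t ->
    exists2 lam, normc lam = 1 & {ae (@lebesgue_measure R), forall x, f x = lam * g x} \/
      {ae (@lebesgue_measure R), forall x, f x = lam * conjc (g (2 * t - x))}.
  move=> ht df; have [dgt _] := dg t ht.
  apply: (retrieval_at hB hphi hsupp hpsi hb hT hsym hnz homega mf mg pf pg df dgt) => n hn.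
    by apply: normC_eq; case: (hm t ht n hn).
  by apply: normC_eq; case: (hm t ht n hn).
(* The direct alternative at either time already proves the claim; irrationality is called upon only
   when both times give reflections. *)
have [l0 n0 [h0|h0]] := at_t t0 (or_introl erefl) df0; first by exists l0.
have [l1 n1 [h1|h1]] := at_t t1 (or_intror erefl) df1; first by exists l1.
exact: (double_reflection T0 lf mf pf irr n0 n1 h0 h1).
Qed.
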